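(* Let $G=\mathbb{Z}/p\mathbb{Z}\rtimes\mathbb{Z}/m\mathbb{Z}$ with $p$ prime and $p\nmid m$, let $k$ be algebraically closed of characteristic $p$, and let $\gamma\in(\mathbb{Z}/m\mathbb{Z})^{\times}$. Let $V_{d,s}$ be an indecomposable $d$-dimensional representation of $G$ over $k$. Then the $\mathbf{v}$-function $\mathbf{v}_{V_{d,s},\gamma}:\Delta_{G,\gamma}\to\frac1m\mathbb{Z}$ is given by $$\mathbf{v}_{V_{d,s},\gamma}(x)=\begin{cases}0 & x\text{ is trivial},\\ \displaystyle\sum_{(i,j)\in I_{\gamma,r,s}}\frac{i}{m}+\sum_{(i,j)\in I_{\gamma,r,s}}\left\lceil\frac{-ip+jr}{mp}\right\rceil&\text{otherwise},\end{cases}$$ where, for $x$ corresponding to the $G$-extension $L/k((t))$, $r$ is the last (lower) ramification jump of $L/k((t))$ and $$I_{\gamma,r,s}=\{(i,j)\in\{0,\dots,m-1\}\times\{0,\dots,d-1\}: i-rj\equiv s\gamma^{-1}\pmod m\},$$ a set with $d$ elements. Moreover, if $V=\bigoplus_{\lambda=1}^{l}V_{d_\lambda,s_\lambda}$ is a decomposition of a representation $V$ into indecomposables, then $\mathbf{v}_{V,\gamma}=\sum_{\lambda=1}^{l}\mathbf{v}_{V_{d_\lambda,s_\lambda},\gamma}$.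
   Context: Setting: $K=k((t))$; fixed primitive roots of unity $\zeta_n\in k$ ($p\nmid n$) with $\zeta_{m'n}^n=\zeta_{m'}$. $G=\langle\sigma\rangle\rtimes\langle\tau\rangle$, $\sigma^p=\tau^m=1$, $\tau\sigma\tau^{-1}=\sigma^{a(G)}$, $a(G)\in(\mathbb{Z}/p\mathbb{Z})^\times=\mathbb{F}_p^\times\subset k^\times$. A $G$-extension is a Galois field extension $L/K$ with group identified with $G$. Extensions: for a $G$-extension $L/K$, put $F=L^{\sigma}=K(\alpha)$ with $\alpha=t^{1/m}$, and $L=F(\beta)$ where $\beta$ satisfies an Artin–Schreier equation over $F$; generators are chosen so that $\sigma(\alpha)=\alpha$, $\sigma(\beta)=\beta+1$, $\tau(\alpha)=\zeta_m^{\gamma}\alpha$, $\tau(\beta)=\zeta_m^{-\gamma r}\beta$, with $\gamma\in(\mathbb{Z}/m\mathbb{Z})^\times$, $v_L(\alpha)=p$, $v_L(\beta)=-r$, where $r$ (prime to $p$) is the lower ramification jump: $v_L(\sigma(\pi)-\pi)=r+1$ for a uniformiser $\pi$ of $L$. $\Delta_{G,\gamma}$ is the space of $G$-torsors over $\operatorname{Spec}K$ corresponding to $G$-extensions with this value of $\gamma$. Representations: for $1\le d\le p$ and $s\in\mathbb{Z}/m\mathbb{Z}$, $V_{d,s}$ is the indecomposable $d$-dimensional representation whose coordinates $x_1,\dots,x_d$ satisfy $\sigma(x_i)=x_i+x_{i+1}$ ($i<d$), $\sigma(x_d)=x_d$, $\tau(x_1)=\zeta_m^s x_1$. $\mathbf{v}$-function: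 for a $d$-dimensional representation $V$ with coordinates $x_1,\dots,x_d$ and a $G$-étale $K$-algebra $M$ with $\mathcal{O}_M$ the integral closure of $\mathcal{O}_K=k[[t]]$ in $M$, the tuning module $\Xi_M\subset\mathcal{O}_M^{\oplus d}$ is the set of $(c_1,\dots,c_d)$ such that the $k$-linear map $x_i\mapsto c_i$ is $G$-equivariant (equivalently, the submodule on which the diagonal action from $\mathcal O_M$ and the action through $G\to GL_d(k)\to GL_d(\mathcal O_M)$ coincide); it is free of rank $d$ over $k[[t]]$. Then $\mathbf{v}_V(M)=\frac{1}{\#G}\operatorname{length}_{\mathcal{O}_K}\mathcal{O}_M^{\oplus d}/(\mathcal{O}_M\cdot\Xi_M)$; $\mathbf{v}_{V,\gamma}$ is its restriction to $\Delta_{G,\gamma}$. *)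

(* Defs.v *)
From HB Require Import structures.
From mathcomp Require Import all_boot all_order all_algebra.
From mathcomp Require Import all_fingroup all_field all_character.
From mathcomp Require Import boolp classical_sets constructive_ereal.

Set Implicit Arguments.
Unset Strict Implicit.
Unset Printing Implicit Defensive.

Import GRing.Theory.
Local Open Scope ring_scope.

Record fps (k : fieldType) := FPS { fps_coef : nat -> k }.

HB.instance Definition _ (k : fieldType) := gen_eqMixin (fps k).
HB.instance Definition _ (k : fieldType) := gen_choiceMixin (fps k).

Section PowerSeries.
Variable k : fieldType.
Implicit Types f g h : fps k.

Lemma fpsP f g : fps_coef f =1 fps_coef g -> f = g.
Proof. by case: f g => [f] [g] /= /funext ->. Qed.

Definition fps_zero : fps k := FPS (fun=> 0).
Definition fps_opp f : fps k := FPS (fun n => - fps_coef f n).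
Definition fps_add f g : fps k := FPS (fun n => fps_coef f n + fps_coef g n).
Definition fps_const (c : k) : fps k :=
  FPS (fun n => if n == 0%N then c else 0).
Definition fps_one : fps k := fps_const 1.
Definition fps_mul f g : fps k :=
  FPS (fun n => \sum_(i < n.+1) fps_coef f i * fps_coef g (n - i)).

Fact fps_addA : associative fps_add.
Proof. by move=> f g h; apply: fpsP => n /=; rewrite addrA. Qed.

Fact fps_addC : commutative fps_add.
Proof. by move=> f g; apply: fpsP => n /=; rewrite addrC. Qed.

Fact fps_add0 : left_id fps_zero fps_add.
Proof. by move=> f; apply: fpsP => n /=; rewrite add0r. Qed.

Fact fps_addN : left_inverse fps_zero fps_opp fps_add.
Proof. by move=> f; apply: fpsP => n /=; rewrite addNr. Qed.

HB.instance Definition _ :=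
  GRing.isZmodule.Build (fps k) fps_addA fps_addC fps_add0 fps_addN.

Definition fps_trunc (N : nat) f : {poly k} := \poly_(i < N) fps_coef f i.

Lemma coef_fps_trunc N f i : (i < N)%N -> (fps_trunc N f)`_i = fps_coef f i.
Proof. by move=> iN; rewrite coef_poly iN. Qed.

Lemma fps_mul_trunc N f g n : (n < N)%N ->
  fps_coef (fps_mul f g) n = (fps_trunc N f * fps_trunc N g)`_n.
Proof.
move=> nN; rewrite coefM; apply: eq_bigr => i _.
rewrite !coef_fps_trunc // (leq_ltn_trans _ nN) ?leq_subr //.
by rewrite -ltnS.
Qed.

Fact fps_mulA : associative fps_mul.
Proof.
move=> f g h; apply: fpsP => n.
pose T := fps_trunc n.+1.
have E1 : fps_coef (fps_mul f (fps_mul g h)) n = (T f * (T g * T h))`_n.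
  rewrite coefM; apply: eq_bigr => i _.
  rewrite coef_fps_trunc ?ltn_ord // (@fps_mul_trunc n.+1) //.
  by rewrite ltnS leq_subr.
have E2 : fps_coef (fps_mul (fps_mul f g) h) n = (T f * T g * T h)`_n.
  rewrite coefM; apply: eq_bigr => i _.
  rewrite (@coef_fps_trunc n.+1 h) ?ltnS ?leq_subr //.
  by rewrite (@fps_mul_trunc n.+1) ?ltn_ord.
by rewrite E1 E2 mulrA.
Qed.

Fact fps_mulC : commutative fps_mul.
Proof.
by move=> f g; apply: fpsP => n; rewrite !(@fps_mul_trunc n.+1) // mulrC.
Qed.

Fact fps_mul1 : left_id fps_one fps_mul.
Proof.
move=> f; apply: fpsP => n /=.
rewrite big_ord_recl /= mul1r subn0 big1 ?addr0 // => i _.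
by rewrite mul0r.
Qed.

Fact fps_mulDl : left_distributive fps_mul fps_add.
Proof.
move=> f g h; apply: fpsP => n /=.
by rewrite -big_split; apply: eq_bigr => i _; rewrite mulrDl.
Qed.

Fact fps_one_neq0 : fps_one != 0.
Proof.
by apply/eqP => /(congr1 (fun f => fps_coef f 0)) /eqP /=; rewrite oner_eq0.
Qed.

HB.instance Definition _ := GRing.Zmodule_isComNzRing.Build (fps k)
  fps_mulA fps_mulC fps_mul1 fps_mulDl fps_one_neq0.

Definition fps_unit : pred (fps k) := fun f => `[< exists g, g * f = 1 >].
Definition fps_inv f : fps k :=
  if pselect (exists g, g * f = 1) is left h then projT1 (cid h) else f.

Fact fps_mulV : {in fps_unit, left_inverse 1 fps_inv *%R}.
Proof.
move=> f /asboolP uf; rewrite /fps_inv.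
by case: pselect => // h; case: cid.
Qed.

Fact fps_unitP f g : g * f = 1 -> fps_unit f.
Proof. by move=> gf; apply/asboolP; exists g. Qed.

Fact fps_inv_out : {in [predC fps_unit], fps_inv =1 id}.
Proof.
move=> f /negP nuf; rewrite /fps_inv; case: pselect => // h.
by case: nuf; apply/asboolP.
Qed.

HB.instance Definition _ := GRing.ComNzRing_hasMulInverse.Build (fps k)
  fps_mulV fps_unitP fps_inv_out.

Lemma fps_neq0_lead f : f != 0 ->
  exists2 n, fps_coef f n != 0 & forall i, (i < n)%N -> fps_coef f i = 0.
Proof.
move=> f0; have ex : exists n, fps_coef f n != 0.
  apply/not_existsP => f0'; case/eqP: f0; apply: fpsP => n /=.
  by apply/eqP/negPn/negP/f0'.
case: (ex_minnP ex) => n fn min_n; exists n => // i lt_in.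
by apply/eqP; apply: contraTT lt_in => /min_n; rewrite -leqNgt.
Qed.

Fact fps_idomain : GRing.integral_domain_axiom (fps k).
Proof.
move=> f g fg0; apply/norP => -[f0 g0].
have [n fn ltn] := fps_neq0_lead f0; have [l gl ltl] := fps_neq0_lead g0.
have: fps_coef (f * g) (n + l) = 0 by rewrite fg0.
have n_lt : (n < (n + l).+1)%N by rewrite ltnS leq_addr.
rewrite /= (bigD1 (Ordinal n_lt)) //= addKn big1 => [|i i_n].
  by rewrite addr0 => /eqP; rewrite mulf_eq0 (negPf fn) (negPf gl).
have [lt_in|] := ltnP i n; first by rewrite ltn ?mul0r.
rewrite leq_eqVlt => /orP[/eqP n_i|lt_ni].
  by case/eqP: i_n; apply: val_inj; rewrite /= -n_i.
rewrite (ltl (n + l - i)%N) ?mulr0 // ltn_subLR ?ltn_add2r //.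
by rewrite -ltnS ltn_ord.
Qed.

HB.instance Definition _ :=
  GRing.ComUnitRing_isIntegral.Build (fps k) fps_idomain.

Definition fps_t : fps k := FPS (fun n => if n == 1%N then 1 else 0).

End PowerSeries.

Definition laurent (k : fieldType) : fieldType := {fraction fps k}.

Definition ring_emb (k : fieldType) (A : comAlgType (laurent k)) (f : fps k) : A :=
  (tofrac f : laurent k)%:A.

Definition base_emb (k : fieldType) (A : comAlgType (laurent k)) (c : k) : A :=
  ring_emb A (fps_const c).

Definition laurent_t (k : fieldType) : laurent k := tofrac (fps_t k).

Definition int_closure (k : fieldType) (A : comAlgType (laurent k)) : set A :=
  [set x | integralOver (ring_emb A) x].
Arguments int_closure {k} A _.

Section Length.
Variables (k : fieldType) (A : comAlgType (laurent k)) (d : nat).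
Implicit Types (N P S : set 'cV[A]_d).

Definition fps_submodule S : Prop :=
  [/\ S 0, forall x y, S x -> S y -> S (x + y) &
      forall (f : fps k) x, S x -> S (ring_emb A f *: x)].

(** The k[[t]]-submodules of P / N are the k[[t]]-submodules between N and P,
    so this is a strictly increasing chain of n + 1 submodules of P / N. *)
Definition submodule_chain N P (n : nat) : Prop :=
  exists S : nat -> set 'cV[A]_d,
    [/\ forall i, (i <= n)%N -> fps_submodule (S i),
        N `<=` S 0%N, S n `<=` P &
        forall i, (i < n)%N -> S i `<` S i.+1]%classic.

Definition is_quotient_length N P (n : nat) : Prop :=
  submodule_chain N P n /\ forall n', submodule_chain N P n' -> (n' <= n)%N.

Definition quotient_length N P : \bar rat :=
  if `[< exists n, is_quotient_length N P n >]
  then ((xget 0%N [set n | is_quotient_length N P n]%classic)%:R)%:E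
  else +oo%E.

End Length.

Record Galgebra (k : fieldType) (gT : finGroupType) := GAlgebra {
  Galg :> comAlgType (laurent k);
  Gact : gT -> Galg -> Galg;
  Gact_linear : forall g, linear (Gact g);
  Gact_monoid : forall g, monoid_morphism (Gact g);
  Gact1 : forall x, Gact 1%g x = x;
  GactM : forall g h x, Gact (g * h)%g x = Gact g (Gact h x)
}.

(** The trivial G-torsor over Spec k((t)): A is isomorphic to the algebra of all
    functions G -> k((t)), on which G acts by (g f)(h) = f(hg). *)
Definition trivial_torsor (k : fieldType) (gT : finGroupType)
    (A : Galgebra k gT) : Prop :=
  exists phi : A -> {ffun gT -> laurent k},
    [/\ bijective phi,
        forall a x y h, phi (a *: x + y) h = a * phi x h + phi y h,
        forall h, phi 1 h = 1,
        forall x y h, phi (x * y) h = phi x h * phi y h &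
        forall g x h, phi (Gact g x) h = phi x (h * g)%g].

(** Composition in MathComp's galois groups is reversed, (x * y) a = y (x a),
    whence the form of Gext_M: G acts on L on the left. *)
Record Gextension (k : fieldType) (gT : finGroupType) := GExtension {
  Gext :> splittingFieldType (laurent k);
  Gext_galois : galois 1 {: Gext};
  Gext_gal : gT -> gal_of {: Gext};
  Gext_inj : injective Gext_gal;
  Gext_im : [set Gext_gal g | g in [set: gT]]%SET = 'Gal({: Gext} / 1%AS)%g;
  Gext_M : forall g h x, Gext_gal (g * h)%g x = Gext_gal g (Gext_gal h x)
}.

Section GextAlgebra.
Variables (k : fieldType) (gT : finGroupType) (E : Gextension k gT).

Fact Gext_linear (g : gT) : linear (Gext_gal E g : E -> E).
Proof. by move=> a x y; rewrite linearP. Qed.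

Fact Gext_monoid (g : gT) : monoid_morphism (Gext_gal E g : E -> E).
Proof. by split; [rewrite rmorph1 | move=> x y; rewrite rmorphM]. Qed.

Fact Gext_1 (x : E) : Gext_gal E 1%g x = x.
Proof.
have := Gext_M 1%g 1%g x; rewrite mulg1 => e.
by apply: (fmorph_inj (Gext_gal E 1%g)).
Qed.

Definition Gext_algebra : Galgebra k gT :=
  @GAlgebra k gT E (fun g x => Gext_gal E g x)
    Gext_linear Gext_monoid Gext_1 (@Gext_M _ _ E).

End GextAlgebra.

Section Ramification.
Variables (k : fieldType) (gT : finGroupType) (E : Gextension k gT).

Definition max_ideal : set E :=
  [set x | int_closure E x /\ (x = 0 \/ ~ int_closure E x^-1)]%classic.

Definition uniformizer (pi : E) : Prop :=
  pi != 0 /\ max_ideal = [set pi * y | y in int_closure E]%classic.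

(** v_L(x) >= n, for the normalised valuation v_L of L = E *)
Definition val_ge (n : nat) (x : E) : Prop :=
  exists pi, uniformizer pi /\ int_closure E (x / pi ^+ n).

Definition ram_group (i : nat) : set gT :=
  [set g | forall x, int_closure E x ->
             val_ge i.+1 (Gext_gal E g x - x)]%classic.

Definition is_last_jump (r : nat) : Prop :=
  (ram_group r <> [set 1%g] /\ ram_group r.+1 = [set 1%g])%classic.

Definition last_jump : nat := xget 0%N [set r | is_last_jump r]%classic.

End Ramification.

(** F = L^sigma = K(alpha) with alpha = t^(1/m) and
    tau(alpha) = z^gamma alpha, where z = zeta_m *)
Definition has_gamma (k : fieldType) (gT : finGroupType) (sigma tau : gT)
    (m : nat) (z : k) (gamma : int) (E : Gextension k gT) : Prop :=
  exists alpha : E,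
    [/\ <<1; alpha>>%VS = fixedField [set Gext_gal E sigma]%SET,
        alpha ^+ m = (laurent_t k)%:A &
        Gext_gal E tau alpha = base_emb E (z ^ gamma) * alpha].

(** The trivial torsor is not a field extension and carries no value of gamma;
    it is a point of Delta_(G, gamma) for every gamma. The algebras of the
    points of the second kind are fields, hence never trivial. *)
Inductive Delta (k : fieldType) (gT : finGroupType) (sigma tau : gT)
    (m : nat) (z : k) (gamma : int) : Type :=
  | Delta_trivial (A : Galgebra k gT) of trivial_torsor A
  | Delta_ext (E : Gextension k gT) of has_gamma sigma tau m z gamma E.

Definition Delta_algebra k gT sigma tau m z gamma
    (x : @Delta k gT sigma tau m z gamma) : Galgebra k gT :=
  match x with
  | Delta_trivial A _ => A
  | Delta_ext E _ => Gext_algebra E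
  end.

Section Representations.
Variables (k : fieldType) (gT : finGroupType) (d : nat).
Variable V : mx_representation k [set: gT]%G d.

(** V is 'cV[k]_d with g acting by v |-> V g *m v, and a row vector u is the
    linear form v |-> u *m v; (g u)(v) = u(g^-1 v). *)
Definition form_act (g : gT) (u : 'rV[k]_d) : 'rV[k]_d := u *m V g^-1%g.

(** V is (isomorphic to) V_(d, s): the rows of X are coordinates x_1, ..., x_d
    (a basis of linear forms) on which sigma is a single Jordan block, so that V
    is indecomposable. The image tau(x_1) determines tau on all of the span of
    the x_i, since x_1 generates it over k[sigma]. *)
Definition is_Vds (p : nat) (z : k) (sigma tau : gT) (s : int) : Prop :=
  (0 < d <= p)%N /\
  exists X : 'M[k]_d,
    [/\ X \in unitmx,
        forall i j : 'I_d, j = i.+1 :> nat ->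
          form_act sigma (row i X) = row i X + row j X,
        forall i : 'I_d, i.+1 = d -> form_act sigma (row i X) = row i X &
        forall i : 'I_d, i = 0%N :> nat ->
          form_act tau (row i X) = z ^ s *: row i X].

Variable A : Galgebra k gT.

(** The k-linear map from linear forms to A with x_i |-> c_i, for the standard
    coordinates x_i *)
Definition form_map (c : 'cV[A]_d) (u : 'rV[k]_d) : A :=
  \sum_(i < d) base_emb A (u 0 i) * c i 0.

Definition int_vectors : set 'cV[A]_d :=
  [set c | forall i, int_closure A (c i 0)]%classic.

Definition tuning_module : set 'cV[A]_d :=
  [set c | int_vectors c /\
           forall g u, form_map c (form_act g u) = Gact g (form_map c u)]%classic.

Definition tuning_span : set 'cV[A]_d :=
  [set c | exists (n : nat) (a : 'I_n -> A) (xi : 'I_n -> 'cV[A]_d),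
     [/\ forall i, int_closure A (a i), forall i, tuning_module (xi i) &
         c = \sum_(i < n) a i *: xi i]]%classic.

Definition v_function : \bar rat :=
  ((#|gT|%:R^-1 : rat)%R%:E * quotient_length tuning_span int_vectors)%E.

End Representations.

Definition v_gamma (k : fieldType) (gT : finGroupType) (d : nat)
    (V : mx_representation k [set: gT]%G d)
    sigma tau m z gamma (x : @Delta k gT sigma tau m z gamma) : \bar rat :=
  v_function V (Delta_algebra x).

Definition inv_mod (m : nat) (gamma : int) : int := (egcdz gamma m%:Z).1.

Lemma inv_modP (m : nat) (gamma : int) : coprimez gamma m%:Z ->
  (inv_mod m gamma * gamma = 1 %[mod m%:Z])%Z.
Proof.
rewrite /coprimez /inv_mod; case: egcdzP => u v /= <- _ /eqP uv1.
by rewrite -[in RHS]uv1 addrC modzMDl.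
Qed.

Definition index_set (m d : nat) (gamma : int) (r : nat) (s : int) :
    {set 'I_m * 'I_d} :=
  [set ij : 'I_m * 'I_d |
     (ij.1%:Z - r%:Z * ij.2%:Z == s * inv_mod m gamma %[mod m%:Z])%Z]%SET.

Definition v_formula (p m d : nat) (gamma : int) (r : nat) (s : int) : rat :=
  \sum_(ij in index_set m d gamma r s) ij.1%:R / m%:R +
  \sum_(ij in index_set m d gamma r s)
     (Num.ceil ((- (ij.1 * p)%:R + (ij.2 * r)%:R) / (m * p)%:R : rat))%:~R.

(* Main.v *)
(** Idea. Write xi = zeta_m^gamma and D = sigma - 1. An extension L = E carries
    alpha with alpha^m = t, tau(alpha) = xi alpha, and (reducing an
    Artin-Schreier generator) beta with beta^p = beta + u alpha^-r for a unit u
    of k[[t]], where p does not divide r, sigma(beta) = beta + 1 and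
    tau(beta) = xi^-r beta. The monomials alpha^i beta^j, i < m, j < p, form a
    k((t))-basis of L whose prospective valuations p i - r j are distinct modulo
    m p; hence the minimum over the terms of an expansion is the normalised
    valuation, and everything (integral closure, ramification groups, r as the
    last jump) is read off from expansions.
    A tuple in the tuning module of V_(d,s) is (c, D c, ..., D^(d-1) c) with
    D^d c = 0 and tau(c) = zeta_m^s c, so c is a combination over k[[t]] of the
    t^n alpha^i beta^j with (i, j) in the index set and n the least exponent
    making the monomial integral. As D^j beta^j = j! and D^l beta^j = 0 for l > j, the
    matrix of these d tuples is triangular, and the length of the quotient is
    the sum of the valuations m p n + p i of its diagonal entries. *)

Require Import Defs.
From HB Require Import structures.
From mathcomp Require Import all_boot all_order all_algebra.
From mathcomp Require Import all_fingroup all_field all_character.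
From mathcomp Require Import boolp classical_sets constructive_ereal.
From mathcomp Require Import cyclic zify ring.

Set Implicit Arguments.
Unset Strict Implicit.
Unset Printing Implicit Defensive.

Import Order.TTheory GRing.Theory Num.Theory.
Local Open Scope ring_scope.

(** * Laurent series *)

(** The length is defined as a maximum over all chains of submodules, so exhibiting one filtration
    is not enough: a Jordan-Hoelder argument bounds every chain by a composition series. The steps
    of the series used are simple because [L] is totally ramified, with residue field [k]. No
    valuation on [L] is given in advance; it is built as a relation, from lower bounds on the
    coordinates of an expansion. The obstacle is multiplicativity, since a product of two monomials
    can leave the range j < p. The equation of beta rewrites it: the term u alpha^-r has the same
    value as beta^p, the term beta a larger one, and exactness of the value is where u being a unit
    enters. Beta can be reduced while tau still acts diagonally because the eigenvalue of tau lies
    in the prime field: beta^p - beta is then an eigenvector too, of the form c alpha^e with c in K,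
    and the poles of order divisible by p are removed by elements of the same line K alpha^e. *)

Section PowerSeries.
Variable k : fieldType.
Implicit Types (f g h : fps k) (c : k).

Fact fps_const_is_zmod_morphism : zmod_morphism (@fps_const k).
Proof. by move=> x y; apply: fpsP => -[|n] /=; rewrite ?subr0. Qed.

Fact fps_const_is_monoid_morphism : monoid_morphism (@fps_const k).
Proof.
split=> // x y; apply: fpsP => -[|n] /=.
  by rewrite big_ord_recl big_ord0 addr0.
by rewrite big_ord_recl /= mulr0 big1 ?addr0 // => i _; rewrite mul0r.
Qed.

HB.instance Definition _ := GRing.isZmodMorphism.Build k (fps k) (@fps_const k)
  fps_const_is_zmod_morphism.
HB.instance Definition _ := GRing.isMonoidMorphism.Build k (fps k)
  (@fps_const k) fps_const_is_monoid_morphism.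

Lemma fps_coefD f g n : fps_coef (f + g) n = fps_coef f n + fps_coef g n.
Proof. by []. Qed.

Lemma fps_coefN f n : fps_coef (- f) n = - fps_coef f n.
Proof. by []. Qed.

Lemma fps_coefCM c f n : fps_coef (fps_const c * f) n = c * fps_coef f n.
Proof.
by rewrite /= big_ord_recl /= subn0 big1 ?addr0 // => i _; rewrite mul0r.
Qed.

Lemma fps_coefM0 f g : fps_coef (f * g) 0 = fps_coef f 0 * fps_coef g 0.
Proof. by rewrite /= big_ord_recl big_ord0 addr0. Qed.

Lemma fps_coefXM f n :
  fps_coef (fps_t k * f) n = if n is n'.+1 then fps_coef f n' else 0.
Proof.
case: n => [|n]; first by rewrite fps_coefM0 mul0r.
rewrite /= big_ord_recl mul0r add0r big_ord_recl /= mul1r subSS subn0.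
by rewrite big1 ?addr0 // => i _; rewrite mul0r.
Qed.

Lemma fps_coefXnM q f n :
  fps_coef (fps_t k ^+ q * f) n = if (q <= n)%N then fps_coef f (n - q) else 0.
Proof.
elim: q n => [|q IHq] [|n]; rewrite ?expr0 ?mul1r ?subn0 // exprS -mulrA.
  by rewrite fps_coefXM.
by rewrite fps_coefXM IHq subSS.
Qed.

Lemma fps_t_neq0 : fps_t k != 0.
Proof. by apply/eqP => /(congr1 (fun f => fps_coef f 1)) /eqP; rewrite oner_eq0. Qed.

Definition fps_shift f : fps k := FPS (fun n => fps_coef f n.+1).

Lemma fps_shiftE f : f = fps_const (fps_coef f 0) + fps_t k * fps_shift f.
Proof.
by apply: fpsP => n; rewrite fps_coefD fps_coefXM; case: n => [|n]; rewrite ?addr0 ?add0r.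
Qed.

Definition fps_agree N f g := forall n, (n < N)%N -> fps_coef f n = fps_coef g n.

Lemma fps_agreeP f g : (forall N, fps_agree N f g) -> f = g.
Proof. by move=> fg; apply: fpsP => n; apply: (fg n.+1). Qed.

(** The iterates of [F] converge [t]-adically. Contraction is only required for series that already
    agree in degree 0, so that the constant coefficient may solve an equation of its own; [g0]
    supplies it. *)
Lemma fps_fixpoint (F : fps k -> fps k) g0 :
    fps_agree 1 g0 (F g0) ->
    (forall N f g, fps_agree N.+1 f g -> fps_agree N.+2 (F f) (F g)) ->
  exists g, F g = g.
Proof.
move=> F0 F_contr; pose s n := iter n F g0.
have sS n : fps_agree n.+1 (s n) (s n.+1) by elim: n => //= n; apply: F_contr.
have sD n d : fps_agree n.+1 (s n) (s (n + d)%N).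
  elim: d => [|d IHd] i lt_in; first by rewrite addn0.
  by rewrite IHd // addnS (sS _ i) // (leq_trans lt_in) // ltnS leq_addr.
pose g := FPS (fun n => fps_coef (s n) n).
have gs n : fps_agree n.+1 g (s n).
  by move=> i lt_in /=; rewrite (sD i (n - i)%N) // subnKC.
exists g; apply: fps_agreeP => N i lt_iN.
rewrite (F_contr i _ _ (gs i)); last by rewrite ltnS leqW.
by rewrite (gs i) // [RHS]sS.
Qed.

(** Writing [f = c + t h], an inverse is a fixed point of [g = c^-1 (1 - t h g)]. *)
Lemma fps_unitP f : reflect (fps_coef f 0 != 0) (f \is a GRing.unit).
Proof.
apply: (iffP idP) => [uf|f0].
  apply/eqP => f0; have /eqP := congr1 (fun h => fps_coef h 0) (divrr uf).
  by rewrite fps_coefM0 f0 mul0r eq_sym oner_eq0.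
set c := fps_coef f 0 in f0.
have [] := @fps_fixpoint
  (fun g => fps_const c^-1 * (1 - fps_t k * (fps_shift f * g))) (fps_const c^-1).
- case=> // _; rewrite fps_coefCM fps_coefD fps_coefN fps_coefXM.
  by rewrite subr0 mulr1.
- move=> N g h gh i lt_iN; rewrite !fps_coefCM !fps_coefD !fps_coefN !fps_coefXM.
  case: i lt_iN => // i lt_iN; congr (_ * (_ - _)) => /=.
  by apply: eq_bigr => j _; rewrite gh // ltnS (leq_trans (leq_subr _ _)).
move=> g gP; have : g * f = 1.
  rewrite [f in LHS]fps_shiftE -/c.
  have /(congr1 (fun h => fps_const c * h)) := gP.
  rewrite mulrA -rmorphM mulfV // rmorph1 mul1r => cg.
  have -> : g * (fps_const c + fps_t k * fps_shift f)
            = fps_const c * g + fps_t k * (fps_shift f * g) by ring.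
  by rewrite -cg subrK.
move=> gf; apply/unitrP; exists g; by rewrite [f * _]mulrC.
Qed.

Lemma fps_decomp f : f != 0 ->
  exists n g, g \is a GRing.unit /\ f = fps_t k ^+ n * g.
Proof.
move=> /fps_neq0_lead [n fn lt_n].
exists n, (FPS (fun i => fps_coef f (n + i))); split.
  by apply/fps_unitP; rewrite /= addn0.
apply: fpsP => i; rewrite fps_coefXnM /=; case: leqP => [/subnKC -> //|].
exact: lt_n.
Qed.

End PowerSeries.

Section Laurent.
Variable k : fieldType.
Local Notation K := (laurent k).
Local Notation t := (laurent_t k).
Implicit Types (f g : fps k) (c : K) (l : int).

Lemma laurent_t_neq0 : t != 0.
Proof. by rewrite tofrac_eq0 fps_t_neq0. Qed.


Lemma laurent_frac c : exists f g, g != 0 /\ c = tofrac f / tofrac g.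
Proof.
elim/quotW: c => x; exists (frac x).1, (frac x).2.
split; first exact: denom_ratioP.
apply: (canRL (mulfK _)); first by rewrite tofrac_eq0 denom_ratioP.
unlock tofrac; rewrite -[LHS]FracField.pi_mul; apply/eqmodP => /=.
rewrite FracField.equivfE /FracField.mulf !numden_Ratio ?oner_eq0 //.
- by rewrite !mulr1 mulrC.
- by rewrite mulr1 denom_ratioP.
- by rewrite mulr1 denom_ratioP.
Qed.

Lemma laurent_decomp c : c != 0 ->
  exists l u, u \is a GRing.unit /\ c = t ^ l * tofrac u.
Proof.
have [f [g [g0 ->]]] := laurent_frac c.
have [-> | f0] := eqVneq f 0; first by rewrite rmorph0 mul0r eqxx.
move=> _; have [n [u [uu ->]]] := fps_decomp f0.
have [n' [u' [uu' ->]]] := fps_decomp g0.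
exists (n%:Z - n'%:Z), (u / u'); split; first by rewrite unitrM uu unitrV.
rewrite expfzDr ?laurent_t_neq0 // -invr_expz -!exprnP.
rewrite !rmorphM !rmorphXn rmorphV //= invfM -!/(laurent_t k).
rewrite -!mulrA; congr (_ * _); rewrite mulrCA; congr (_ * _).
Qed.

(** v(c) >= l, for the t-adic valuation v of k((t)) *)
Definition kge l c := exists f, c = t ^ l * tofrac f.

Lemma kge_fps f : kge 0 (tofrac f).
Proof. by exists f; rewrite mul1r. Qed.

Lemma kge_t l : kge l (t ^ l).
Proof. by exists 1; rewrite rmorph1 mulr1. Qed.

Lemma kge0 l : kge l 0.
Proof. by exists 0; rewrite rmorph0 mulr0. Qed.

Lemma kgeD l c c' : kge l c -> kge l c' -> kge l (c + c').
Proof. by move=> [f ->] [g ->]; exists (f + g); rewrite rmorphD mulrDr. Qed.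

Lemma kgeM l l' c c' : kge l c -> kge l' c' -> kge (l + l') (c * c').
Proof.
move=> [f ->] [g ->]; exists (f * g).
by rewrite rmorphM expfzDr ?laurent_t_neq0 // mulrACA.
Qed.

Lemma kge_le l l' c : (l' <= l)%R -> kge l c -> kge l' c.
Proof.
move=> le_l [f ->]; exists (fps_t k ^+ `|(l - l')%R|%N * f).
rewrite rmorphM rmorphXn mulrA /= -/t exprnP -expfzDr ?laurent_t_neq0 //.
by congr (t ^ _ * _); lia.
Qed.

(** Otherwise [t] would divide the unit [u]. *)
Lemma kge_unit l l' u : u \is a GRing.unit ->
  kge l' (t ^ l * tofrac u) -> (l' <= l)%R.
Proof.
move=> uu [f]; case: lerP => // lt_l.
have -> : l' = l + `|(l' - l)%R|%N%:Z by lia.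
rewrite expfzDr ?laurent_t_neq0 // -mulrA => /(mulfI _) e.
have {}e : u = fps_t k ^+ `|(l' - l)%R|%N * f.
  apply/eqP; rewrite -tofrac_eq rmorphM rmorphXn e ?expfz_neq0 //.
  exact: laurent_t_neq0.
move/fps_unitP: uu; rewrite e fps_coefXnM ifF ?eqxx //.
lia.
Qed.

End Laurent.

(** * Artin-Schreier equations over Laurent series *)

Section ArtinSchreier.
Variables (p : nat) (k : closedFieldType).
Hypothesis char_k : p \in [pchar k].
Local Notation K := (laurent k).
Local Notation t := (laurent_t k).

Lemma pchar_fps : p \in [pchar fps k].
Proof. exact: (rmorph_pchar (@fps_const k)). Qed.

Lemma pchar_laurent : p \in [pchar K].
Proof. exact: (rmorph_pchar (@tofrac (fps k)) pchar_fps). Qed.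

Let p_gt0 : (0 < p)%N.
Proof. exact: prime_gt0 (pcharf_prime char_k). Qed.
Let p_gt1 : (1 < p)%N.
Proof. exact: prime_gt1 (pcharf_prime char_k). Qed.

Lemma pexprD (R : comNzRingType) (x y : R) : p \in [pchar R] ->
  (x + y) ^+ p = x ^+ p + y ^+ p.
Proof.
by move=> char_R; rewrite -!(pFrobenius_autE char_R) pFrobenius_autD_comm //; apply: mulrC.
Qed.

Lemma pexprB (R : comNzRingType) (x y : R) : p \in [pchar R] ->
  (x - y) ^+ p = x ^+ p - y ^+ p.
Proof.
by move=> char_R; rewrite -!(pFrobenius_autE char_R) pFrobenius_autB_comm //; apply: mulrC.
Qed.

(** The identity for [f = f(0) + t h] follows from the identity for [h]. *)
Lemma fps_coef_expp (f : fps k) n :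
  fps_coef (f ^+ p) n = if (p %| n)%N then fps_coef f (n %/ p)%N ^+ p else 0.
Proof.
elim/ltn_ind: n f => n IHn f.
rewrite [f in LHS]fps_shiftE pexprD ?pchar_fps // exprMn -rmorphXn fps_coefD.
rewrite fps_coefXnM; case: leqP => [le_pn | lt_np]; last first.
  rewrite addr0; case: n lt_np {IHn} => [|n] lt_np /=; first by rewrite dvdn0 div0n.
  by case: ifP => // /dvdn_leq; lia.
rewrite IHn; last by lia.
have -> : fps_coef (fps_const (fps_coef f 0 ^+ p)) n = 0.
  by case: n le_pn {IHn} => //; rewrite leqNgt p_gt0.
rewrite add0r -[in RHS](subnK le_pn) dvdn_addl // divnDr // divnn p_gt0 addn1.
by case: ifP.
Qed.

(** A solution is a fixed point of [g = t^q g^p - c]: for [n > 0] the coefficient of degree [n] of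
    the right-hand side involves at most one coefficient of [g], of degree [(n - q) / p < n]. *)
Lemma fps_artin_schreier_solve q (c : fps k) :
  exists g : fps k, g ^+ p * fps_t k ^+ q - g = c.
Proof.
(* The constant coefficient: a root of [b^p - b = c(0)] if [q = 0], which exists as [k] is
   algebraically closed, and [- c(0)] otherwise. *)
have [b b_def] : exists b : k, (q == 0%N)%:R * b ^+ p - fps_coef c 0 = b.
  case: (q == 0%N); last by exists (- fps_coef c 0); rewrite mul0r add0r.
  have [b bE] := @solve_monicpoly k p
    (fun i => if i == 0%N then fps_coef c 0 else if i == 1%N then 1 else 0) p_gt0.
  exists b; rewrite bE mul1r -(prednK p_gt0) big_ord_recl /= mulr1.
  have -> : p.-1 = (p.-2).+1 by lia.
  rewrite big_ord_recl /= mul1r expr1 big1 => [|i _]; last by rewrite mul0r.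
  by rewrite addr0 addrC addKr.
pose F g : fps k := fps_t k ^+ q * g ^+ p - c.
have FE g i : fps_coef (F g) i = (if (q <= i)%N then
    if (p %| i - q)%N then fps_coef g ((i - q) %/ p)%N ^+ p else 0
    else 0) - fps_coef c i.
  by rewrite fps_coefD fps_coefXnM fps_coefN fps_coef_expp.
have [||g gP] := @fps_fixpoint k F (fps_const b); last first.
- by exists g; rewrite mulrC -[X in _ - X]gP opprB addrC subrK.
- move=> N g h gh i lt_iN; rewrite [LHS]FE [RHS]FE; congr (_ - _).
  case: ifP => // _; case: ifP => // _.
  rewrite gh //; case: i lt_iN => [|i]; first by rewrite sub0n div0n.
  move=> lt_iN; have : ((i.+1 - q) %/ p < i.+1)%N.
    by rewrite (leq_ltn_trans (leq_div2r p (leq_subr q _))) ?ltn_Pdiv.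
  by move=> /leq_trans; apply.
case=> // _; rewrite FE /= -[LHS]b_def.
by rewrite leqn0 sub0n dvdn0 div0n; case: eqP; rewrite ?mul1r ?mul0r.
Qed.

(** Reduction of x^p - x modulo its image on the line [k((t)) t^(e/m)]: there
    [(g t^(e/m))^p = g^p t^q t^(e/m)], and [m l + e] is m times the valuation of
    the reduced element. *)
Lemma laurent_artin_schreier m q e (c : K) :
    ~~ (p %| m)%N -> (e < m)%N -> (m * q = e * p.-1)%N ->
  exists g, c = g ^+ p * t ^+ q - g \/
    exists l u, [/\ u \is a GRing.unit, c - (g ^+ p * t ^+ q - g) = t ^ l * tofrac u,
      m%:Z * l + e%:Z < 0 & ~~ (p %| `|(m%:Z * l + e%:Z)%R|)%N].
Proof.
move=> p'm lt_em mq.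
have t0 := laurent_t_neq0 k.
(* [n] bounds the pole order [- (m l + e)]; cancelling the leading term lowers it. *)
suff main n : forall c, (c = 0 \/ exists l u, [/\ u \is a GRing.unit, c = t ^ l * tofrac u
      & - n%:Z <= m%:Z * l + e%:Z]) ->
  exists g, c = g ^+ p * t ^+ q - g \/
    exists l u, [/\ u \is a GRing.unit, c - (g ^+ p * t ^+ q - g) = t ^ l * tofrac u,
      m%:Z * l + e%:Z < 0 & ~~ (p %| `|(m%:Z * l + e%:Z)%R|)%N].
  have [c0 | /laurent_decomp[l [u [uu cE]]]] := eqVneq c 0.
    by apply: (main 0%N); left.
  apply: (main `|(m%:Z * l + e%:Z)%R|%N); right; exists l, u; split=> //; lia.
elim/ltn_ind: n => n IHn {}c cP.
have [[f cE]|] := pselect (exists f, c = tofrac f).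
  have [g gE] := fps_artin_schreier_solve q f; exists (tofrac g); left.
  by rewrite cE -gE rmorphB rmorphM !rmorphXn.
case: cP => [-> []|[l [u [uu cE le_n]]] c_nint]; first by exists 0; rewrite rmorph0.
have l_lt0 : l < 0.
  case: ltrP => // l_ge0; case: c_nint; exists (fps_t k ^+ `|l| * u).
  by rewrite rmorphM rmorphXn /= cE exprnP gez0_abs.
have v_lt0 : m%:Z * l + e%:Z < 0 by nia.
have [p_dvd | p'v] := boolP (p %| `|(m%:Z * l + e%:Z)%R|)%N; last first.
  by exists 0; right; exists l, u; rewrite expr0n gtn_eqF // mul0r subrr subr0.
(* By [m q = e (p - 1)], [m (l - q) = (m l + e) - e p], so [p] divides [l - q]. *)
have [l' l'E] : exists l', l = p%:Z * l' + q%:Z.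
  have: (p%:Z %| l - q%:Z)%Z.
    rewrite -(@Gauss_dvdzr p%:Z m%:Z); last first.
      by rewrite coprimezE !absz_nat prime_coprime // (pcharf_prime char_k).
    have -> : m%:Z * (l - q%:Z) = (m%:Z * l + e%:Z) - e%:Z * p%:Z by move: mq p_gt0; clear; nia.
    by rewrite rpredB ?dvdz_mull // dvdzE.
  by case/dvdzP=> l' l'E; exists l'; lia.
have [b bE] : exists b : k, b ^+ p = fps_coef u 0.
  have [b bE] := @solve_monicpoly k p
    (fun i => if i == 0%N then fps_coef u 0 else 0) p_gt0.
  exists b; rewrite bE -(prednK p_gt0) big_ord_recl /= mulr1 big1 ?addr0 // => i _.
  by rewrite mul0r.
(* [g^p t^q] is the leading term [u(0) t^l] of [c]. The other term [g] does not disturb it: the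
   negative number [m l + e] is [p] times [m l' + e], whence [l < l']. *)
pose g := t ^ l' * tofrac (fps_const b).
have vE : m%:Z * l + e%:Z = p%:Z * (m%:Z * l' + e%:Z).
  have -> : m%:Z * l = p%:Z * (m%:Z * l') + m%:Z * q%:Z by rewrite l'E; ring.
  have -> : m%:Z * q%:Z = e%:Z * p%:Z - e%:Z by move: mq p_gt0; clear; nia.
  by ring.
have lt_l : l < l'.
  have : m%:Z * l < m%:Z * l' by move: vE v_lt0 p_gt1; clear; nia.
  by rewrite ltr_pM2l //; lia.
have [f fE] : exists f, c - (g ^+ p * t ^+ q - g) = t ^ (l + 1) * tofrac f.
  exists (fps_shift u + fps_t k ^+ `|(l' - l - 1)%R|%N * fps_const b).
  have -> : g ^+ p * t ^+ q = t ^ l * tofrac (fps_const (fps_coef u 0)).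
    rewrite exprMn -rmorphXn -rmorphXn /= bE mulrAC; congr (_ * _).
    by rewrite l'E expfzDr // [p%:Z * l']mulrC -exprz_exp.
  rewrite rmorphD rmorphM rmorphXn /= -/t mulrDr mulrA exprnP -expfzDr //.
  have -> : l + 1 + `|(l' - l - 1)%R|%N%:Z = l' by lia.
  rewrite -/g opprB addrA addrAC; congr (_ + _).
  rewrite cE {1}(fps_shiftE u) rmorphD rmorphM /= -/t expfzDr // expr1z.
  by rewrite mulrDr addrAC subrr add0r mulrA.
have n_gt0 : (0 < n)%N by lia.
have lt_n : (n.-1 < n)%N by rewrite prednK.
have [|g2 g2P] := IHn n.-1 lt_n (c - (g ^+ p * t ^+ q - g)).
  have [f0 | /laurent_decomp[l2 [u2 [uu2 e2]]]] := eqVneq (c - (g ^+ p * t ^+ q - g)) 0.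
    by left.
  right; exists l2, u2; split=> //.
  have le_l : l + 1 <= l2 by apply: (kge_unit uu2); exists f; rewrite -e2.
  by move: le_n le_l n_gt0 lt_em; clear; nia.
have E : (g + g2) ^+ p * t ^+ q - (g + g2)
          = (g ^+ p * t ^+ q - g) + (g2 ^+ p * t ^+ q - g2).
  by rewrite pexprD ?pchar_laurent //; ring.
exists (g + g2); rewrite E; move: (g ^+ p * _ - g) (g2 ^+ p * _ - g2) g2P.
move=> x y [<- | yP]; first by left; rewrite addrC subrK.
by right; rewrite opprD addrA.
Qed.

End ArtinSchreier.

(** * Lengths of modules over power series *)

Section CompositionSeries.
Variables (k : fieldType) (A : comAlgType (laurent k)).

Fact ring_emb_is_zmod_morphism : zmod_morphism (ring_emb A).
Proof. by move=> x y; rewrite /ring_emb rmorphB scalerBl. Qed.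

Fact ring_emb_is_monoid_morphism : monoid_morphism (ring_emb A).
Proof.
split=> [|x y]; first by rewrite /ring_emb rmorph1 scale1r.
by rewrite /ring_emb rmorphM -scalerAl mul1r scalerA.
Qed.

HB.instance Definition _ := GRing.isZmodMorphism.Build (fps k) A (ring_emb A)
  ring_emb_is_zmod_morphism.
HB.instance Definition _ := GRing.isMonoidMorphism.Build (fps k) A (ring_emb A)
  ring_emb_is_monoid_morphism.

Fact base_emb_is_zmod_morphism : zmod_morphism (base_emb A).
Proof. by move=> x y; rewrite /base_emb !rmorphB. Qed.

Fact base_emb_is_monoid_morphism : monoid_morphism (base_emb A).
Proof. by split=> [|x y]; rewrite /base_emb ?rmorph1 ?rmorphM. Qed.

HB.instance Definition _ := GRing.isZmodMorphism.Build k A (base_emb A)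
  base_emb_is_zmod_morphism.
HB.instance Definition _ := GRing.isMonoidMorphism.Build k A (base_emb A)
  base_emb_is_monoid_morphism.

Section FixedDim.
Variable d : nat.
Implicit Types (N P S : set 'cV[A]_d) (x y : 'cV[A]_d).

Lemma fps_submoduleN S x : fps_submodule S -> S x -> S (- x).
Proof. by case=> _ _ SZ /(SZ (- 1)); rewrite rmorphN1 scaleN1r. Qed.

Lemma fps_submoduleB S x y : fps_submodule S -> S x -> S y -> S (x - y).
Proof. by move=> Ssub Sx /(fps_submoduleN Ssub); case: Ssub => _ SD _; apply: SD. Qed.

Lemma fps_submodule_lincomb S f x y :
  fps_submodule S -> S (x - ring_emb A f *: y) -> S y -> S x.
Proof.
by case=> _ SD SZ Sxy Sy; rewrite -(subrK (ring_emb A f *: y) x); apply/SD/SZ.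
Qed.

(** P / N is a simple k[[t]]-module (k being the residue field) *)
Definition simple_step N P : Prop :=
  [/\ fps_submodule P, N `<` P
    & forall x y, P x -> P y -> ~ N y -> exists f, N (x - ring_emb A f *: y)]%classic.

(** A composition series of [P / N], built upwards from [N]. *)
Inductive has_length N : set 'cV[A]_d -> nat -> Prop :=
  | has_length0 of fps_submodule N : has_length N N 0
  | has_lengthS P P' n of has_length N P n & simple_step P P' : has_length N P' n.+1.

Lemma has_length_submodule N P n : has_length N P n -> fps_submodule P.
Proof. by case=> // ? ? ? _ []. Qed.

Lemma has_length_sub N P n : has_length N P n -> (N `<=` P)%classic.
Proof.
by elim=> [_ //|P1 P2 {}n _ NP1 [_ [P12 _] _]]; apply: subset_trans NP1 P12.
Qed.

Lemma has_length_cat N P Q n n' :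
  has_length N P n -> has_length P Q n' -> has_length N Q (n + n').
Proof.
by move=> NP; elim=> [_|P1 P2 {}n' _ IH st]; rewrite ?addn0 ?addnS //; apply: has_lengthS st.
Qed.

Lemma fps_submoduleI S P :
  fps_submodule S -> fps_submodule P -> fps_submodule (S `&` P)%classic.
Proof.
by move=> [S0 SD SZ] [P0 PD PZ]; split=> [//|x y [Sx Px] [Sy Py]|f x [Sx Px]];
  split; auto.
Qed.

(** The rank of S counts the steps of the composition series that S meets in a
    new element; two nested submodules meeting the same steps are equal. *)
Lemma exists_submodule_rank N P n : has_length N P n ->
  exists rank : set 'cV[A]_d -> nat,
    [/\ forall S, (rank S <= n)%N,
        forall S, fps_submodule S -> (S `<=` P)%classic -> forall S', fps_submodule S' ->
          (S' `<=` P)%classic -> (S `<=` S')%classic -> (rank S <= rank S')%N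
      & forall S, fps_submodule S -> (N `<=` S)%classic -> forall S', fps_submodule S' ->
          (S' `<=` P)%classic -> (S `<` S')%classic -> (rank S < rank S')%N].
Proof.
elim=> [Nsub | {n}P1 P2 n NP1 [rk [rk_le rk_mono rk_lt]] [P2sub [P12 nP21] simp]].
  exists (fun=> 0%N); split=> // S _ NS S' _ SN' [_ nSS'].
  by case: nSS' => x /SN' /NS.
have P1sub := has_length_submodule NP1.
pose out S := ~~ `[< S `<=` P1 >]%classic.
have out_mono S S' : (S `<=` S' -> out S <= out S')%classic%N.
  move=> SS'; rewrite /out; case: asboolP => // nS; case: asboolP => // S'P1.
  by case: nS; apply: subset_trans SS' S'P1.
exists (fun S => rk (S `&` P1)%classic + out S)%N; split.
- by move=> S; rewrite -(addn1 n) leq_add ?leq_b1.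
- move=> S Ssub SP S' S'sub SP' SS'; rewrite leq_add ?out_mono //.
  by apply: rk_mono; [exact: fps_submoduleI | exact: subIsetr |
    exact: fps_submoduleI | exact: subIsetr | exact: setSI].
move=> S Ssub NS S' S'sub SP' [SS' nS'S].
have NSP1 : (N `<=` S `&` P1)%classic.
  by move=> x Nx; split; [apply: NS | apply: (has_length_sub NP1)].
have SP1 := fps_submoduleI Ssub P1sub; have SP1' := fps_submoduleI S'sub P1sub.
have [outE | out_neq] := eqVneq (out S) (out S'); last first.
  rewrite -addnS leq_add //.
    apply: rk_mono => //; first [exact: subIsetr | exact: setSI].
  by have := out_mono _ _ SS'; move: out_neq; case: (out S); case: (out S').
rewrite outE ltn_add2r; apply: rk_lt => //.
split=> [|SP1S]; first exact: setSI.
case: nS'S => x S'x.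
have [S'P1 | outS'] := pselect (S' `<=` P1)%classic.
  by case: (SP1S x) => //; split; auto.
(* [S] leaves [P1] as well, at some [y]; simplicity of the top step brings [x] into [P1] by a
   multiple of [y], which lies in [S]. *)
have /asboolPn/existsNP[y /not_implyP[Sy P1y]] : out S.
  by rewrite outE; apply/asboolPn.
have [f P1xy] := simp x y (SP' _ S'x) (SP' _ (SS' _ Sy)) P1y.
have S'xy : (S' `&` P1)%classic (x - ring_emb A f *: y).
  split=> //; apply: fps_submoduleB => //.
  by case: S'sub => _ _ S'Z; apply/S'Z/SS'.
by have [] := SP1S _ S'xy => /(fps_submodule_lincomb Ssub) + _; apply.
Qed.

(** A composition series is itself a chain of the required kind; along any other chain the rank
    grows strictly, and it never exceeds [n]. *)
Lemma has_length_quotient N P n : has_length N P n -> is_quotient_length N P n.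
Proof.
move=> NPn; split.
  elim: NPn => {P n} [Nsub|P P' n NP [S [Ssub NS SP S_lt]] [P'sub [PP' nPP'] _]].
    by exists (fun=> N); split.
  exists (fun i => if (i <= n)%N then S i else P'); split.
  - by move=> i _; case: ifP => // /Ssub.
  - by rewrite leq0n.
  - by rewrite ltnn.
  move=> i; rewrite ltnS => le_in; rewrite le_in.
  case: ltnP => [/S_lt //|le_ni]; have -> : i = n by lia.
  by split; [apply: subset_trans SP PP' | move=> /(_ _) P'S; apply: nPP' => x /P'S /SP].
move=> n' [S [Ssub NS SP S_lt]].
have [rk [rk_le _ rk_lt]] := exists_submodule_rank NPn.
apply: leq_trans (rk_le (S n')).
have S_mono i j : (i <= j <= n')%N -> (S i `<=` S j)%classic.
  move=> /andP[/subnKC <-]; elim: (j - i)%N => [|e IHe]; first by rewrite addn0 => _ x.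
  by rewrite addnS => lt_n; apply: subset_trans (IHe (ltnW lt_n)) (S_lt _ lt_n).1.
suff main i : (i <= n')%N -> (i <= rk (S i))%N by apply: main.
elim: i => // i IHi lt_in; apply: leq_ltn_trans (IHi (ltnW lt_in)) _.
apply: rk_lt; first by apply: Ssub; apply: ltnW.
- by apply: (subset_trans NS); apply: S_mono; rewrite (ltnW lt_in).
- exact: Ssub.
- by apply: subset_trans SP; apply: S_mono; rewrite lt_in leqnn.
- exact: S_lt.
Qed.

Lemma quotient_lengthE N P n : has_length N P n ->
  quotient_length N P = (n%:R : rat)%:E.
Proof.
move=> /has_length_quotient NPn; rewrite /quotient_length asboolT; last by exists n.
have [NPx x_max] := xgetPex 0%N (ex_intro (fun n => is_quotient_length N P n) n NPn).
by congr (_%:R%:E); apply/eqP; rewrite eqn_leq (x_max _ NPn.1) (NPn.2 _ NPx).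
Qed.

End FixedDim.

(** Meant for invertible changes of coordinates; surjectivity keeps the inclusions strict. *)
Lemma has_length_preimage d d' (g : 'cV[A]_d' -> 'cV[A]_d) N P n :
    (forall x y, g (x + y) = g x + g y) -> (forall a x, g (a *: x) = a *: g x) ->
    (forall y, exists x, g x = y) ->
  has_length N P n -> has_length (g @^-1` N)%classic (g @^-1` P)%classic n.
Proof.
move=> gD gZ g_surj.
have sub S : fps_submodule S -> fps_submodule (g @^-1` S)%classic.
  case=> S0 SD SZ; split=> [|x y Sx Sy|f x Sx].
  - by rewrite /preimage /= -(scale0r 0) gZ scale0r.
  - by rewrite /preimage /= gD; apply: SD.
  - by rewrite /preimage /= gZ; apply: SZ.
have gB x y : g (x - y) = g x - g y by rewrite gD -scaleN1r gZ scaleN1r.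
elim=> [|P1 P2 {}n _ IHn [P2sub [P12 nP21] simp]]; first by move/sub/has_length0.
apply: has_lengthS IHn _; split; first exact: sub.
  split=> [x /P12 //|P21]; apply: nP21 => y.
  by have [x <-] := g_surj y; apply: P21.
move=> x y P2x P2y nP1y; have [f P1f] := simp _ _ P2x P2y nP1y.
by exists f; rewrite /preimage /= gB gZ.
Qed.

Section Product.
Variables d1 d2 : nat.
Implicit Types (P : set 'cV[A]_d1) (Q : set 'cV[A]_d2).

Definition prod_set P Q : set 'cV[A]_(d1 + d2) :=
  [set c | P (usubmx c) /\ Q (dsubmx c)]%classic.

Lemma fps_submodule_prod P Q :
  fps_submodule P -> fps_submodule Q -> fps_submodule (prod_set P Q).
Proof.
move=> [P0 PD PZ] [Q0 QD QZ]; split=> [|x y [Px Qx] [Py Qy]|f x [Px Qx]];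
  rewrite /prod_set /= ?linear0 ?linearD ?linearZ /=; split; auto.
Qed.

(** Pass through [prod_set P M], changing one factor at a time. *)
Lemma has_length_prod N P n M Q n' : has_length N P n -> has_length M Q n' ->
  has_length (prod_set N M) (prod_set P Q) (n + n').
Proof.
move=> NP MQ; apply: (@has_length_cat _ _ (prod_set P M)).
  have Msub : fps_submodule M by elim: MQ.
  elim: NP => [Nsub|P1 P2 {}n _ IHn [P2sub [P12 nP21] simp]].
    by apply: has_length0; apply: fps_submodule_prod.
  apply: has_lengthS IHn _; split; first exact: fps_submodule_prod.
    split=> [x [/P12 ? ?] //|P21]; apply: nP21 => y P2y.
    have [] := P21 (col_mx y 0); rewrite /prod_set /= col_mxKu col_mxKd //.
    by split=> //; case: Msub.
  move=> x y [P2x Mx] [P2y My] nP1y.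
  have [|f P1f] := simp _ _ P2x P2y; first by move=> P1y; apply: nP1y.
  exists f; split; rewrite linearB linearZ //=.
  by apply: fps_submoduleB => //; case: Msub => _ _; apply.
have Psub := has_length_submodule NP.
elim: MQ => [Nsub|P1 P2 {}n' _ IHn [P2sub [P12 nP21] simp]].
  by apply: has_length0; apply: fps_submodule_prod.
apply: has_lengthS IHn _; split; first exact: fps_submodule_prod.
  split=> [x [? /P12 ?] //|P21]; apply: nP21 => y P2y.
  have [] := P21 (col_mx 0 y); rewrite /prod_set /= col_mxKu col_mxKd //.
  by split=> //; case: Psub.
move=> x y [Px P2x] [Py P2y] nP1y.
have [|f P1f] := simp _ _ P2x P2y; first by move=> P1y; apply: nP1y.
exists f; split; rewrite linearB linearZ //=.
by apply: fps_submoduleB => //; case: Psub => _ _; apply.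
Qed.

End Product.

End CompositionSeries.

(** * Length of the quotient by a triangular module *)

Section TriangularLength.
Variables (k : fieldType) (A : comAlgType (laurent k)) (d : nat).
Variable v : nat -> set A.
Hypotheses (v0E : v 0%N = int_closure A)
  (v_sub : forall n x y, v n x -> v n y -> v n (x - y))
  (v_scale : forall n f x, v n x -> v n (ring_emb A f * x))
  (v_le : forall n n' x, (n' <= n)%N -> v n x -> v n' x)
  (v_strict : forall n, exists2 x, v n x & ~ v n.+1 x)
  (v_residue : forall n x y, v n x -> v n y -> ~ v n.+1 y ->
     exists f, v n.+1 (x - ring_emb A f * y)).

Definition int_columns : set 'cV[A]_d :=
  [set c | forall i, int_closure A (c i 0)]%classic.

Variables (N : set 'cV[A]_d) (w : 'I_d -> nat).
Hypotheses (N_sub : fps_submodule N) (N_int : (N `<=` int_columns)%classic)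
  (N_lower : forall y, N y -> forall j : 'I_d,
     (forall l : 'I_d, (j < l)%N -> y l 0 = 0) -> v (w j) (y j 0))
  (N_pivot : forall (j : 'I_d) x, v (w j) x -> exists2 y, N y &
     y j 0 = x /\ forall l : 'I_d, (j < l)%N -> y l 0 = 0).

Let v0 n : v n 0.
Proof. by have [x vx _] := v_strict n; rewrite -(subrr x); apply: v_sub. Qed.

Let vD n x y : v n x -> v n y -> v n (x + y).
Proof. by move=> vx vy; rewrite -[y]opprK -[- y]sub0r; do 2!apply: v_sub => //. Qed.

Let int_sub c c' : int_columns c -> int_columns c' -> int_columns (c - c').
Proof.
by move=> Ic Ic' i; rewrite !mxE -v0E; apply: v_sub; rewrite v0E; [apply: Ic | apply: Ic'].
Qed.

(** N + A^j, where A^j consists of the integral columns supported on rows < j;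
    [below_pivot j] interpolates between A^j and A^(j+1) through the valuation of
    row j. *)
Definition below (j : nat) : set 'cV[A]_d :=
  [set c | exists2 y, N y & int_columns (c - y) /\
     forall l : 'I_d, (j <= l)%N -> (c - y) l 0 = 0]%classic.

Definition below_pivot (j : 'I_d) (n : nat) : set 'cV[A]_d :=
  [set c | exists2 y, N y & [/\ int_columns (c - y),
     forall l : 'I_d, (j < l)%N -> (c - y) l 0 = 0 & v n ((c - y) j 0)]]%classic.

Let below_pivot_sub j n : fps_submodule (below_pivot j n).
Proof.
case: N_sub => N0 ND NZ; split.
- exists 0 => //; rewrite subrr; split=> [i|l _|]; rewrite mxE //.
  by rewrite -v0E.
- move=> x x' [y Ny [Iy ly vy]] [y' Ny' [Iy' ly' vy']].
  exists (y + y'); first exact: ND.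
  rewrite opprD addrACA; split=> [i|l jl|]; rewrite mxE.
  + by rewrite -v0E; apply: vD; rewrite v0E; [apply: Iy | apply: Iy'].
  + by rewrite ly ?ly' ?addr0.
  + exact: vD.
move=> f x [y Ny [Iy ly vy]]; exists (ring_emb A f *: y); first exact: NZ.
rewrite -scalerBr; split=> [i|l jl|]; rewrite mxE.
- by rewrite -v0E; apply: v_scale; rewrite v0E; apply: Iy.
- by rewrite ly ?mulr0.
- exact: v_scale.
Qed.

(** The quotient is a graded piece of [v] in row [j]. It is nonzero as long as [n < w j], because
    corrections by [N] that keep the lower rows zero change row [j] only by elements of [v (w j)],
    which lie in [v n.+1]. *)
Let below_pivot_step j n : (n < w j)%N -> simple_step (below_pivot j n.+1) (below_pivot j n).
Proof.
move=> lt_n; split; first exact: below_pivot_sub.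
  split=> [c [y Ny [Iy ly vy]]|].
    by exists y => //; split=> //; apply: v_le vy.
  have [x vx vx'] := v_strict n => sub.
  have [|y Ny [_ ly]] := sub (\col_i if i == j then x else 0).
    exists 0; first by case: N_sub.
    rewrite subr0; split=> [i|l jl|]; rewrite mxE ?eqxx //.
      by rewrite -v0E; case: ifP => // _; apply: v_le vx.
    by rewrite ifN // -val_eqE /= gtn_eqF.
  rewrite !mxE eqxx => vxy; case: vx'.
  rewrite -[x](subrK (y j 0)); apply: vD => //.
  apply: (v_le lt_n); apply: N_lower => // l jl.
  have := ly l jl; rewrite !mxE ifN ?add0r -?val_eqE /= ?gtn_eqF // => /eqP.
  by rewrite oppr_eq0 => /eqP.
move=> c c' [y Ny [Iy ly vy]] [y' Ny' [Iy' ly' vy']] nb.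
have [f vf] : exists f, v n.+1 ((c - y) j 0 - ring_emb A f * (c' - y') j 0).
  by apply: v_residue => // vy''; apply: nb; exists y'.
exists f, (y - ring_emb A f *: y').
  by apply: fps_submoduleB => //; case: N_sub => _ _; apply.
have -> : c - ring_emb A f *: c' - (y - ring_emb A f *: y')
          = (c - y) - ring_emb A f *: (c' - y').
  by rewrite scalerBr !opprB addrACA [RHS]addrACA; congr (_ + _); rewrite addrC.
split=> [|l jl|].
- apply: int_sub => // i; rewrite mxE -v0E; apply: v_scale; rewrite v0E; exact: Iy'.
- by rewrite mxE ly // !mxE; have := ly' l jl; rewrite !mxE => ->; rewrite mulr0 subr0.
- by move: vf; rewrite !mxE.
Qed.

Let below_top (j : 'I_d) : below_pivot j 0 = below j.+1.
Proof.
apply/seteqP; split=> c [y Ny]; last first.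
  by move=> [Iy ly]; exists y => //; split=> //; rewrite v0E; apply: Iy.
by move=> [Iy ly _]; exists y.
Qed.

(** An entry of row [j] in [v (w j)] is cleared by the element of [N] that [N_pivot] provides. *)
Let below_bottom (j : 'I_d) : below_pivot j (w j) = below j.
Proof.
apply/seteqP; split=> c [y Ny].
  move=> [Iy ly vy]; have [y' Ny' [y'j ly']] := N_pivot vy.
  exists (y + y'); first by case: N_sub => _ + _; apply.
  rewrite opprD addrA; split; first by apply: int_sub => //; apply: N_int.
  move=> l; rewrite leq_eqVlt => /predU1P[/val_inj <-|jl].
    by rewrite mxE [(- y') _ _]mxE y'j subrr.
  by rewrite mxE [(- y') _ _]mxE ly // ly' // subr0.
move=> [Iy ly]; exists y => //; split=> // [l jl|]; first by apply: ly; apply: ltnW.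
by rewrite ly.
Qed.

(** Between [below j] and [below j.+1] the bound on row [j] descends from [w j] to 0, one simple
    step at a time. *)
Lemma triangular_length : has_length N int_columns (\sum_j w j).
Proof.
suff main j : (j <= d)%N -> has_length N (below j) (\sum_(i < d | (i < j)%N) w i).
  have -> : int_columns = below d.
    apply/seteqP; split=> c => [Ic | [y Ny [Iy _]]].
      exists 0; first by case: N_sub.
      by rewrite subr0; split=> // l; rewrite leqNgt ltn_ord.
    rewrite -(subrK y c) -[X in _ + X]opprK; apply: int_sub => //.
    exact: N_int (fps_submoduleN N_sub Ny).
  rewrite (eq_bigl (fun i : 'I_d => i < d)%N) => [|i]; first exact: main.
  by rewrite ltn_ord.
elim: j => [_|j IHj lt_jd].
  have -> : below 0 = N.
    apply/seteqP; split=> c => [[y Ny [_ cy]] | Nc]; last first.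
      exists c => //; rewrite subrr; split=> [i|l _]; rewrite mxE //.
      by rewrite -v0E.
    suff -> : c = y by [].
    by apply/colP => i; apply/eqP; rewrite -subr_eq0; have := cy i isT; rewrite !mxE => ->.
  by rewrite big_pred0 //; apply: has_length0.
pose J := Ordinal lt_jd.
rewrite (bigD1 J) //= addnC (eq_bigl (fun i : 'I_d => i < j)%N); last first.
  by move=> i; rewrite ltnS andbC ltn_neqAle.
apply: has_length_cat (IHj (ltnW lt_jd)) _.
rewrite -(below_top J) -(below_bottom J).
suff main n : (n <= w J)%N -> has_length (below_pivot J (w J)) (below_pivot J (w J - n)) n.
  by have := main _ (leqnn (w J)); rewrite subnn.
elim: n => [_|n IHn lt_n]; first by rewrite subn0; apply: has_length0.
apply: has_lengthS (IHn (ltnW lt_n)) _.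
by rewrite -(subnSK lt_n); apply: below_pivot_step; lia.
Qed.

End TriangularLength.

(** * Artin-Schreier generators *)

Lemma prim_root_neq0 (F : fieldType) n (z : F) : n.-primitive_root z -> z != 0.
Proof.
move=> z_prim; apply: contra_eq_neq (prim_expr_order z_prim) => ->.
by rewrite expr0n gtn_eqF ?(prim_order_gt0 z_prim) // eq_sym oner_eq0.
Qed.

Lemma prim_root_exprz_mod (F : fieldType) n (z : F) (w : int) :
  n.-primitive_root z -> z ^ w = z ^+ `|(w %% n)%Z|%N.
Proof.
move=> z_prim; have z0 := prim_root_neq0 z_prim.
have n_neq0 : n%:Z != 0 by rewrite eqz_nat -lt0n (prim_order_gt0 z_prim).
rewrite {1}(divz_eq w n) expfzDr // [(_ * n%:Z)]mulrC -exprz_exp.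
rewrite -[z ^ n%:Z]/(z ^+ n) prim_expr_order // exp1rz mul1r.
by rewrite [RHS]exprnP gez0_abs ?modz_ge0.
Qed.

Section PrimeSubfield.
Variables (p : nat) (R : idomainType).
Hypothesis char_R : p \in [pchar R].

Lemma natr_inj_pchar i j : (i < p)%N -> (j < p)%N -> i%:R = j%:R :> R -> i = j.
Proof.
wlog le_ij : i j / (i <= j)%N.
  by move=> W ip jp ij; case/orP: (leq_total i j) => le_ij; [apply: W | apply/esym/W].
move=> ip jp /esym/eqP; rewrite -subr_eq0 -natrB // -(dvdn_pcharf char_R).
case: (posnP (j - i)) => [|pos /(dvdn_leq pos)]; lia.
Qed.

(** ['X^p - 'X] already has the [p] roots [0, ..., p - 1]; a further root would exceed its
    degree. *)
Lemma frobenius_fixed (y : R) : y ^+ p = y -> exists i : nat, y = i%:R.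
Proof.
have p_pr := pcharf_prime char_R; have p_gt1 := prime_gt1 p_pr.
move=> yp; apply: contrapT => /forallNP y_nat.
pose P : {poly R} := 'X^p - 'X; pose rs := y :: [seq i%:R | i <- iota 0 p].
have szP : size P = p.+1.
  by rewrite size_polyDl ?size_polyXn // size_polyN size_polyX ltnS.
have : (size rs < size P)%N.
  apply: max_poly_roots; first by rewrite -size_poly_gt0 szP.
    apply/allP => x; rewrite inE => /predU1P[->|/mapP[i _ ->]].
      by rewrite /root !hornerE yp subrr.
    by rewrite /root !hornerE -(pFrobenius_autE char_R) rmorph_nat subrr.
  rewrite /= map_inj_in_uniq ?iota_uniq ?andbT; last first.
    by move=> i j; rewrite !mem_iota /= !add0n; apply: natr_inj_pchar.
  by apply/mapP => -[i _ yi]; apply: (y_nat i).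
by rewrite szP /= size_map size_iota ltnn.
Qed.

End PrimeSubfield.

Section ArtinSchreierGenerator.
Variables (p m a b : nat) (k : closedFieldType) (xi : k).
Variables (L : fieldExtType (laurent k)) (sg tu : {lrmorphism L -> L}) (alpha : L).
Hypotheses (char_k : p \in [pchar k]) (p'm : ~~ (p %| m)%N)
  (xi_prim : m.-primitive_root xi)
  (sg_p : forall x, iter p sg x = x) (tu_m : forall x, iter m tu x = x)
  (sg_nontrivial : exists x, sg x != x)
  (tu_sg : forall x, tu (sg x) = iter a sg (tu x))
  (sg_tu : forall x, sg (tu x) = tu (iter b sg x))
  (fixed : forall x, sg x = x -> tu x = x -> exists c : laurent k, x = c%:A)
  (sg_alpha : sg alpha = alpha) (alpha_m : alpha ^+ m = (laurent_t k)%:A)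
  (tu_alpha : tu alpha = base_emb L xi * alpha).

Let algE (c : laurent k) : c%:A = in_alg L c. Proof. by []. Qed.
Let m_gt0 : (0 < m)%N. Proof. exact: prim_order_gt0 xi_prim. Qed.

Lemma pchar_ext : p \in [pchar L].
Proof. by rewrite pchar_lalg (pchar_laurent char_k). Qed.
Let char_L := pchar_ext.

Lemma alpha_neq0 : alpha != 0.
Proof.
apply/eqP => alpha0; have := alpha_m; rewrite alpha0 expr0n gtn_eqF // => /esym/eqP.
by rewrite scaler_eq0 oner_eq0 orbF (negPf (laurent_t_neq0 k)).
Qed.

Import FalgLfun.

(** In the endomorphism algebra, which has characteristic [p], [sg] and 1 commute, so
    [(sg - 1)^p = sg^p - 1 = 0]. *)
Lemma nilpotent_sub1 x : iter p (fun y => sg y - y) x = 0.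
Proof.
have char_End : p \in [pchar 'End(L)] by rewrite pchar_lalg (pchar_laurent char_k).
have iterE (f : 'End(L)) (F : L -> L) n y : (forall z, f z = F z) ->
    (f ^+ n) y = iter n F y.
  move=> fF; elim: n => [|n IHn]; first by rewrite expr0 lfunE.
  by rewrite exprSr lfun_mulE IHn fF.
rewrite -(iterE (linfun sg - 1)) => [|z]; last by rewrite add_lfunE opp_lfunE id_lfunE lfunE.
rewrite -pFrobenius_autE pFrobenius_autB_comm; last exact: commr1.
rewrite pFrobenius_aut1 pFrobenius_autE.
rewrite add_lfunE opp_lfunE id_lfunE (iterE _ sg) => [|z]; last by rewrite lfunE.
by rewrite sg_p subrr.
Qed.

Let sg_alg (c : laurent k) : sg c%:A = c%:A.
Proof. by rewrite linearZ /= rmorph1. Qed.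
Let tu_alg (c : laurent k) : tu c%:A = c%:A.
Proof. by rewrite linearZ /= rmorph1. Qed.

(** If z is killed by (sg - 1)^(n+2) but not by (sg - 1)^(n+1), then
    [(sg - 1)^n z / (sg - 1)^(n+1) z] is translated by 1. *)
Lemma exists_translate : exists x, sg x = x + 1.
Proof.
pose D x := sg x - x; have [z Dz] := sg_nontrivial.
have ex_n : exists n, iter n D z == 0 by exists p; rewrite nilpotent_sub1.
case: (ex_minnP ex_n) => -[|[|n]] /= /eqP Dn0 n_min.
- by case/eqP: Dz; rewrite Dn0 rmorph0.
- by case/eqP: Dz; apply/eqP; rewrite -subr_eq0 -/(D z) Dn0.
have Dn : D (iter n D z) != 0.
  by apply/negP => Dn; have := n_min n.+1 Dn; rewrite ltnn.
exists (iter n D z / D (iter n D z)).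
have sgD : sg (D (iter n D z)) = D (iter n D z).
  by apply/eqP; rewrite -subr_eq0; apply/eqP.
have := fmorph_div sg (iter n D z) (D (iter n D z)); rewrite /= sgD => ->.
by rewrite -[in RHS](divff Dn) -mulrDl; congr (_ / _); rewrite [RHS]addrC subrK.
Qed.

Lemma iter_translate x n : sg x = x + 1 -> iter n sg x = x + n%:R.
Proof.
move=> sgx; elim: n => [|n IHn]; first by rewrite addr0.
by rewrite iterS IHn rmorphD rmorph_nat /= sgx -addrA -natr1 [1 + _]addrC.
Qed.

(** The eigenvalue is the inverse of the exponent [a] by which [tau] conjugates [sigma]. As an
    element of the prime field it is fixed by Frobenius, which later makes [beta^p - beta] an
    eigenvector as well. *)
Lemma exists_eigen_translate : exists beta (lambda : k),
  [/\ sg beta = beta + 1, tu beta = base_emb L lambda * beta,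
      lambda ^+ m = 1 & lambda ^+ p = lambda].
Proof.
have [x0 sg_x0] := exists_translate.
(* T preserves the translated elements and has order m on them; average it. *)
pose T x := a%:R * tu x.
(* The relation [tu_sg] at [x0]: the left side is [tu x0 + 1], while [a] translations of [tu x0] by
   [b] give the right side. *)
have ab1 : a%:R * b%:R = 1 :> L.
  have := tu_sg x0; rewrite sg_x0 rmorphD rmorph1 /=.
  have -> n : iter n sg (tu x0) = tu x0 + n%:R * b%:R.
    elim: n => [|n IHn]; first by rewrite mul0r addr0.
    rewrite iterS IHn rmorphD rmorphM !rmorph_nat /= sg_tu iter_translate //.
    by rewrite rmorphD rmorph_nat /= -natr1; ring.
  by move/addrI.
have T_translate x : sg x = x + 1 -> sg (T x) = T x + 1.
  move=> sgx; rewrite rmorphM rmorph_nat /= sg_tu iter_translate //.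
  by rewrite rmorphD rmorph_nat /= mulrDr ab1.
have iterT n x : iter n T x = a%:R ^+ n * iter n tu x.
  elim: n => [|n IHn]; first by rewrite mul1r.
  by rewrite !iterS IHn /T rmorphM rmorphXn rmorph_nat mulrA exprS.
(* [T^m x0] equals [a^m x0]; it is translated by 1, but also by [a^m]. *)
have a_m : a%:R ^+ m = 1 :> L.
  have : sg (iter m T x0) = iter m T x0 + 1.
    by elim: (m) => // n IHn; rewrite !iterS T_translate.
  rewrite iterT tu_m rmorphM rmorphXn rmorph_nat /= sg_x0 mulrDr mulr1.
  by move/addrI.
have m_neq0 : m%:R != 0 :> L by rewrite -(dvdn_pcharf char_L).
pose beta := m%:R^-1 * \sum_(i < m) iter i T x0.
have sg_beta : sg beta = beta + 1.
  rewrite rmorphM fmorphV rmorph_nat rmorph_sum /=.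
  under eq_bigr => i _.
    have -> : sg (iter i T x0) = iter i T x0 + 1.
      by elim: (nat_of_ord i) => // n IHn; rewrite !iterS T_translate.
    over.
  by rewrite big_split sumr_const card_ord mulrDr mulVf.
have T_beta : a%:R * tu beta = beta.
  rewrite /beta rmorphM fmorphV rmorph_nat /= mulrCA rmorph_sum /= mulr_sumr.
  (* Adding [x0] turns the cyclic shift of the sum into two ways of splitting a sum of [m + 1]
     terms. *)
  congr (_ * _); apply: (@addIr _ x0).
  transitivity (\sum_(i < m.+1) iter i T x0).
    by rewrite big_ord_recl addrC; congr (_ + _); apply: eq_bigr => i _; rewrite /T.
  by rewrite big_ord_recr /= iterT a_m mul1r tu_m.
have ak_m : a%:R ^+ m = 1 :> k.
  by apply: (fmorph_inj (base_emb L)); rewrite rmorphXn rmorph_nat rmorph1.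
have a_neq0 : a%:R != 0 :> k.
  by apply/eqP => a0; move: ak_m; rewrite a0 expr0n gtn_eqF // => /esym/eqP; rewrite oner_eq0.
exists beta, a%:R^-1; split=> //.
- rewrite -[in RHS]T_beta mulrA fmorphV rmorph_nat mulVf ?mul1r //.
  by rewrite -(rmorph_nat (base_emb L)) fmorph_eq0.
- by rewrite exprVn ak_m invr1.
- by rewrite exprVn -(pFrobenius_autE char_k) rmorph_nat.
Qed.

(** [beta^p - beta] is fixed by [sigma] and scaled by [lambda = xi^e] under [tau], hence equals
    [c alpha^e] with [c] in [K]. Reducing [c] changes [beta] by some [g alpha^e], which respects
    both actions; [-r] is the exponent [m l + e] of [alpha] that remains. *)
Lemma artin_schreier_generator : exists (r : nat) (u : fps k) (beta : L),
  [/\ (0 < r)%N /\ ~~ (p %| r)%N, u \is a GRing.unit, (xi ^+ r) ^+ p = xi ^+ r,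
      beta ^+ p = beta + ring_emb L u * alpha ^- r
    & sg beta = beta + 1 /\ tu beta = base_emb L (xi ^- r) * beta].
Proof.
have [beta [lambda [sg_beta tu_beta lambda_m lambda_p]]] := exists_eigen_translate.
have [e lambdaE] := prim_rootP xi_prim lambda_m.
have alpha0 := alpha_neq0.
pose f := beta ^+ p - beta.
have sg_f : sg f = f.
  by rewrite rmorphB rmorphXn /= sg_beta (pexprD _ _ char_L) expr1n /f; ring.
have tu_f : tu f = base_emb L lambda * f.
  by rewrite rmorphB rmorphXn /= tu_beta exprMn -rmorphXn lambda_p mulrBr.
have xi_neq0 := prim_root_neq0 xi_prim.
have tu_alphaX n : tu (alpha ^+ n) = base_emb L (xi ^+ n) * alpha ^+ n.
  by rewrite !rmorphXn /= tu_alpha exprMn.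
have [||c cE] := @fixed (f / alpha ^+ e).
- by rewrite fmorph_div rmorphXn /= sg_f sg_alpha.
- rewrite fmorph_div /= tu_f tu_alphaX lambdaE -mulf_div divff ?mul1r //.
  by rewrite fmorph_eq0 expf_neq0.
have fE : f = c%:A * alpha ^+ e by rewrite -cE divfK // expf_neq0.
have p_gt0 : (0 < p)%N := prime_gt0 (pcharf_prime char_k).
(* Since Frobenius fixes [xi^e], [alpha^(e p) = t^q alpha^e]: [p]-th powers stay on the line
   [K alpha^e]. *)
have /dvdnP[q mq] : (m %| e * p.-1)%N.
  have : xi ^+ (e * p) == xi ^+ e by rewrite exprM -lambdaE lambda_p.
  rewrite (eq_prim_root_expr xi_prim) -{1}(prednK p_gt0) mulnS.
  by rewrite eqn_mod_dvd ?leq_addr // addKn.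
have [|g gP] := laurent_artin_schreier char_k c p'm (ltn_ord e) (q := q).
  by rewrite mulnC -mq.
pose y := beta - g%:A * alpha ^+ e.
have yE : y ^+ p - y = (c - (g ^+ p * laurent_t k ^+ q - g))%:A * alpha ^+ e.
  have ypE : y ^+ p = beta ^+ p - (g ^+ p * laurent_t k ^+ q)%:A * alpha ^+ e.
    rewrite (pexprB _ _ char_L) exprMn -exprM -(prednK p_gt0) mulnS mq.
    rewrite exprD [(q * m)%N]mulnC exprM alpha_m.
    rewrite !algE rmorphM !rmorphXn; congr (_ - _).
    by rewrite [in RHS]mulrAC mulrA.
  rewrite {}ypE /y; move: (g ^+ p * _) => G.
  rewrite !scalerBl !mulrBl -fE /f; move: (beta ^+ p) (_ * _) (_ * _) => A B C.
  by rewrite !opprB addrA; ring.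
have sg_y : sg y = y + 1.
  by rewrite rmorphB rmorphM rmorphXn /= sg_alg sg_beta sg_alpha addrAC.
have tu_y : tu y = base_emb L (xi ^+ e) * y.
  rewrite rmorphB rmorphM /= tu_alg tu_beta tu_alphaX lambdaE mulrBr.
  by congr (_ - _); rewrite mulrCA.
case: gP => [cg | [l [u [uu cg lt_r p'r]]]].
  (* If everything cancels, [y] lies in the prime field and is fixed by [sg], contradicting
     [sg y = y + 1]. *)
  have [|i yi] := @frobenius_fixed p L char_L y.
    by apply/eqP; rewrite -subr_eq0 yE cg subrr scale0r mul0r.
  move: sg_y; rewrite yi rmorph_nat => /eqP; rewrite -subr_eq0 opprD addNKr.
  by rewrite oppr_eq0 oner_eq0.
pose r := `|(m%:Z * l + e%:Z)%R|%N.
have rE : - r%:Z = m%:Z * l + e%:Z by rewrite /r; move: lt_r; clear; lia.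
have xi_r : xi ^- r = xi ^+ e.
  rewrite exprnN rE expfzDr // -exprz_exp -[xi ^ m%:Z]/(xi ^+ m).
  by rewrite prim_expr_order // exp1rz mul1r.
exists r, u, y; split=> //.
- by split=> //; rewrite /r; move: lt_r; clear; lia.
- by apply: invr_inj; rewrite -exprVn xi_r -lambdaE.
- apply/eqP; rewrite addrC -subr_eq yE cg algE rmorphM.
  rewrite exprnN rE expfzDr // -exprz_exp.
  rewrite -[alpha ^ m%:Z]/(alpha ^+ m) alpha_m algE -fmorphXz.
  by rewrite /ring_emb -mulrA [eqbRHS]mulrCA.
- by rewrite sg_y tu_y xi_r.
Qed.

End ArtinSchreierGenerator.

(** * The valuation *)

(** Invertibility of a Vandermonde matrix, by counting the roots of [\sum_j c j 'X^j]. *)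
Lemma powers_independent (R : idomainType) n (z : 'I_n -> R) (c : 'I_n -> R) :
    injective z -> (forall l, \sum_j c j * z l ^+ j = 0) -> forall j, c j = 0.
Proof.
move=> z_inj cz j; pose P := rVpoly (\row_j c j).
have P_size : (size P <= n)%N by apply: size_poly.
suff P0 : P = 0.
  by have := coef_rVpoly_ord (\row_j c j) j; rewrite -/P P0 coef0 mxE => <-.
apply/eqP; apply: contraLR (P_size) => P0; rewrite -ltnNge -(card_ord n) cardE.
rewrite -(size_map z); apply: max_poly_roots => //.
  apply/allP => _ /mapP[l _ ->]; apply/eqP; rewrite (horner_coef_wide _ P_size) -[RHS](cz l).
  by apply: eq_bigr => i _; rewrite coef_rVpoly_ord mxE.
by rewrite map_inj_uniq ?enum_uniq.
Qed.

(** [as_xi_r] says that [tau] scales [beta] by an element of the prime field; [as_dim] turns the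
    independent monomials into a basis. *)
Record artin_schreier_data (p m r : nat) (k : closedFieldType) (xi : k)
    (L : fieldExtType (laurent k)) (sg tu : {lrmorphism L -> L}) (alpha beta : L)
    (u : fps k) : Prop := ArtinSchreierData {
  as_char : p \in [pchar k];
  as_m : ~~ (p %| m)%N;
  as_xi : m.-primitive_root xi;
  as_r_gt0 : (0 < r)%N;
  as_r : ~~ (p %| r)%N;
  as_xi_r : (xi ^+ r) ^+ p = xi ^+ r;
  as_u : u \is a GRing.unit;
  as_alpha_m : alpha ^+ m = (laurent_t k)%:A;
  as_beta_p : beta ^+ p = beta + ring_emb L u * alpha ^- r;
  as_sg_alpha : sg alpha = alpha;
  as_tu_alpha : tu alpha = base_emb L xi * alpha;
  as_sg_beta : sg beta = beta + 1;
  as_tu_beta : tu beta = base_emb L (xi ^- r) * beta;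
  as_dim : \dim {:L} = (m * p)%N
}.

Section Valuation.
Variables (p m r : nat) (k : closedFieldType) (xi : k).
Variables (L : fieldExtType (laurent k)) (sg tu : {lrmorphism L -> L}).
Variables (alpha beta : L) (u : fps k).
Hypothesis X : artin_schreier_data p m r xi sg tu alpha beta u.
Local Notation K := (laurent k).
Local Notation t := (laurent_t k).

Let char_k := as_char X.
Let p'm := as_m X.
Let xi_prim := as_xi X.
Let r_gt0 := as_r_gt0 X.
Let p'r := as_r X.
Let u_unit := as_u X.
Let alpha_m := as_alpha_m X.
Let beta_p := as_beta_p X.
Let sg_alpha := as_sg_alpha X.
Let tu_alpha := as_tu_alpha X.
Let sg_beta := as_sg_beta X.
Let dimL := as_dim X.
Let m_gt0 : (0 < m)%N. Proof. exact: prim_order_gt0 xi_prim. Qed.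
Let p_pr : prime p. Proof. exact: pcharf_prime char_k. Qed.
Let p_gt1 : (1 < p)%N. Proof. exact: prime_gt1 p_pr. Qed.
Let p_gt0 : (0 < p)%N. Proof. exact: prime_gt0 p_pr. Qed.
Let alpha0 : alpha != 0. Proof. exact: alpha_neq0 xi_prim alpha_m. Qed.
Let char_L : p \in [pchar L]. Proof. exact: pchar_ext. Qed.
Let t_neq0 := laurent_t_neq0 k.

Definition monom (ij : 'I_m * 'I_p) : L := alpha ^+ ij.1 * beta ^+ ij.2.

(** A relation gives a polynomial in beta of degree < p with coefficients fixed by
    sg, which vanishes at the p conjugates beta + l; likewise for alpha and tu. *)
Lemma monom_independent (c : 'I_m * 'I_p -> K) :
  \sum_ij c ij *: monom ij = 0 -> forall ij, c ij = 0.
Proof.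
move=> c0; have {}c0 : \sum_(j < p) (\sum_(i < m) c (i, j) *: alpha ^+ i) * beta ^+ j = 0.
  rewrite -[RHS]c0; under eq_bigr do rewrite mulr_suml.
  rewrite exchange_big pair_bigA /=; apply: eq_bigr => -[i j] _.
  by rewrite -scalerAl.
have sg_F j : sg (\sum_(i < m) c (i, j) *: alpha ^+ i) = \sum_(i < m) c (i, j) *: alpha ^+ i.
  by rewrite rmorph_sum; apply: eq_bigr => i _; rewrite /= linearZ /= rmorphXn /= sg_alpha.
have c1 j : \sum_(i < m) c (i, j) *: alpha ^+ i = 0.
  move: j; apply: (@powers_independent _ _ (fun l : 'I_p => beta + (l : nat)%:R)).
    move=> l l' /addrI e; apply: val_inj.
    exact: (natr_inj_pchar char_L (ltn_ord l) (ltn_ord l') e).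
  move=> l; elim: (nat_of_ord l) => [|n IHn]; first by rewrite addr0.
  rewrite -[RHS](rmorph0 sg) -[in RHS]IHn rmorph_sum; apply: eq_bigr => j _ /=.
  rewrite rmorphM rmorphXn rmorphD rmorph_nat /= sg_F sg_beta.
  by rewrite -addrA [1 + _]addrC natr1.
move=> [i j]; have /eqP : (c (i, j))%:A = 0 :> L.
  move: i; apply: (@powers_independent _ _ (fun l : 'I_m => base_emb L (xi ^+ l) * alpha)).
    move=> l l' /(mulIf alpha0) /(fmorph_inj (base_emb L)) /eqP.
    by rewrite (eq_prim_root_expr xi_prim) !modn_small // => /eqP /val_inj.
  move=> l; elim: (nat_of_ord l) => [|n IHn].
    by rewrite -[RHS](c1 j); apply: eq_bigr => i _; rewrite rmorph1 mul1r mulr_algl.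
  have tuE : tu (base_emb L (xi ^+ n) * alpha) = base_emb L (xi ^+ n.+1) * alpha.
    rewrite rmorphM /= tu_alpha [tu (base_emb L _)]linearZ /= rmorph1.
    by rewrite exprSr [in RHS]rmorphM mulrA.
  rewrite -[RHS](rmorph0 tu) -[in RHS]IHn rmorph_sum; apply: eq_bigr => i _ /=.
  by rewrite [RHS]rmorphM [in RHS]rmorphXn /= tuE linearZ /= rmorph1.
by rewrite scaler_eq0 oner_eq0 orbF => /eqP.
Qed.

Definition monoms := codom_tuple monom.

Lemma monoms_nth (i : 'I_#|{: 'I_m * 'I_p}|) : monoms`_i = monom (enum_val i).
Proof.
rewrite (nth_map (enum_val i)) -?cardE ?ltn_ord //; congr monom.
exact: (esym (enum_val_nth (enum_val i) i)).
Qed.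

Lemma sum_monomsE (c : 'I_m * 'I_p -> K) :
  \sum_ij c ij *: monom ij = \sum_(i < #|{: 'I_m * 'I_p}|) c (enum_val i) *: monoms`_i.
Proof.
pose h (i : 'I_#|{: 'I_m * 'I_p}|) := enum_val i.
rewrite (reindex h) /=; last by apply: onW_bij; apply: enum_val_bij.
by apply: eq_bigr => j _; rewrite monoms_nth.
Qed.

Lemma monoms_free : free monoms.
Proof.
apply/freeP => c c0 i; rewrite -[i]enum_valK.
apply: (@monom_independent (fun ij => c (enum_rank ij))).
by rewrite -[RHS]c0 sum_monomsE; apply: eq_bigr => j _; rewrite enum_valK.
Qed.

Definition mcoord (ij : 'I_m * 'I_p) (x : L) : K := coord monoms (enum_rank ij) x.

Lemma mcoordD ij x y : mcoord ij (x + y) = mcoord ij x + mcoord ij y.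
Proof. exact: linearD. Qed.

Lemma mcoordB ij x y : mcoord ij (x - y) = mcoord ij x - mcoord ij y.
Proof. exact: linearB. Qed.

Lemma mcoordZ ij c x : mcoord ij (c *: x) = c * mcoord ij x.
Proof. exact: linearZ. Qed.

Lemma mcoord0 ij : mcoord ij 0 = 0.
Proof. exact: linear0. Qed.

Lemma mcoord_sum (c : 'I_m * 'I_p -> K) ij : mcoord ij (\sum_ij' c ij' *: monom ij') = c ij.
Proof.
by rewrite sum_monomsE /mcoord coord_sum_free ?monoms_free // enum_rankK.
Qed.

Lemma mcoordE x : x = \sum_ij mcoord ij x *: monom ij.
Proof.
have monoms_basis : basis_of {:L} monoms.
  by rewrite basisEfree monoms_free subvf dimL size_tuple card_prod !card_ord leqnn.
rewrite sum_monomsE [LHS](coord_basis monoms_basis (memvf x)).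
by apply: eq_bigr => i _; rewrite /mcoord enum_valK.
Qed.

Lemma mcoord_monom ij c ij' : mcoord ij' (c *: monom ij) = if ij' == ij then c else 0.
Proof.
have -> : c *: monom ij = \sum_ij' (if ij' == ij then c else 0) *: monom ij'.
  rewrite (bigD1 ij) //= eqxx big1 ?addr0 // => i /negPf->.
  by rewrite scale0r.
by rewrite mcoord_sum.
Qed.

(** Valuation of [t^l monom ij] *)
Definition mval (l : int) (ij : 'I_m * 'I_p) : int :=
  (m * p)%:Z * l + (p * ij.1)%:Z - (r * ij.2)%:Z.

(** x has normalised valuation at least N *)
Definition vge (N : int) (x : L) : Prop :=
  forall ij, exists2 l, kge l (mcoord ij x) & N <= mval l ij.

Lemma mval_le l l' ij : l <= l' -> mval l ij <= mval l' ij.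
Proof. by move=> le_l; rewrite /mval !lerD2r ler_wpM2l. Qed.

Lemma mval_lt l l' ij : l < l' -> mval l ij < mval l' ij.
Proof.
by move=> lt_l; rewrite /mval !ltrD2r ltr_pM2l // ltz_nat muln_gt0 m_gt0.
Qed.

Lemma mvalD l l' ij : mval (l + l') ij = (m * p)%:Z * l + mval l' ij.
Proof. by rewrite /mval; ring. Qed.

Lemma vge0 N : vge N 0.
Proof.
move=> ij; exists `|N - mval 0 ij|; first by rewrite mcoord0; apply: kge0.
rewrite -[X in mval X]addr0 mvalD.
have : (1 <= m * p)%N by rewrite muln_gt0 m_gt0.
by move: (m * p)%N (mval 0 ij) => n w; clear; nia.
Qed.

Lemma vge_le N N' x : vge N x -> N' <= N -> vge N' x.
Proof. by move=> vx le_N ij; have [l ? ?] := vx ij; exists l => //; apply: le_trans le_N _. Qed.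

Lemma vgeD N x y : vge N x -> vge N y -> vge N (x + y).
Proof.
move=> vx vy ij; have [l kx lx] := vx ij; have [l' ky ly] := vy ij.
rewrite mcoordD; have [le_l | le_l] := lerP l l'.
  by exists l => //; apply: kgeD kx (kge_le le_l ky).
by exists l' => //; apply: kgeD (kge_le (ltW le_l) kx) ky.
Qed.

Lemma vgeZ l N c x : kge l c -> vge N x -> vge ((m * p)%:Z * l + N) (c *: x).
Proof.
move=> kc vx ij; have [l' kx lx] := vx ij; exists (l + l').
  by rewrite mcoordZ; apply: kgeM.
by move: lx; rewrite /mval; clear; nia.
Qed.

Lemma vgeZ_fps N f x : vge N x -> vge N (ring_emb L f * x).
Proof.
rewrite /ring_emb mulr_algl => /(vgeZ (kge_fps f)).
by rewrite mulr0 add0r.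
Qed.

Lemma vgeN N x : vge N x -> vge N (- x).
Proof. by move/(vgeZ_fps (-1)); rewrite rmorphN1 mulN1r. Qed.

Lemma vgeB N x y : vge N x -> vge N y -> vge N (x - y).
Proof. by move=> vx /vgeN; apply: vgeD. Qed.

Lemma vge_sum N (I : finType) (P : pred I) (F : I -> L) :
  (forall i, P i -> vge N (F i)) -> vge N (\sum_(i | P i) F i).
Proof. by move=> vF; apply: big_ind => //; [apply: vge0 | apply: vgeD]. Qed.

Lemma vge_monom l c ij : kge l c -> vge (mval l ij) (c *: monom ij).
Proof.
move=> kc ij'; rewrite mcoord_monom; case: eqP => [->|_]; first by exists l.
by have [l' k0 ?] := @vge0 (mval l ij) ij'; exists l' => //; apply: kge0.
Qed.

Definition laurent_monom (I : int) (J : nat) : L := alpha ^ I * beta ^+ J.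

(** The family [laurent_monom I J], with valuations [p I - r J], is stable under
    products; for [J < p] these are the basis elements up to powers of t, and
    larger J are reduced by the equation of beta. *)
Lemma laurent_monom_small I (J : 'I_p) : exists (i : 'I_m) (q : int),
  p%:Z * I - r%:Z * (J : nat)%:Z = mval q (i, J) /\ laurent_monom I J = t ^ q *: monom (i, J).
Proof.
have m_neq0 : m%:Z != 0 by rewrite eqz_nat -lt0n.
have lt_im : (`|(I %% m)%Z| < m)%N.
  by rewrite -ltz_nat gez0_abs ?modz_ge0 // ltz_pmod.
exists (Ordinal lt_im), (I %/ m)%Z.
have IE : I = m%:Z * (I %/ m)%Z + `|(I %% m)%Z|%N%:Z.
  by rewrite gez0_abs ?modz_ge0 // mulrC -divz_eq.
split; first by rewrite /mval /= [in LHS]IE !PoszM; ring.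
rewrite /laurent_monom /monom /= [in alpha ^ I]IE expfzDr // -exprz_exp.
rewrite -[alpha ^ m%:Z]/(alpha ^+ m) alpha_m -mulrA -[RHS]mulr_algl.
by rewrite -[_%:A]/(in_alg L _) -fmorphXz.
Qed.

Lemma laurent_monom_big I J : (p <= J)%N ->
  laurent_monom I J = laurent_monom I (J - p).+1
    + ring_emb L u * laurent_monom (I - r%:Z) (J - p).
Proof.
move=> le_pJ; rewrite /laurent_monom -[in LHS](subnK le_pJ) exprD beta_p.
rewrite expfzDr // -exprnN exprS; ring.
Qed.

(** When [beta^p] is replaced, the term with [u alpha^-r] keeps the value [p I - r J] and the other
    one gains [r (p - 1)]. *)
Lemma vge_laurent_monom I J : vge (p%:Z * I - r%:Z * J%:Z) (laurent_monom I J).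
Proof.
elim/ltn_ind: J I => J IHJ I; have [le_pJ | lt_Jp] := leqP p J.
  rewrite laurent_monom_big //; apply: vgeD.
    apply: vge_le (IHJ _ _ I) _; first by move: le_pJ p_gt1; clear; lia.
    by move: le_pJ r_gt0 p_gt1; clear; nia.
  apply: vgeZ_fps; apply: vge_le (IHJ _ _ _) _; first by move: le_pJ p_gt0; clear; lia.
  by move: le_pJ; clear; nia.
have [i [q [IE ->]]] := laurent_monom_small I (Ordinal lt_Jp).
by rewrite IE; apply: vge_monom (kge_t k q).
Qed.

Lemma vgeM N M x y : vge N x -> vge M y -> vge (N + M) (x * y).
Proof.
move=> vx vy; rewrite (mcoordE x) (mcoordE y) mulr_suml.
apply: vge_sum => ij _; rewrite mulr_sumr; apply: vge_sum => ij' _.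
have [l kx lx] := vx ij; have [l' ky ly] := vy ij'.
have -> : mcoord ij x *: monom ij * (mcoord ij' y *: monom ij')
  = (mcoord ij x * mcoord ij' y) *: laurent_monom (ij.1 + ij'.1)%N%:Z (ij.2 + ij'.2).
  rewrite -scalerAl -scalerAr scalerA; congr (_ *: _).
  by rewrite /laurent_monom /monom -exprnP !exprD; ring.
apply: vge_le (vgeZ (kgeM kx ky) (vge_laurent_monom _ _)) _.
have -> : (m * p)%:Z * (l + l') + (p%:Z * (ij.1 + ij'.1)%N%:Z - r%:Z * (ij.2 + ij'.2)%N%:Z)
          = mval l ij + mval l' ij' by rewrite /mval !PoszD !PoszM; ring.
exact: lerD.
Qed.

(** The same reduction, in which only the term of unchanged value matters. The factor [w] absorbs
    the powers of [u] that accumulate and remains a unit. *)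
Lemma laurent_monom_exact w I J : w \is a GRing.unit ->
  ~ vge (p%:Z * I - r%:Z * J%:Z + 1) (ring_emb L w * laurent_monom I J).
Proof.
elim/ltn_ind: J w I => J IHJ w I w_unit; have [le_pJ | lt_Jp] := leqP p J.
  rewrite laurent_monom_big // mulrDr (mulrA (ring_emb L w) (ring_emb L u)).
  rewrite -(rmorphM (ring_emb L)) => vw.
  apply: (IHJ (J - p)%N _ (w * u) (I - r%:Z)); rewrite ?unitrM ?w_unit ?u_unit //.
    by move: le_pJ p_gt0; clear; lia.
  rewrite -[X in vge _ X](addKr (ring_emb L w * laurent_monom I (J - p).+1)); apply: vgeD.
    apply/vgeN/vgeZ_fps; apply: vge_le (vge_laurent_monom _ _) _.
    by move: le_pJ r_gt0 p_gt1; clear; nia.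
  by apply: vge_le vw _; move: le_pJ; clear; nia.
have [i [q [IE ->]]] := laurent_monom_small I (Ordinal lt_Jp).
rewrite /ring_emb mulr_algl scalerA [tofrac w * _]mulrC => /(_ (i, Ordinal lt_Jp))[l].
rewrite mcoord_monom eqxx => /(kge_unit w_unit) le_l.
by rewrite IE => /le_trans/(_ (mval_le _ le_l)); rewrite gerDl.
Qed.

(** [r] and [p] are coprime: with [a r + b p = 1], [J] is the residue of [- N a] modulo [p]. *)
Lemma exists_laurent_monom N : exists I (J : 'I_p), p%:Z * I - r%:Z * (J : nat)%:Z = N.
Proof.
have [[a b] /= ab1] : exists ab : int * int, ab.1 * r%:Z + ab.2 * p%:Z = 1.
  have := Bezoutz r%:Z p%:Z => -[a [b ab]]; exists (a, b); rewrite /= ab.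
  rewrite /gcdz !absz_nat; congr Posz; apply/eqP; rewrite -/(coprime r p).
  by rewrite coprime_sym prime_coprime.
have p_neq0 : p%:Z != 0 by rewrite eqz_nat -lt0n.
have lt_Jp : (`|(- (N * a) %% p)%Z| < p)%N.
  by rewrite -ltz_nat gez0_abs ?modz_ge0 // ltz_pmod.
have JE : - (N * a) = p%:Z * (- (N * a) %/ p)%Z + `|(- (N * a) %% p)%Z|%N%:Z.
  by rewrite gez0_abs ?modz_ge0 // [p%:Z * _]mulrC -divz_eq.
exists (N * b - r%:Z * (- (N * a) %/ p)%Z), (Ordinal lt_Jp) => /=.
move: JE; move: (- (N * a) %/ p)%Z `|(- (N * a) %% p)%Z|%N%:Z => q J JE.
rewrite -[RHS]mulr1 -ab1.
have -> : J = - (N * a) - p%:Z * q by rewrite JE addrAC subrr add0r.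
ring.
Qed.

Lemma vge_base N c x : vge N x -> vge N (base_emb L c * x).
Proof. exact: vgeZ_fps. Qed.

(** Modulo [p] the value determines [j], as [p] does not divide [r]; what is left, divided by [p],
    determines [i] modulo [m]. *)
Lemma mval_inj l l' ij ij' : mval l ij = mval l' ij' -> ij = ij' /\ l = l'.
Proof.
case: ij ij' => [i j] [i' j']; rewrite /mval /= => e.
have jj' : j = j'.
  apply: val_inj => /=; apply/eqP.
  have : (p%:Z %| r%:Z * (j%:Z - j'%:Z))%Z.
    have -> : r%:Z * (j%:Z - j'%:Z) = p%:Z * (m%:Z * (l - l') + i%:Z - i'%:Z).
      by move: e; rewrite !PoszM; clear; nia.
    by rewrite dvdz_mulr.
  rewrite Gauss_dvdzr; last by rewrite coprimezE !absz_nat prime_coprime.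
  by rewrite -eqz_mod_dvd !modz_small ?ltz_nat ?ltn_ord // eqz_nat.
have ii' : m%:Z * (l - l') = i'%:Z - i%:Z.
  by move: e; rewrite jj' !PoszM; move: p_gt0; clear; nia.
have ei : i = i'.
  have : (m%:Z %| i'%:Z - i%:Z)%Z by rewrite -ii' dvdz_mulr.
  rewrite -eqz_mod_dvd !modz_small ?ltz_nat ?ltn_ord // eqz_nat => /eqP ei.
  by apply: val_inj.
rewrite ei jj'; split=> //; move/eqP: ii'; rewrite ei subrr mulf_eq0 eqz_nat.
by rewrite (gtn_eqF m_gt0) subr_eq0 => /eqP.
Qed.

(** Total ramification: each graded piece of the filtration is a line over [k], because a single
    basis monomial, up to a power of [t], takes the value [N]. *)
Lemma vge_lead N : exists I J, p%:Z * I - r%:Z * (J : nat)%:Z = N /\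
  forall x, vge N x -> exists c, vge (N + 1) (x - base_emb L c * laurent_monom I J).
Proof.
have [I [J NE]] := exists_laurent_monom N; exists I, J; split=> // x vx.
have [i [q [qE ->]]] := laurent_monom_small I J.
have [l kx lx] := vx (i, J).
have {l kx lx} [f fE] : kge q (mcoord (i, J) x).
  apply: kge_le kx; rewrite leNgt; apply/negP => lt_lq.
  by have := @mval_lt _ _ (i, J) lt_lq; rewrite -qE NE ltNge lx.
exists (fps_coef f 0) => ij; rewrite mcoordB /base_emb /ring_emb mulr_algl scalerA mcoord_monom.
case: eqP => [-> | neq_ij].
  exists (q + 1); last first.
    by rewrite [q + 1]addrC mvalD mulr1 -qE NE [X in _ <= X]addrC lerD2l lez_nat muln_gt0 m_gt0.
  exists (fps_shift f); rewrite fE {1}(fps_shiftE f) rmorphD rmorphM /= -/t.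
  rewrite expfzDr // expr1z mulrDr mulrC [_ * t ^ q]mulrC mulrA.
  by move: (_ * _) (_ * _) => A B; rewrite addrC addrA addNr add0r.
have [l' kx' lx'] := vx ij; exists l'; first by rewrite subr0.
move: lx'; rewrite lezD1 le_eqVlt => /predU1P[e | //].
by case: neq_ij; apply: (proj1 (@mval_inj l' q ij (i, J) _)); rewrite -e -qE NE.
Qed.

(** Value exactly [N], as a relation, so that 0 has no value at all. *)
Definition vex N x := vge N x /\ ~ vge (N + 1) x.

Lemma vex_lead N x : vex N x -> exists I J (c : k) x',
  [/\ p%:Z * I - r%:Z * (J : nat)%:Z = N, c != 0, vge (N + 1) x'
    & x = base_emb L c * laurent_monom I J + x'].
Proof.
move=> [vx nvx]; have [I [J [NE lead]]] := vge_lead N; have [c vc] := lead x vx.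
exists I, J, c, (x - base_emb L c * laurent_monom I J); split=> //.
  by apply: contra_notN nvx => /eqP c0; move: vc; rewrite c0 rmorph0 mul0r subr0.
by rewrite addrC subrK.
Qed.

Lemma const_unit (c : k) : c != 0 -> fps_const c \is a GRing.unit.
Proof. by move=> c0; apply/fps_unitP. Qed.

Lemma vex_laurent_monom c I J : c != 0 ->
  vex (p%:Z * I - r%:Z * J%:Z) (base_emb L c * laurent_monom I J).
Proof.
move=> c0; split; first exact/vge_base/vge_laurent_monom.
exact: laurent_monom_exact (const_unit c0).
Qed.

Lemma vex_addr N x y : vex N x -> vge (N + 1) y -> vex N (x + y).
Proof.
move=> [vx nvx] vy; split; first by apply: vgeD => //; apply: vge_le vy _; rewrite lerDl.
by move=> /vgeB/(_ vy); rewrite addrK.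
Qed.

Lemma vex_uniq N M x : vex N x -> vex M x -> N = M.
Proof.
move=> [vN nvN] [vM nvM]; apply: le_anti; rewrite !leNgt; apply/andP; split; apply/negP.
  by rewrite -lezD1 => /(vge_le vN).
by rewrite -lezD1 => /(vge_le vM).
Qed.

(** The leading monomials multiply to [laurent_monom (I + I') (J + J')], whose value is exact even
    if [J + J'] reaches [p]; all other terms have larger value. *)
Lemma vexM N M x y : vex N x -> vex M y -> vex (N + M) (x * y).
Proof.
move=> /[dup] [[vx _]] /vex_lead[I [J [c [x' [NE c0 vx' xE]]]]].
move=> /[dup] [[vy _]] /vex_lead[I' [J' [c' [y' [ME c0' vy' yE]]]]].
have -> : x * y = base_emb L (c * c') * laurent_monom (I + I') (J + J')
     + (x' * y + base_emb L c * laurent_monom I J * y').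
  rewrite xE yE rmorphM /laurent_monom expfzDr // exprD; ring.
apply: vex_addr.
  have -> : N + M = p%:Z * (I + I') - r%:Z * (J + J')%N%:Z by rewrite -NE -ME PoszD; ring.
  by apply: vex_laurent_monom; rewrite mulf_neq0.
apply: vgeD; first by rewrite addrAC; apply: vgeM.
by rewrite -addrA; apply: vgeM => //; rewrite -NE; apply/vge_base/vge_laurent_monom.
Qed.

(** A nonzero coordinate bounds the value from above, the finitely many coordinates together bound
    it from below; the last bound that holds in between is the value. *)
Lemma exists_vex x : x != 0 -> exists N, vex N x.
Proof.
move=> x0; have [ij cij] : exists ij, mcoord ij x != 0.
  apply: contrapT => /forallNP cd0'; case/eqP: x0; rewrite (mcoordE x) big1 // => ij _.
  by have /negP/negPn/eqP -> := cd0' ij; rewrite scale0r.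
have [l [w [w_unit cE]]] := laurent_decomp cij.
have nv : ~ vge (mval l ij + 1) x.
  move=> /(_ ij)[l']; rewrite cE => /(kge_unit w_unit) le_l.
  by rewrite leNgt ltzD1 mval_le.
have [N0 vN0] : exists N0, vge N0 x.
  have kx ij' : exists l', kge l' (mcoord ij' x).
    have [-> | /laurent_decomp[l' [w' [_ ->]]]] := eqVneq (mcoord ij' x) 0.
      by exists 0; apply: kge0.
    by exists l', w'.
  pose lx ij' := projT1 (cid (kx ij')).
  exists (- \sum_ij' `|mval (lx ij') ij'|) => ij'.
  exists (lx ij'); first exact: projT2 (cid (kx ij')).
  rewrite lerNl (bigD1 ij') //= ler_wpDr ?sumr_ge0 //.
  by rewrite -normrN ler_norm.
suff main n : ~ vge (N0 + n%:Z) x -> exists N, vex N x.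
  apply: (main `|(mval l ij + 1 - N0)%R|%N); contradict nv; apply: vge_le nv _.
  by move: (mval _ _ + 1); clear; lia.
elim: n => [|n IHn]; first by rewrite addr0.
have [vn | nvn _] := pselect (vge (N0 + n%:Z) x); last exact: IHn.
by rewrite -addn1 PoszD addrA => nvn; exists (N0 + n%:Z).
Qed.

Lemma vex_neq0 N x : vex N x -> x != 0.
Proof. by case=> _; apply: contra_notN => /eqP ->; apply: vge0. Qed.

Lemma vex1 : vex 0 1.
Proof.
have := @vex_laurent_monom 1 0 0 (oner_neq0 k).
by rewrite rmorph1 /laurent_monom expr0z expr0 !mulr1 !mulr0 subr0.
Qed.

Lemma vexV N x : vex N x -> vex (- N) x^-1.
Proof.
move=> vx; have x0 := vex_neq0 vx; have [M vM] := exists_vex (invr_neq0 x0).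
have := vexM vx vM; rewrite divff // => /(vex_uniq vex1) /esym NM.
by have -> : - N = M by move: NM; clear; lia.
Qed.

Lemma vexP N x : vex N x -> forall M, vge M x <-> (M <= N).
Proof.
move=> [vx nvx] M; split=> [vM | le_MN]; last exact: vge_le vx le_MN.
by rewrite leNgt; apply/negP; rewrite -lezD1 => /(vge_le vM).
Qed.

(** * The integral closure as the valuation ring *)

Lemma integral_vge x : int_closure L x -> vge 0 x.
Proof.
case=> P /(monic_map (ring_emb L)) Q_mon; set Q := map_poly _ P in Q_mon * => /rootP Qx.
apply: contrapT => nvx.
have x0 : x != 0 by apply: contra_notN nvx => /eqP ->; apply: vge0.
have [N vN] := exists_vex x0.
have N_lt0 : N < 0 by rewrite ltNge; apply/negP => /(vexP vN).
have [_ nv1] := vex1; case: nv1; rewrite add0r.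
pose n := (size Q).-1.
have szQ : size Q = n.+1 by rewrite prednK // size_poly_gt0 monic_neq0.
have Qn : Q`_n = 1 by rewrite -[n]/((size Q).-1) -lead_coefE (monicP Q_mon).
have vy : vge 1 x^-1 by apply: vge_le (vexV vN).1 _; move: N_lt0; clear; lia.
have vyn i : (0 < i)%N -> vge 1 (x^-1 ^+ i).
  elim: i => // -[_ _|i IHi _]; first by rewrite expr1.
  by rewrite exprS; apply: vge_le (vgeM vy (IHi isT)) _.
(* The monic equation divided by [x^n]: with [x] of negative value, every term on the right has
   value at least 1. *)
have -> : 1 = - \sum_(i < n) Q`_i * x^-1 ^+ (n - i).
  have := congr1 (fun z => z * x^-1 ^+ n) Qx.
  rewrite mul0r horner_coef szQ big_ord_recr /= Qn mul1r mulrDl exprVn divff ?expf_neq0 //.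
  rewrite addrC => /eqP; rewrite addr_eq0 => /eqP ->; congr (- _).
  rewrite mulr_suml; apply: eq_bigr => i _; rewrite -mulrA; congr (_ * _).
  rewrite -exprVn; have -> : x^-1 ^+ n = x^-1 ^+ (n - i) * x^-1 ^+ i.
    by rewrite -exprD subnK // ltnW.
  by rewrite mulrCA -exprMn divff // expr1n mulr1.
apply/vgeN/vge_sum => i _; rewrite coef_map; apply/vgeZ_fps/vyn.
by rewrite subn_gt0.
Qed.

Lemma integral_expn x n : (0 < n)%N -> int_closure L (x ^+ n) -> int_closure L x.
Proof.
move=> n_gt0 int_xn; apply: (@integral_root_monic _ _ (ring_emb L) _ ('X^n - (x ^+ n)%:P)).
- exact: monicXnsubC.
- by rewrite /root !hornerE subrr.
apply/integral_poly => i; rewrite coefB coefXn coefC.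
by apply: integral_sub; [apply: integral_nat | case: ifP => _; [|apply: integral0]].
Qed.

Lemma integralX x n : int_closure L x -> int_closure L (x ^+ n).
Proof.
move=> int_x; elim: n => [|n IHn]; first exact: integral1.
by rewrite exprS; apply: integral_mul.
Qed.

Lemma integral_alpha : int_closure L alpha.
Proof. by apply: (integral_expn m_gt0); rewrite alpha_m; apply: integral_id. Qed.

(** The equation of [beta] times [alpha^(r p)] reads [b^p = a b + a u], with [a = alpha^(r (p - 1))]
    integral. *)
Lemma integral_alpha_beta : int_closure L (alpha ^+ r * beta).
Proof.
set b := _ * _; pose a := alpha ^+ (r * p.-1).
have bE : b ^+ p = a * b + a * ring_emb L u.
  rewrite exprMn beta_p -exprM -[in (r * p)%N](prednK p_gt0) mulnS addnC exprD -/a /b.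
  by rewrite mulrDr -!mulrA; congr (_ + a * _); rewrite mulrCA divff ?expf_neq0 ?mulr1.
pose Q : {poly L} := a *: 'X + (a * ring_emb L u)%:P.
have szQ : (size Q < size ('X^p : {poly L}))%N.
  rewrite size_polyXn ltnS (leq_trans (size_polyD _ _)) // geq_max.
  rewrite (leq_trans (size_scale_leq _ _)) ?size_polyX //=.
  by rewrite (leq_trans (size_polyC_leq1 _)).
have int_a : int_closure L a by apply/integralX/integral_alpha.
apply: (@integral_root_monic _ _ (ring_emb L) _ ('X^p - Q)).
- by rewrite monicE lead_coefDl ?size_polyN // lead_coefXn.
- by rewrite /root hornerD hornerN hornerXn bE /Q hornerD hornerZ hornerX hornerC subrr.
apply/integral_poly => i; rewrite coefB coefXn coefD coefZ coefX coefC.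
apply: integral_sub; first exact: integral_nat.
apply: integral_add; first by apply: integral_mul => //; apply: integral_nat.
by case: ifP => _; [apply: integral_mul => //; apply: integral_id | apply: integral0].
Qed.

(** Each term is [alpha^I beta^j] times a power series, and the [p]-th power of [alpha^I beta^j] is
    [alpha^(p I - r j) (alpha^r beta + u)^j], a product of integral elements. *)
Lemma vge_integral x : vge 0 x -> int_closure L x.
Proof.
move=> vx; rewrite (mcoordE x); apply: big_ind => [||ij _].
- exact: integral0.
- exact: integral_add.
have [l [f ->] lx] := vx ij.
have wtE : mval l ij = p%:Z * (m%:Z * l + ij.1%:Z) - (r * ij.2)%N%:Z.
  by rewrite /mval !PoszM; ring.
have le_I : 0 <= m%:Z * l + ij.1%:Z.
  by move: lx p_gt0; rewrite wtE; move: (r * _)%N (m%:Z * _ + _); clear; nia.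
have [I IE] : exists I : nat, m%:Z * l + ij.1%:Z = I%:Z.
  by exists `|(m%:Z * l + ij.1%:Z)%R|%N; rewrite gez0_abs.
have le_rj : (r * ij.2 <= p * I)%N.
  by move: lx; rewrite wtE IE subr_ge0 -PoszM lez_nat.
have -> : (t ^ l * tofrac f) *: monom ij = ring_emb L f * (alpha ^+ I * beta ^+ ij.2).
  rewrite mulrC -scalerA -mulr_algl -[X in X * _]/(ring_emb L f); congr (_ * _).
  rewrite /monom [alpha ^+ I]exprnP -IE expfzDr // -exprz_exp -[alpha ^ m%:Z]/(alpha ^+ m) alpha_m.
  by rewrite -mulrA -[LHS]mulr_algl -[t%:A]/(in_alg L t) -fmorphXz.
apply: integral_mul; first exact: integral_id.
apply: (integral_expn p_gt0).
have -> : (alpha ^+ I * beta ^+ ij.2) ^+ p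
    = alpha ^+ (p * I - r * ij.2) * (alpha ^+ r * beta + ring_emb L u) ^+ ij.2.
  rewrite exprMn -[in RHS](divfK (expf_neq0 r alpha0) (ring_emb L u)).
  rewrite [in RHS](mulrC _ (alpha ^+ r)) -mulrDr -beta_p exprMn -!exprM mulrA -exprD.
  by rewrite subnK // [(I * p)%N]mulnC [(ij.2 * p)%N]mulnC.
apply: integral_mul; first exact/integralX/integral_alpha.
by apply: integralX; apply: integral_add; [apply: integral_alpha_beta | apply: integral_id].
Qed.

Lemma int_closureE x : int_closure L x <-> vge 0 x.
Proof. by split; [apply: integral_vge | apply: vge_integral]. Qed.

End Valuation.

Lemma sum_pair (V : nmodType) (I J : finType) (G : I * J -> V) :
  \sum_ij G ij = \sum_i \sum_j G (i, j).
Proof. by rewrite pair_bigA; apply: eq_bigr => -[]. Qed.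

(** * The actions of [sigma] and [tau] on expansions *)

Section Ramification.
Variables (p m r : nat) (k : closedFieldType) (xi : k).
Variables (L : fieldExtType (laurent k)) (sg tu : {lrmorphism L -> L}).
Variables (alpha beta : L) (u : fps k).
Hypothesis X : artin_schreier_data p m r xi sg tu alpha beta u.
Local Notation K := (laurent k).
Local Notation t := (laurent_t k).
Local Notation vge := (vge p m r alpha beta).
Local Notation vex := (vex p m r alpha beta).
Local Notation laurent_monom := (laurent_monom alpha beta).
Local Notation monom := (@monom p m k L alpha beta).
Local Notation mcoord := (@mcoord p m k L alpha beta).

Let char_k := as_char X.
Let xi_prim := as_xi X.
Let r_gt0 := as_r_gt0 X.
Let p'r := as_r X.
Let sg_alpha := as_sg_alpha X.
Let tu_alpha := as_tu_alpha X.
Let sg_beta := as_sg_beta X.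
Let m_gt0 : (0 < m)%N. Proof. exact: prim_order_gt0 xi_prim. Qed.
Let p_pr : prime p. Proof. exact: pcharf_prime char_k. Qed.
Let p_gt1 : (1 < p)%N. Proof. exact: prime_gt1 p_pr. Qed.
Let p_gt0 : (0 < p)%N. Proof. exact: prime_gt0 p_pr. Qed.

Lemma base_embE c (x : L) : base_emb L c * x = tofrac (fps_const c) *: x.
Proof. exact: mulr_algl. Qed.

(** This makes the steps of the filtration in [triangular_length] simple. *)
Lemma vge_residue N x y : vge N x -> vge N y -> ~ vge (N + 1) y ->
  exists c, vge (N + 1) (x - base_emb L c * y).
Proof.
move=> vx vy nvy; have [I [J [_ lead]]] := vge_lead X N.
have [c vc] := lead x vx; have [c' vc'] := lead y vy.
have c'0 : c' != 0.
  by apply: contra_notN nvy => /eqP c'0; move: vc'; rewrite c'0 rmorph0 mul0r subr0.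
exists (c / c').
have -> : x - base_emb L (c / c') * y = (x - base_emb L c * laurent_monom I J)
    - base_emb L (c / c') * (y - base_emb L c' * laurent_monom I J).
  have bE : base_emb L (c / c') * (base_emb L c' * laurent_monom I J)
            = base_emb L c * laurent_monom I J by rewrite mulrA -rmorphM divfK.
  rewrite mulrBr bE; move: (_ * y) (_ * laurent_monom _ _) => A B.
  by rewrite opprB addrA subrK.
by apply: vgeB => //; apply: vge_base.
Qed.

Lemma vge_strict N : exists2 x, vge N x & ~ vge (N + 1) x.
Proof.
have [I [J <-]] := exists_laurent_monom X N.
have [v nv] := vex_laurent_monom X I J (oner_neq0 k).
by exists (base_emb L 1 * laurent_monom I J).
Qed.

Lemma tu_base (c : k) : tu (base_emb L c) = base_emb L c.
Proof. by rewrite linearZ /= rmorph1. Qed.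

Lemma sg_base (c : k) : sg (base_emb L c) = base_emb L c.
Proof. by rewrite linearZ /= rmorph1. Qed.

Lemma tu_laurent_monom I J : tu (laurent_monom I J) =
  base_emb L (xi ^ I * (xi ^- r) ^+ J) * laurent_monom I J.
Proof.
rewrite /laurent_monom rmorphM fmorphXz rmorphXn /= tu_alpha (as_tu_beta X).
by rewrite exprMn expfzMl rmorphM fmorphXz [in RHS]rmorphXn mulrACA.
Qed.

Lemma iter_sg_laurent_monom n I J :
  iter n sg (laurent_monom I J) = alpha ^ I * (beta + n%:R) ^+ J.
Proof.
elim: n => [|n IHn]; first by rewrite addr0.
rewrite iterS IHn rmorphM fmorphXz rmorphXn rmorphD rmorph_nat /= sg_alpha sg_beta.
by rewrite -addrA [1 + _]addrC natr1.
Qed.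

Lemma translate_laurent_monom n I J : alpha ^ I * (beta + n%:R) ^+ J =
  laurent_monom I J + \sum_(j < J) (n ^ (J - j) * 'C(J, j))%:R * laurent_monom I j.
Proof.
rewrite addrC exprDn mulr_sumr big_ord_recr /= subnn mul1r binn mulr1n addrC.
congr (_ + _); apply: eq_bigr => j _.
by rewrite natrM natrX -[in LHS]mulr_natl /laurent_monom; ring.
Qed.

Lemma vge_natr N n x : vge N x -> vge N (n%:R * x).
Proof. by rewrite -(rmorph_nat (base_emb L)); apply: vge_base. Qed.

Lemma vge_translate n I J :
  vge (p%:Z * I - r%:Z * J%:Z + r%:Z) (alpha ^ I * (beta + n%:R) ^+ J - laurent_monom I J).
Proof.
rewrite translate_laurent_monom [X in vge _ X]addrAC subrr add0r; apply: (vge_sum X) => j _.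
apply: vge_natr; apply: vge_le (vge_laurent_monom X I j) _.
by have := ltn_ord j; move: r_gt0; clear; nia.
Qed.

(** Terms without [beta] are fixed, and on the others [sigma - 1] gains at least [r]. The additional
    1 is there because no term with [0 < j < p] has value 0: [p] does not divide [r j]. *)
Lemma vge_sg_sub1 x : vge 0 x -> vge (r%:Z + 1) (sg x - x).
Proof.
move=> vx; rewrite [in sg x](mcoordE X x) [X in _ - X](mcoordE X x) rmorph_sum -sumrB.
apply: (vge_sum X) => ij _; have [l kl lx] := vx ij.
have monE : monom ij = laurent_monom ij.1%:Z ij.2 by [].
rewrite /= linearZ /= -scalerBr monE -[sg _]/(iter 1 sg _) iter_sg_laurent_monom.
have [j0 | j_gt0] := posnP ij.2.
  by rewrite j0 /laurent_monom subrr scaler0; apply: vge0 X _.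
apply: vge_le (vgeZ kl (vge_translate 1 _ _)) _.
have wt1 : 1 <= mval r l ij.
  rewrite -[1]add0r lezD1 lt_neqAle lx andbT; apply/eqP => wt0.
  have : (p %| r * ij.2)%N.
    have : (p%:Z %| (r * ij.2)%N%:Z)%Z.
      have -> : (r * ij.2)%N%:Z = p%:Z * (m%:Z * l + ij.1%:Z).
        apply/esym/eqP; rewrite -subr_eq0; apply/eqP.
        by rewrite [RHS]wt0 /mval !PoszM; ring.
      exact: dvdz_mulr.
    by rewrite dvdzE !absz_nat.
  rewrite Euclid_dvdM // (negPf p'r) => /(dvdn_leq j_gt0).
  by rewrite leqNgt ltn_ord.
have -> : (m * p)%:Z * l + (p%:Z * ij.1%:Z - r%:Z * ij.2%:Z + r%:Z) = mval r l ij + r%:Z.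
  by rewrite /mval !PoszM; ring.
by rewrite addrC lerD2r.
Qed.

Lemma exists_uniformizer : exists U (V : 'I_p), (0 < V)%N /\
  p%:Z * U - r%:Z * (V : nat)%:Z = 1.
Proof.
have [U [V UV]] := exists_laurent_monom X 1; exists U, V; split=> //.
rewrite lt0n; apply/eqP => V0; move: UV p_gt1; rewrite V0 mulr0 subr0; clear.
by case: (lerP U 0); nia.
Qed.

Lemma iter_tu_base c n x :
  tu x = base_emb L c * x -> iter n tu x = base_emb L (c ^+ n) * x.
Proof.
move=> tux; elim: n => [|n IHn]; first by rewrite rmorph1 mul1r.
by rewrite iterS IHn rmorphM /= tu_base tux exprSr [in RHS]rmorphM mulrA.
Qed.

Lemma iter_sg_base c n x : iter n sg (base_emb L c * x) = base_emb L c * iter n sg x.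
Proof. by elim: n => // n IHn; rewrite !iterS IHn rmorphM /= sg_base. Qed.

(** [iter j tu] scales the uniformizer pi by psi^j, psi being a primitive m-th root
    of unity (psi^p = xi), and [iter n sg pi - pi] has leading term
    [n V alpha^U beta^(V-1)], of valuation r + 1. *)
Lemma wild_uniformizer_fixed U (V : 'I_p) n j : (0 < V)%N ->
    p%:Z * U - r%:Z * (V : nat)%:Z = 1 ->
    vge (r%:Z + 2) (iter n sg (iter j tu (laurent_monom U V)) - laurent_monom U V) ->
  (p %| n)%N && (m %| j)%N.
Proof.
move=> V_gt0 UV; set pi := laurent_monom U V; pose psi := xi ^ U * (xi ^- r) ^+ V.
have xi0 := prim_root_neq0 xi_prim.
(* [as_xi_r] removes the [p]-th power from [xi^r], leaving the exponent [p U - r V = 1]. *)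
have psi_p : psi ^+ p = xi.
  rewrite exprMn [(_ ^+ V) ^+ p]exprAC exprVn (as_xi_r X).
  have -> : (xi ^ U) ^+ p = xi ^ (p%:Z * U) by rewrite exprnP exprz_exp mulrC.
  have -> : (xi ^+ r)^-1 ^+ V = xi ^ (- (r%:Z * (V : nat)%:Z)).
    by rewrite -PoszM -exprnN exprM exprVn.
  by rewrite -expfzDr // UV expr1z.
rewrite (iter_tu_base _ (tu_laurent_monom U V)) -/psi -/pi iter_sg_base iter_sg_laurent_monom.
set y := alpha ^ U * _.
have vy : vge (1 + r%:Z) (y - pi) by rewrite -UV; apply: vge_translate.
(* If [psi^j] is not 1, the difference still has value 1, that of the uniformizer. *)
have [psi_j | psi_j] := eqVneq (psi ^+ j) 1; last first.
  move=> v; have := vex_laurent_monom X U V (_ : psi ^+ j - 1 != 0).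
  rewrite subr_eq0 UV => /(_ psi_j) [_ []].
  have -> : base_emb L (psi ^+ j - 1) * laurent_monom U V
      = (base_emb L (psi ^+ j) * y - pi) - base_emb L (psi ^+ j) * (y - pi).
    by rewrite -/pi rmorphB rmorph1; ring.
  apply: vgeB; first by apply: vge_le v _; move: r_gt0; clear; lia.
  by apply: vge_base; apply: vge_le vy _; move: r_gt0; clear; lia.
have mj : (m %| j)%N.
  by rewrite (prim_order_dvd xi_prim) -psi_p -exprM mulnC exprM psi_j expr1n.
rewrite psi_j rmorph1 mul1r mj andbT => v.
rewrite (dvdn_pcharf char_k); apply/negPn/negP => n0.
have V0 : V%:R != 0 :> k.
  by rewrite -(dvdn_pcharf char_k) gtnNdvd.
have := vex_laurent_monom X U V.-1 (_ : n%:R * V%:R != 0).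
rewrite mulf_neq0 // => /(_ isT) [_ []].
have -> : base_emb L (n%:R * V%:R) * laurent_monom U V.-1 = (y - pi)
    - \sum_(j < V.-1) (n ^ (V - j) * 'C(V, j))%:R * laurent_monom U j.
  have -> : y - pi = \sum_(j < V) (n ^ (V - j) * 'C(V, j))%:R * laurent_monom U j.
    by rewrite /y translate_laurent_monom [LHS]addrAC subrr add0r.
  move: V_gt0; case: (nat_of_ord V) => // V' _ /=.
  rewrite big_ord_recr /= [RHS]addrAC subrr add0r subSnn expn1 binSn.
  by rewrite -natrM rmorph_nat.
have VE : V.-1%:Z = V%:Z - 1 by move: V_gt0; clear; lia.
have -> : p%:Z * U - r%:Z * V.-1%:Z + 1 = r%:Z + 2 by rewrite VE; move: UV; clear; lia.
apply: vgeB => //; apply: (vge_sum X) => i _; apply: vge_natr.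
apply: vge_le (vge_laurent_monom X U i) _.
have := ltn_ord i; move: UV r_gt0; clear; nia.
Qed.

(** * Iterates of [sigma - 1] and the coordinates they constrain *)

Let D x := sg x - x.

Lemma iter_subD n x y : iter n D (x + y) = iter n D x + iter n D y.
Proof. by elim: n => // n IHn; rewrite !iterS IHn /D rmorphD /= opprD addrACA. Qed.

Lemma iter_sub0 n : iter n D 0 = 0.
Proof. by elim: n => // n IHn; rewrite iterS IHn /D rmorph0 subrr. Qed.

Lemma iter_subZ n (c : K) x : iter n D (c *: x) = c *: iter n D x.
Proof. by elim: n => // n IHn; rewrite !iterS IHn /D linearZ /= scalerBr. Qed.

Lemma iter_sub_sum n (I : finType) (F : I -> L) :
  iter n D (\sum_i F i) = \sum_i iter n D (F i).
Proof. by apply: (big_morph (iter n D) (iter_subD n) (iter_sub0 n)). Qed.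

Lemma D_laurent_monom I J :
  D (laurent_monom I J) = \sum_(j < J) 'C(J, j)%:R * laurent_monom I j.
Proof.
rewrite /D -[sg _]/(iter 1 sg _) iter_sg_laurent_monom translate_laurent_monom addrAC subrr add0r.
by apply: eq_bigr => j _; rewrite exp1n mul1n.
Qed.

Lemma iter_sub_natr n (c : nat) x : iter n D (c%:R * x) = c%:R * iter n D x.
Proof.
by rewrite -!(rmorph_nat (base_emb L)) !base_embE iter_subZ.
Qed.

Lemma iter_sub_laurent_monom_gt n I J : (J < n)%N -> iter n D (laurent_monom I J) = 0.
Proof.
elim: n J => // n IHn J lt_Jn; rewrite iterSr D_laurent_monom iter_sub_sum big1 // => j _.
by rewrite iter_sub_natr IHn ?mulr0 // (leq_trans (ltn_ord j)).
Qed.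

Lemma iter_sub_laurent_monom_eq I J : iter J D (laurent_monom I J) = J`!%:R * alpha ^ I.
Proof.
elim: J => [|J IHJ]; first by rewrite mul1r /laurent_monom mulr1.
rewrite iterSr D_laurent_monom iter_sub_sum big_ord_recr /= big1 ?add0r => [|j _].
  by rewrite iter_sub_natr IHJ binSn factS natrM mulrA.
by rewrite iter_sub_natr iter_sub_laurent_monom_gt ?mulr0.
Qed.

Lemma fact_neq0 (J : 'I_p) : J`!%:R != 0 :> k.
Proof.
rewrite -(dvdn_pcharf char_k); have := ltn_ord J; elim: (nat_of_ord J) => [|j IHj] lt_jp.
  by rewrite dvdn1 gtn_eqF.
by rewrite factS Euclid_dvdM // negb_or IHj ?(ltnW lt_jp) // gtnNdvd.
Qed.

(** Descending induction on [j >= d]: [D^j] kills the terms of lower index, those of higher index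
    are already zero, and what remains is [j!] times the part of index [j], with [j!] invertible
    because [j < p]. *)
Lemma mcoord_nilpotent d x ij : iter d D x = 0 -> mcoord ij x != 0 -> (ij.2 < d)%N.
Proof.
move=> Dx; rewrite ltnNge; apply: contraNN => le_dj; have : (ij.2 <= p)%N := ltnW (ltn_ord _).
move: ij le_dj.
suff main n : forall ij : 'I_m * 'I_p, (d <= ij.2)%N -> (p - ij.2 <= n)%N -> mcoord ij x == 0.
  by move=> ij le_dj _; apply: (main _ ij le_dj (leqnn _)).
elim: n => [|n IHn] ij le_dj le_n; first by move: (ltn_ord ij.2) le_n; lia.
have monE (i : 'I_m) (j : 'I_p) : monom (i, j) = laurent_monom i%:Z j by [].
have Dx0 : \sum_(i < m) (ij.2`!%:R * mcoord (i, ij.2) x) *: monom (i, Ordinal p_gt0) = 0.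
  have Dj : iter ij.2 D x = 0 by rewrite -(subnK le_dj) iterD Dx iter_sub0.
  rewrite -[RHS]Dj.
  rewrite [in RHS](mcoordE X x) iter_sub_sum.
  rewrite [RHS]sum_pair; apply: eq_bigr => i _; rewrite (bigD1 ij.2) //= big1 ?addr0 => [|j neq_j].
    rewrite iter_subZ [monom (i, ij.2)]monE iter_sub_laurent_monom_eq /monom /= mulr1.
    rewrite [_ * mcoord _ _]mulrC -scalerA.
    by congr (_ *: _); rewrite scaler_nat mulr_natl.
  rewrite iter_subZ; have [lt_j | le_j] := ltnP j ij.2.
    by rewrite monE iter_sub_laurent_monom_gt // scaler0.
  have /eqP -> : mcoord (i, j) x == 0; last by rewrite scale0r.
  have lt_j : (ij.2 < j)%N by rewrite ltn_neqAle le_j andbT eq_sym.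
  apply: IHn => /=; first exact: leq_trans le_dj le_j.
  by move: lt_j le_n (ltn_ord j); clear; lia.
have := @monom_independent _ _ _ _ _ _ _ _ _ _ _ X
  (fun ij' => if ij'.2 == Ordinal p_gt0 then ij.2`!%:R * mcoord (ij'.1, ij.2) x else 0).
rewrite sum_pair /= (eq_bigr (fun i =>
  (ij.2`!%:R * mcoord (i, ij.2) x) *: monom (i, Ordinal p_gt0))).
  move=> /(_ Dx0 (ij.1, Ordinal p_gt0)); rewrite /= -surjective_pairing => /eqP.
  rewrite mulf_eq0 -(rmorph_nat (@tofrac (fps k))) -(rmorph_nat (@fps_const k)).
  by rewrite tofrac_eq0 fmorph_eq0 (negPf (fact_neq0 _)).
move=> i _; rewrite (bigD1 (Ordinal p_gt0)) //= big1 ?addr0 // => j /negPf ->.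
by rewrite scale0r.
Qed.

(** The monomials are eigenvectors of [tau], so coordinates compare one by one. *)
Lemma mcoord_eigenvector (z : k) x ij : tu x = base_emb L z * x -> mcoord ij x != 0 ->
  z = xi ^+ ij.1 * (xi ^- r) ^+ ij.2.
Proof.
move=> tux mcoord0; pose e (ij : 'I_m * 'I_p) : k := xi ^+ ij.1 * (xi ^- r) ^+ ij.2.
have : mcoord ij (tu x) = tofrac (fps_const (e ij)) * mcoord ij x.
  rewrite {1}(mcoordE X x) rmorph_sum.
  have -> : \sum_ij tu (mcoord ij x *: monom ij)
      = \sum_ij (tofrac (fps_const (e ij)) * mcoord ij x) *: monom ij.
    apply: eq_bigr => ij' _; rewrite linearZ /= -[monom _]/(laurent_monom ij'.1%:Z ij'.2).
    by rewrite tu_laurent_monom base_embE scalerA mulrC.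
  by rewrite (mcoord_sum X).
rewrite tux base_embE mcoordZ => /(mulIf mcoord0) /eqP; rewrite tofrac_eq => /eqP.
exact: fmorph_inj.
Qed.

End Ramification.

(** * Ramification of Galois extensions *)

Section GaloisAction.
Variables (k : fieldType) (gT : finGroupType) (E : Gextension k gT).

Definition gext_act (g : gT) : {lrmorphism E -> E} := Gext_gal E g.

Lemma gext_actM g h x : gext_act (g * h)%g x = gext_act g (gext_act h x).
Proof. exact: Gext_M. Qed.

Lemma gext_act1 x : gext_act 1%g x = x.
Proof. exact: Gext_1. Qed.

Lemma iter_gext_act n g x : iter n (gext_act g) x = gext_act (g ^+ n)%g x.
Proof.
elim: n => [|n IHn]; first by rewrite expg0 gext_act1.
by rewrite iterS IHn expgS gext_actM.
Qed.

Lemma gext_act_inj g h : (forall x, gext_act g x = gext_act h x) -> g = h.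
Proof.
by move=> gh; apply: (@Gext_inj _ _ E); apply/eqP/gal_eqP => x _; apply: gh.
Qed.

Lemma gext_fixed x : (forall g, gext_act g x = x) -> exists c : laurent k, x = c%:A.
Proof.
move=> fix_x; apply/vlineP.
have /galois_fixedField <- := Gext_galois E; apply/fixedFieldP; first exact: memvf.
by move=> y; rewrite -(Gext_im E) => /imsetP[g _ ->]; apply: fix_x.
Qed.

Lemma gext_dim : \dim {:E} = #|gT|.
Proof.
have := galois_dim (Gext_galois E); rewrite dimv1 divn1 => ->.
by rewrite -(Gext_im E) card_imset ?cardsT //; apply: Gext_inj.
Qed.

End GaloisAction.

Section ExtensionData.
Variables (p m : nat) (k : closedFieldType) (z : k).
Variables (gT : finGroupType) (sigma tau : gT) (a : nat) (gamma : int).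
Hypotheses (p_prime : prime p) (p'm : ~~ (p %| m)%N) (char_k : p \in [pchar k])
  (z_prim : m.-primitive_root z)
  (G_sdprod : (<[sigma]> ><| <[tau]> = [set: gT])%g)
  (order_sigma : #[sigma]%g = p) (order_tau : #[tau]%g = m)
  (G_rel : (tau * sigma * tau^-1 = sigma ^+ a)%g)
  (gamma_unit : coprimez gamma m%:Z).
Variable E : Gextension k gT.
Hypothesis E_gamma : has_gamma sigma tau m z gamma E.

Lemma sdprod_elements (g : gT) : exists i j, g = (sigma ^+ i * tau ^+ j)%g.
Proof.
have [_ defG _ _] := sdprodP G_sdprod.
have : g \in (<[sigma]> * <[tau]>)%g by rewrite defG inE.
by case/mulsgP=> _ _ /cycleP[i ->] /cycleP[j ->] ->; exists i, j.
Qed.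

Lemma card_sdprod_cycles : #|gT| = (m * p)%N.
Proof.
rewrite -cardsT -(sdprod_card G_sdprod) -/(#[sigma]%g) -/(#[tau]%g).
by rewrite order_sigma order_tau mulnC.
Qed.

Lemma prim_root_coprimez : m.-primitive_root (z ^ gamma).
Proof.
have m_neq0 : m%:Z != 0 by rewrite eqz_nat -lt0n (prim_order_gt0 z_prim).
rewrite (prim_root_exprz_mod _ z_prim).
rewrite prim_root_exp_coprime // -[coprime _ _]/(coprimez `|(gamma %% m)%Z|%N m).
by rewrite gez0_abs ?modz_ge0 // /coprimez gcdz_modl.
Qed.

Lemma exists_artin_schreier_data : exists r alpha beta u,
  artin_schreier_data p m r (z ^ gamma) (gext_act E sigma) (gext_act E tau) alpha beta u.
Proof.
have [alpha [alphaE alpha_m tu_alpha]] := E_gamma.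
have sg_alpha : gext_act E sigma alpha = alpha.
  have : alpha \in fixedField [set Gext_gal E sigma]%SET by rewrite -alphaE memv_adjoin.
  by case/mem_fixedFieldP => _; apply; rewrite inE.
have [_ _ tau_norm _] := sdprodP G_sdprod.
(* [tau] normalises [<[sigma]>]; averaging over [tau] uses the commutation rule in both
   directions. *)
have [b sigma_tau] : exists b, (sigma ^ tau = sigma ^+ b)%g.
  by apply/cycleP; rewrite memJ_norm ?cycle_id // (fintype.subsetP tau_norm) ?cycle_id.
have [|||||||||r [u [beta [[r_gt0 p'r] u_unit xi_r beta_p [sg_beta tu_beta]]]]] :=
  @artin_schreier_generator p m a b k (z ^ gamma) E (gext_act E sigma) (gext_act E tau) alpha
    char_k p'm prim_root_coprimez.
- by move=> x; rewrite iter_gext_act -order_sigma expg_order gext_act1.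
- by move=> x; rewrite iter_gext_act -order_tau expg_order gext_act1.
- apply: contrapT => /forallNP fix_all; have : sigma = 1%g.
    apply: (@gext_act_inj _ _ E) => x; rewrite gext_act1.
    by apply/eqP/negPn/negP/fix_all.
  by move=> s1; move: p_prime; rewrite -order_sigma s1 order1.
- by move=> x; rewrite iter_gext_act -!gext_actM -G_rel mulgKV.
- by move=> x; rewrite iter_gext_act -!gext_actM -sigma_tau conjgE mulKVg.
- move=> x sx tx; apply: gext_fixed => g; have [i [j ->]] := sdprod_elements g.
  rewrite gext_actM -!iter_gext_act.
  by rewrite (_ : iter j _ x = x) ?(iter_fix i) // iter_fix.
- exact: sg_alpha.
- exact: alpha_m.
- exact: tu_alpha.
exists r, alpha, beta, u; split=> //; first exact: prim_root_coprimez.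
by rewrite gext_dim card_sdprod_cycles.
Qed.

Section LastJump.
Variables (r : nat) (alpha beta : E) (u : fps k).
Hypothesis X : artin_schreier_data p m r (z ^ gamma) (gext_act E sigma) (gext_act E tau)
  alpha beta u.
Local Notation vge := (vge p m r alpha beta).
Local Notation vex := (vex p m r alpha beta).

Lemma vexX N x n : vex N x -> vex (N * n%:Z) (x ^+ n).
Proof.
move=> vx; elim: n => [|n IHn]; first by rewrite mulr0; apply: vex1 X.
by rewrite exprS -addn1 PoszD mulrDr mulr1 addrC; apply: vexM X _ _ _ _ vx IHn.
Qed.

Lemma max_idealE x : @max_ideal k gT E x <-> vge 1 x.
Proof.
have [-> | x0] := eqVneq x 0.
  by split=> _; [apply: vge0 X _ | split; [apply: integral0 | left]].
have [N vx] := exists_vex X x0.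
have vx' := vexV X vx.
rewrite /max_ideal /= !(int_closureE X) (vexP vx) (vexP vx') (vexP vx) oppr_ge0.
split=> [[N_ge0 [/eqP|/negP]]|]; first by rewrite (negPf x0).
  by rewrite -ltNge => N_gt0; rewrite -[1]add0r lezD1.
by rewrite -[1]add0r lezD1 => N_gt0; split; [apply: ltW | right; apply/negP; rewrite -ltNge].
Qed.

Lemma uniformizerE pi : uniformizer pi <-> vex 1 pi.
Proof.
have ideal_vge : @max_ideal k gT E = [set x | vge 1 x]%classic.
  by apply/seteqP; split=> x /max_idealE.
(* A known element of value 1, which no generator of larger value could divide. *)
have [U [V [_ UV]]] := exists_uniformizer X.
have := vex_laurent_monom X U V (oner_neq0 k); rewrite UV; set pi0 := _ * _ => vpi0.
rewrite /uniformizer ideal_vge; split=> [[pi_neq0 pi_gen] | vpi].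
  have [N vpi] := exists_vex X pi_neq0.
  have le_N : 1 <= N.
    apply/(vexP vpi); have : [set pi * y | y in int_closure E]%classic pi.
      by exists 1; [apply: integral1 | rewrite mulr1].
    by rewrite -pi_gen.
  have : [set pi * y | y in int_closure E]%classic pi0 by rewrite -pi_gen; apply: vpi0.1.
  case=> y /(int_closureE X) vy pi0E.
  have := vgeM X vpi.1 vy; rewrite pi0E addr0 => /(vexP vpi0) N_le.
  by have -> : 1 = N by apply: le_anti; rewrite le_N.
split; first exact: vex_neq0 X _ _ vpi.
apply/seteqP; split=> [x vx | _ [y /(int_closureE X) vy <-]].
  exists (pi^-1 * x); last by rewrite mulVKf ?(vex_neq0 X vpi).
  by apply/(int_closureE X); apply: vge_le (vgeM X (vexV X vpi).1 vx) _.
by apply: vge_le (vgeM X vpi.1 vy) _.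
Qed.

Lemma val_geE n x : val_ge n x <-> vge n%:Z x.
Proof.
have vn pi : vex 1 pi -> vex n%:Z (pi ^+ n) by move/(vexX n); rewrite mul1r.
split=> [[pi [/uniformizerE /vn vpi /(int_closureE X) vx]] | vx].
  rewrite -(divfK (vex_neq0 X vpi) x); apply: vge_le (vgeM X vx vpi.1) _.
  by rewrite add0r.
have [U [V [_ UV]]] := exists_uniformizer X.
have := vex_laurent_monom X U V (oner_neq0 k); rewrite UV; set pi := _ * _ => vpi.
exists pi; split; first exact/uniformizerE.
apply/(int_closureE X); apply: vge_le (vgeM X vx (vexV X (vn _ vpi)).1) _.
by rewrite subrr.
Qed.

Lemma ram_groupE i g : ram_group E i g <->
  forall x, vge 0 x -> vge i.+1%:Z (gext_act E g x - x).
Proof.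
split=> H x; first by move=> /(int_closureE X) /H /val_geE.
by move=> /(int_closureE X) /H vx; apply/val_geE.
Qed.

Lemma ram_group_anti i j : (i <= j)%N -> (ram_group E j `<=` ram_group E i)%classic.
Proof.
move=> le_ij g /ram_groupE gj; apply/ram_groupE => x /gj vx.
by apply: vge_le vx _; rewrite lez_nat ltnS.
Qed.

Lemma ram_group1 i : ram_group E i 1%g.
Proof. by apply/ram_groupE => x _; rewrite gext_act1 subrr; apply: vge0 X _. Qed.

Lemma ram_group_r_neq1 : ram_group E r <> [set 1%g]%classic.
Proof.
have : ram_group E r sigma.
  by apply/ram_groupE => x vx; rewrite -addn1 PoszD; apply: vge_sg_sub1 X _ vx.
by move=> /[swap] -> /= s1; move: p_prime; rewrite -order_sigma s1 order1.
Qed.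

(** The effect of [g] on the single uniformizer [alpha^U beta^V] already forces [g = 1]. *)
Lemma ram_group_rS : ram_group E r.+1 = [set 1%g]%classic.
Proof.
apply/seteqP; split=> [g /ram_groupE gr | _ -> ]; last exact: ram_group1.
have [U [V [V_gt0 UV]]] := exists_uniformizer X.
have [i [j gE]] := sdprod_elements g; rewrite gE /=.
have /andP[pi mj] : (p %| i)%N && (m %| j)%N.
  apply: (wild_uniformizer_fixed X V_gt0 UV).
  rewrite !iter_gext_act -gext_actM -gE.
  have -> : r%:Z + 2 = r.+2%:Z by lia.
  by apply: gr; apply: vge_le (vge_laurent_monom X U V) _; rewrite UV.
move: pi mj; rewrite -order_sigma -order_tau !order_dvdn => /eqP -> /eqP ->.
by rewrite mulg1.
Qed.

(** [last_jump] is chosen among all solutions of [is_last_jump]; since the ramification groups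
    decrease, there is only one. *)
Lemma last_jumpE : last_jump E = r.
Proof.
have r_jump : is_last_jump E r by split; [apply: ram_group_r_neq1 | apply: ram_group_rS].
have [neq1 eq1] := xgetPex 0%N (ex_intro (fun r => is_last_jump E r) r r_jump).
rewrite /last_jump; set r' := xget _ _ in neq1 eq1 *.
case: (ltngtP r' r) => // lt_r; exfalso.
  apply: ram_group_r_neq1; apply/seteqP; split=> [g | _ ->]; last exact: ram_group1.
  by rewrite -eq1; apply: ram_group_anti.
apply: neq1; apply/seteqP; split=> [g | _ ->]; last exact: ram_group1.
by rewrite -ram_group_rS; apply: ram_group_anti.
Qed.

End LastJump.

End ExtensionData.

(** * Tuning modules *)

Section JordanTuples.
Variables (p m r : nat) (k : closedFieldType) (xi : k).
Variables (L : fieldExtType (laurent k)) (sg tu : {lrmorphism L -> L}).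
Variables (alpha beta : L) (u : fps k).
Hypothesis X : artin_schreier_data p m r xi sg tu alpha beta u.
Variables (d : nat) (le_dp : (d <= p)%N) (d_gt0 : (0 < d)%N) (zs : k).
Variables (ii : 'I_d -> 'I_m) (nn : 'I_d -> int).
Local Notation t := (laurent_t k).
Local Notation vge := (vge p m r alpha beta).
Local Notation vex := (vex p m r alpha beta).
Local Notation laurent_monom := (laurent_monom alpha beta).
Local Notation monom := (@monom p m k L alpha beta).
Local Notation mcoord := (@mcoord p m k L alpha beta).
Local Notation widen := (widen_ord le_dp).
Hypothesis ii_eigen : forall (i : 'I_m) (j : 'I_d),
  zs = xi ^+ i * (xi ^- r) ^+ j <-> i = ii j.
Hypothesis nn_min : forall j l, 0 <= mval r l (ii j, widen j) <-> nn j <= l.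

Let D x := sg x - x.

(** The tuning module of V_(d,s) in coordinates in which sigma is a Jordan block *)
Definition jordan_tuple (c : 'cV[L]_d) : Prop :=
  [/\ int_columns c, forall i j : 'I_d, j = i.+1 :> nat -> c j 0 = D (c i 0),
      forall i : 'I_d, i.+1 = d -> D (c i 0) = 0
    & forall i : 'I_d, i = 0%N :> nat -> tu (c i 0) = base_emb L zs * c i 0].

Definition tuning_generator (j : 'I_d) : L := t ^ nn j *: monom (ii j, widen j).

Definition tuning_column (j : 'I_d) : 'cV[L]_d :=
  \col_l iter l D (tuning_generator j).

Lemma int_closure_sub1 x : int_closure L x -> int_closure L (D x).
Proof.
move=> /(int_closureE X) vx; apply/(int_closureE X); apply: vge_le (vge_sg_sub1 X vx) _.
by clear; lia.
Qed.

Lemma vge_generator j : vge 0 (tuning_generator j).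
Proof. by apply: vge_le (vge_monom X _ (kge_t k _)) _; apply/nn_min. Qed.

Lemma generatorE j : tuning_generator j = t ^ nn j *: laurent_monom (ii j)%:Z j.
Proof. by []. Qed.

Lemma iter_sub_generator_gt n (j : 'I_d) : (j < n)%N -> iter n D (tuning_generator j) = 0.
Proof.
by move=> lt_jn; rewrite generatorE (iter_subZ sg) (iter_sub_laurent_monom_gt X) ?scaler0.
Qed.

Lemma jordan_tuple_column j : jordan_tuple (tuning_column j).
Proof.
split=> [i|i i' e|i e|i e]; rewrite !mxE.
- elim: (nat_of_ord i) => [|n IHn]; first exact/(int_closureE X)/vge_generator.
  exact: int_closure_sub1.
- by rewrite e.
- by rewrite -[D _]/(iter i.+1 D _) e iter_sub_generator_gt.
- rewrite e /= generatorE linearZ /= (tu_laurent_monom X) -[RHS]scalerAr; congr (_ *: _).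
  by congr (base_emb L _ * _); apply/esym/ii_eigen.
Qed.

Lemma jordan_tuple_iter c : jordan_tuple c -> forall i : 'I_d,
  c i 0 = iter i D (c (Ordinal d_gt0) 0).
Proof.
move=> [_ cS _ _] i.
suff main n (lt_nd : (n < d)%N) : c (Ordinal lt_nd) 0 = iter n D (c (Ordinal d_gt0) 0).
  by rewrite -main; congr (c _ 0); apply: val_inj.
elim: n lt_nd => [|n IHn] lt_nd; first by congr (c _ 0); apply: val_inj.
by rewrite (cS (Ordinal (ltnW lt_nd))) // IHn.
Qed.

(** The first entry [x] determines the tuple. [D^d x = 0] leaves the exponents [j < d], the
    eigenvalue leaves [i = ii j], and integrality makes each coordinate divisible by [t^(nn j)]. *)
Lemma jordan_tuple_span c : jordan_tuple c ->
  exists f : 'I_d -> fps k, c = \sum_j ring_emb L (f j) *: tuning_column j.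
Proof.
move=> c_jordan; have cE := jordan_tuple_iter c_jordan.
case: (c_jordan) => c_int _ c_last c_first; set x := c _ 0 in cE.
have Dx : iter d D x = 0.
  have lt_d : (d.-1 < d)%N by rewrite prednK.
  by rewrite -(prednK d_gt0) iterS -(cE (Ordinal lt_d)) c_last //= prednK.
have tux : tu x = base_emb L zs * x by apply: c_first.
have vx : vge 0 x by apply/(int_closureE X)/c_int.
have f_ex j : exists f, mcoord (ii j, widen j) x = t ^ nn j * tofrac f.
  by have [l kl /nn_min lx] := vx (ii j, widen j); apply: kge_le kl.
pose f j := projT1 (cid (f_ex j)).
have fE j : mcoord (ii j, widen j) x = t ^ nn j * tofrac (f j) by apply: projT2 (cid (f_ex j)).
have xE : x = \sum_j ring_emb L (f j) * tuning_generator j.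
  rewrite [LHS](mcoordE X x) (bigID (fun ij : 'I_m * 'I_p => (ij.2 < d)%N)) /= addrC big1 ?add0r.
    rewrite big_mkcond sum_pair exchange_big /=.
    rewrite (eq_bigr (fun j : 'I_p => if (j < d)%N then
      \sum_i mcoord (i, j) x *: monom (i, j) else 0)) => [|j _]; last first.
      by case: ifP => // _; rewrite big1.
    rewrite -big_mkcond (big_ord_narrow le_dp).
    apply: eq_bigr => j _; rewrite (bigD1 (ii j)) //= big1 ?addr0 => [|i neq_i].
      rewrite fE mulrC -scalerA -mulr_algl; congr (_ * _).
    have [-> | /(mcoord_eigenvector X tux) /= e] := eqVneq (mcoord (i, widen j) x) 0.
      by rewrite scale0r.
    by move/eqP: neq_i; case; apply/ii_eigen.
  move=> ij; have [-> | /(mcoord_nilpotent X Dx) -> //] := eqVneq (mcoord ij x) 0.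
  by rewrite scale0r.
exists f; apply/colP => i; rewrite cE xE summxE (iter_sub_sum sg).
by apply: eq_bigr => j _; rewrite !mxE /ring_emb !mulr_algl (iter_subZ sg).
Qed.

(** The value of the [j]-th diagonal entry: [D^j] has turned [beta^j] into a constant, so the
    summand [- r j] is gone. The absolute value changes nothing once [nn j] is nonnegative. *)
Definition pivot_weight (j : 'I_d) : nat := `|((m * p)%:Z * nn j + (p * ii j)%:Z)%R|%N.

Hypothesis nn_ge0 : forall j, 0 <= nn j.

Definition tuning_column_span : set 'cV[L]_d :=
  [set c | exists2 a : 'I_d -> L, forall j, int_closure L (a j)
     & c = \sum_j a j *: tuning_column j]%classic.

Let pivot j := tuning_column j j 0.

Lemma vex_pivot j : vex (pivot_weight j)%:Z (pivot j).
Proof.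
rewrite /pivot mxE generatorE (iter_subZ sg) (iter_sub_laurent_monom_eq X).
have -> : t ^ nn j *: (j`!%:R * alpha ^ (ii j)%:Z)
    = base_emb L j`!%:R * laurent_monom (m%:Z * nn j + (ii j)%:Z) 0.
  rewrite /laurent_monom expr0 mulr1 rmorph_nat scalerAr; congr (_ * _).
  rewrite expfzDr ?(alpha_neq0 (as_xi X) (as_alpha_m X)) // -exprz_exp.
  rewrite -[alpha ^ m%:Z]/(alpha ^+ m) (as_alpha_m X) -[_%:A]/(in_alg L _) -fmorphXz.
  by rewrite -mulr_algl.
have -> : (pivot_weight j)%:Z = p%:Z * (m%:Z * nn j + (ii j)%:Z) - r%:Z * 0%N%:Z.
  rewrite /pivot_weight gez0_abs ?addr_ge0 ?mulr_ge0 ?nn_ge0 //.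
  by rewrite !PoszM; ring.
by apply: (vex_laurent_monom X); apply: (fact_neq0 X (widen j)).
Qed.

Lemma tuning_column_gt (j l : 'I_d) : (j < l)%N -> tuning_column j l 0 = 0.
Proof. by move=> lt_jl; rewrite mxE iter_sub_generator_gt. Qed.

Lemma jordan_length : has_length tuning_column_span (@int_columns _ L d) (\sum_j pivot_weight j).
Proof.
have pivot_neq0 j : pivot j != 0 := vex_neq0 X (vex_pivot j).
apply: (@triangular_length _ L d (fun n => vge n%:Z)).
- by apply/seteqP; split=> x /(int_closureE X).
- by move=> n x y; apply: vgeB.
- by move=> n f x; apply: vgeZ_fps.
- by move=> n n' x le_n vx; apply: vge_le vx _; rewrite lez_nat.
- by move=> n; have [x vx nvx] := vge_strict X n%:Z; exists x => //; rewrite -addn1 PoszD.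
- move=> n x y vx vy; rewrite -addn1 PoszD => nvy.
  by have [c vc] := vge_residue X vx vy nvy; exists (fps_const c).
- split.
  + exists (fun=> 0) => [j|]; first exact: integral0.
    by rewrite big1 // => j _; rewrite scale0r.
  + move=> x y [a a_int ->] [b b_int ->]; exists (fun j => a j + b j).
      by move=> j; apply: integral_add; [apply: a_int | apply: b_int].
    by rewrite -big_split; apply: eq_bigr => j _; rewrite scalerDl.
  + move=> f x [a a_int ->]; exists (fun j => ring_emb L f * a j).
      by move=> j; apply: integral_mul; [apply: integral_id | apply: a_int].
    by rewrite scaler_sumr; apply: eq_bigr => j _; rewrite scalerA.
- move=> c [a a_int ->] i; rewrite summxE; apply: big_ind => [||j _].
  + exact: integral0.
  + exact: integral_add.
  + rewrite mxE; apply: integral_mul; first exact: a_int.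
    by have [col_int _ _ _] := jordan_tuple_column j; apply: col_int.
- move=> y [a a_int yE] j y0.
  have yj (l : 'I_d) : (forall i : 'I_d, (l < i)%N -> a i = 0) -> y l 0 = a l * pivot l.
    move=> a0; rewrite yE summxE (bigD1 l) //= big1 ?addr0; first by rewrite mxE.
    move=> i neq_il; rewrite mxE; have [lt_il | le_li] := ltnP i l.
      by rewrite tuning_column_gt ?mulr0.
    by rewrite a0 ?mul0r // ltn_neqAle le_li eq_sym neq_il.
  (* Back substitution from the last row: the entries of [y] beyond [j] vanish, hence so do the
     coefficients [a l], by downward induction on [l]. *)
  have a0 n : forall l : 'I_d, (d - n <= l)%N -> (j < l)%N -> a l = 0.
    elim: n => [|n IHn] l; first by rewrite subn0 leqNgt ltn_ord.
    move=> le_l lt_jl; have := yj l; rewrite y0 // => /(_ _)/esym/eqP.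
    rewrite mulf_eq0 (negPf (pivot_neq0 l)) orbF => a0; apply/eqP/a0 => i lt_li.
    by apply: IHn; [move: le_l lt_li; clear; lia | apply: ltn_trans lt_li].
  rewrite yj => [|l lt_jl]; last by apply: (a0 d); rewrite ?subnn.
  have /(int_closureE X) va := a_int j.
  by apply: vge_le (vgeM X va (vex_pivot j).1) _; rewrite add0r.
move=> j x vx; exists (x / pivot j *: tuning_column j); last first.
  split=> [|l lt_jl]; first by rewrite mxE divfK.
  by rewrite mxE tuning_column_gt ?mulr0.
exists (fun i => if i == j then x / pivot j else 0) => [i|]; last first.
  rewrite (bigD1 j) //= eqxx big1 ?addr0 // => i /negPf ->.
  by rewrite scale0r.
case: eqP => _; last exact: integral0.
apply/(int_closureE X); apply: vge_le (vgeM X vx (vexV X (vex_pivot j)).1) _.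
by rewrite subrr.
Qed.

End JordanTuples.

(** * The index set of the formula *)

Section IndexSet.
Variables (m d r : nat) (gamma s : int).
Hypothesis m_gt0 : (0 < m)%N.

Lemma index_of_subproof (j : nat) :
  (`|((s * inv_mod m gamma + r%:Z * j%:Z) %% m)%Z| < m)%N.
Proof. by rewrite -ltz_nat gez0_abs ?modz_ge0 ?ltz_pmod // eqz_nat -lt0n. Qed.

Definition index_of (j : 'I_d) : 'I_m := Ordinal (index_of_subproof j).

Lemma index_ofP (i : 'I_m) (j : 'I_d) :
  (i%:Z - r%:Z * j%:Z == s * inv_mod m gamma %[mod m%:Z])%Z = (i == index_of j).
Proof.
rewrite eqz_mod_dvd -addrA -opprD -eqz_mod_dvd [r%:Z * _ + _]addrC.
rewrite [(i%:Z %% m)%Z]modz_small ?ltz_nat ?ltn_ord //.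
apply/eqP/eqP => [iE | ->]; last by rewrite /= gez0_abs ?modz_ge0 // eqz_nat -lt0n.
by apply: val_inj; rewrite /= -iE absz_nat.
Qed.

(** The congruence determines [i] from [j], so the index set is a graph over [j]. *)
Lemma index_setE : index_set m d gamma r s = [set (index_of j, j) | j in 'I_d]%SET.
Proof.
apply/setP => -[i j]; rewrite inE index_ofP /=; apply/eqP/imsetP => [-> | [j' _ [-> ->]] //].
by exists j.
Qed.

Lemma card_index_set : #|index_set m d gamma r s| = d.
Proof. by rewrite index_setE card_imset ?card_ord // => j j' []. Qed.

Lemma sum_index_set (R : nmodType) (F : 'I_m * 'I_d -> R) :
  \sum_(ij in index_set m d gamma r s) F ij = \sum_j F (index_of j, j).
Proof. by rewrite index_setE big_imset // => j j' _ _ []. Qed.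

End IndexSet.

Lemma prim_root_exprz_eq (F : fieldType) m (z : F) (x y : int) :
  m.-primitive_root z -> (z ^ x == z ^ y) = (x == y %[mod m%:Z])%Z.
Proof.
move=> z_prim; have m_gt0 := prim_order_gt0 z_prim.
have m_neq0 : m%:Z != 0 by rewrite eqz_nat -lt0n.
rewrite !(prim_root_exprz_mod _ z_prim) (eq_prim_root_expr z_prim) !modn_small; last first.
- by rewrite -ltz_nat gez0_abs ?modz_ge0 // ltz_pmod.
- by rewrite -ltz_nat gez0_abs ?modz_ge0 // ltz_pmod.
by rewrite -eqz_nat !gez0_abs ?modz_ge0.
Qed.

(** * Linear changes of coordinates and equivariance *)

Section Coordinates.
Variables (k : fieldType) (gT : finGroupType) (A : Galgebra k gT) (d : nat).
Implicit Types (T : set 'cV[A]_d) (V W : mx_representation k [set: gT]%G d).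

Lemma form_mapE (c : 'cV[A]_d) u : form_map c u = (map_mx (base_emb A) u *m c) 0 0.
Proof. by rewrite mxE; apply: eq_bigr => i _; rewrite mxE. Qed.

Lemma form_mapD (c : 'cV[A]_d) u w : form_map c (u + w) = form_map c u + form_map c w.
Proof. by rewrite !form_mapE map_mxD mulmxDl mxE. Qed.

Lemma form_mapZ (c : 'cV[A]_d) a u : form_map c (a *: u) = base_emb A a * form_map c u.
Proof. by rewrite !form_mapE map_mxZ -scalemxAl mxE. Qed.

Definition coord_change (B : 'M[k]_d) (c : 'cV[A]_d) : 'cV[A]_d :=
  map_mx (base_emb A) B *m c.

Lemma form_map_coord (B : 'M[k]_d) c u :
  form_map (coord_change B c) u = form_map c (u *m B).
Proof. by rewrite !form_mapE map_mxM mulmxA. Qed.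

Lemma coord_changeE (B : 'M[k]_d) c i : coord_change B c i 0 = form_map c (row i B).
Proof. by rewrite form_mapE map_row -row_mul [RHS]mxE. Qed.

Lemma coord_changeK (B : 'M[k]_d) : B \in unitmx ->
  cancel (coord_change B) (coord_change (invmx B)).
Proof. by move=> uB c; rewrite /coord_change mulmxA -map_mxM mulVmx // map_mx1 mul1mx. Qed.

Lemma coord_changeVK (B : 'M[k]_d) : B \in unitmx ->
  cancel (coord_change (invmx B)) (coord_change B).
Proof. by move=> uB c; rewrite /coord_change mulmxA -map_mxM mulmxV // map_mx1 mul1mx. Qed.

Lemma int_coord_change B c : int_columns c -> int_columns (coord_change B c).
Proof.
move=> Ic i; rewrite mxE; apply: big_ind => [||j _].
- exact: integral0.
- exact: integral_add.
- by rewrite mxE; apply: integral_mul; [apply: integral_id | apply: Ic].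
Qed.

Definition int_span T : set 'cV[A]_d :=
  [set c | exists (n : nat) (a : 'I_n -> A) (xi : 'I_n -> 'cV[A]_d),
     [/\ forall i, int_closure A (a i), forall i, T (xi i) &
         c = \sum_(i < n) a i *: xi i]]%classic.

Lemma coord_change_lincomb B n (a : 'I_n -> A) (xi : 'I_n -> 'cV[A]_d) :
  coord_change B (\sum_i a i *: xi i) = \sum_i a i *: coord_change B (xi i).
Proof.
by rewrite /coord_change mulmx_sumr; apply: eq_bigr => i _; rewrite -scalemxAr.
Qed.

(** [B] and its inverse have entries in [k], so they preserve integral columns and respect
    combinations over the integral closure. *)
Lemma has_length_coord_change B T T' n : B \in unitmx ->
    (forall c, T c <-> T' (coord_change B c)) ->
  has_length (int_span T') (@int_columns _ A d) n -> has_length (int_span T) (@int_columns _ A d) n.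
Proof.
move=> uB TT' lenT'.
have -> : @int_columns _ A d = (coord_change B @^-1` @int_columns _ A d)%classic.
  apply/seteqP; split=> c; first exact: int_coord_change.
  by move/(int_coord_change (invmx B)); rewrite coord_changeK.
have -> : int_span T = (coord_change B @^-1` int_span T')%classic.
  apply/seteqP; split=> c [l [a [xi [a_int Txi cE]]]].
    exists l, a, (fun i => coord_change B (xi i)); split=> // [i|]; first exact/TT'.
    by rewrite cE coord_change_lincomb.
  exists l, a, (fun i => coord_change (invmx B) (xi i)); split=> // [i|].
    by apply/TT'; rewrite coord_changeVK.
  by rewrite -coord_change_lincomb -cE coord_changeK.
apply: has_length_preimage lenT' => [x y|a x|y].
- exact: mulmxDr.
- by rewrite /coord_change -scalemxAr.
- by exists (coord_change (invmx B) y); rewrite coord_changeVK.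
Qed.

Lemma form_actM V g h u : form_act V (g * h)%g u = form_act V g (form_act V h u).
Proof. by rewrite /form_act invMg repr_mxM ?inE // mulmxA. Qed.

Lemma form_act1 V u : form_act V 1%g u = u.
Proof. by rewrite /form_act invg1 repr_mx1 mulmx1. Qed.

Lemma form_actD V g u w : form_act V g (u + w) = form_act V g u + form_act V g w.
Proof. exact: mulmxDl. Qed.

Lemma form_actZ V g a u : form_act V g (a *: u) = a *: form_act V g u.
Proof. by rewrite /form_act scalemxAl. Qed.

Lemma GactD g (x y : A) : Gact g (x + y) = Gact g x + Gact g y.
Proof. by have := Gact_linear g 1 x y; rewrite !scale1r. Qed.

Lemma Gact0 g : Gact g (0 : A) = 0.
Proof. by apply: (addrI (Gact g 0)); rewrite -GactD !addr0. Qed.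

Lemma GactZ g (a : laurent k) (x : A) : Gact g (a *: x) = a *: Gact g x.
Proof. by have := Gact_linear g a x 0; rewrite Gact0 !addr0. Qed.

Lemma Gact_base g c (x : A) : Gact g (base_emb A c * x) = base_emb A c * Gact g x.
Proof. by rewrite /base_emb /ring_emb !mulr_algl GactZ. Qed.

Definition equivariant V (c : 'cV[A]_d) g :=
  forall u, form_map c (form_act V g u) = Gact g (form_map c u).

Lemma equivariantM V c g h : equivariant V c g -> equivariant V c h ->
  equivariant V c (g * h)%g.
Proof. by move=> eg eh u; rewrite form_actM eg eh GactM. Qed.

Lemma equivariantX V c g n : equivariant V c g -> equivariant V c (g ^+ n)%g.
Proof.
move=> eg; elim: n => [|n IHn]; first by move=> u; rewrite expg0 form_act1 Gact1.
by rewrite expgS; apply: equivariantM.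
Qed.

Lemma equivariant_basis V c g (B : 'M[k]_d) : B \in unitmx ->
  (forall i, form_map c (form_act V g (row i B)) = Gact g (form_map c (row i B))) ->
  equivariant V c g.
Proof.
move=> uB eB u; rewrite -[u](mulmxKV uB) mulmx_sum_row; move: (u *m _) => w.
apply: (big_ind (fun x => form_map c (form_act V g x) = Gact g (form_map c x))).
- have -> : form_map c 0 = 0 by rewrite form_mapE map_mx0 mul0mx mxE.
  by rewrite /form_act mul0mx Gact0 form_mapE map_mx0 mul0mx mxE.
- by move=> x y ex ey; rewrite form_actD !form_mapD ex ey GactD.
- by move=> i _; rewrite form_actZ !form_mapZ eB Gact_base.
Qed.

Lemma has_length_rsim V n (W : mx_representation k [set: gT]%G n) l : mx_rsim W V ->
  has_length (tuning_span V (A:=A)) (@int_vectors _ _ d A) l ->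
  has_length (tuning_span W (A:=A)) (@int_vectors _ _ n A) l.
Proof.
case=> B nd; subst n; rewrite row_free_unit => uB WB.
apply: (has_length_coord_change (B := invmx B)); first by rewrite unitmx_inv.
have {}WB g : W g = B *m V g *m invmx B by rewrite -WB ?inE // mulmxK.
move=> c; split=> -[Ic ec]; split.
- exact: int_coord_change.
- move=> g u; rewrite !form_map_coord -ec; congr (form_map c _).
  by rewrite /form_act WB !mulmxA mulmxKV.
- by rewrite -[c](coord_changeVK uB); apply: int_coord_change.
- move=> g u; have := ec g (u *m B); rewrite !form_map_coord mulmxK // => <-.
  by congr (form_map c _); rewrite /form_act WB !mulmxA.
Qed.

End Coordinates.

(** * The length at a field extension *)

Section ExtensionLength.
Variables (p m : nat) (k : closedFieldType) (z : k).
Variables (gT : finGroupType) (sigma tau : gT) (a : nat) (gamma : int).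
Hypotheses (p_prime : prime p) (p'm : ~~ (p %| m)%N) (char_k : p \in [pchar k])
  (z_prim : m.-primitive_root z)
  (G_sdprod : (<[sigma]> ><| <[tau]> = [set: gT])%g)
  (order_sigma : #[sigma]%g = p) (order_tau : #[tau]%g = m)
  (G_rel : (tau * sigma * tau^-1 = sigma ^+ a)%g)
  (gamma_unit : coprimez gamma m%:Z).
Variables (E : Gextension k gT) (d : nat) (s : int).
Variable V : mx_representation k [set: gT]%G d.

Local Notation A := (Gext_algebra E).

(** For the converse, [tau] is prescribed on [x_1] only; its equivariance passes from [x_i] to
    [x_(i+1) = sigma x_i - x_i] by the relation [tau sigma = sigma^a tau]. As [sigma] and [tau]
    generate the group, this suffices. *)
Lemma tuning_jordan_tuple (Y : 'M[k]_d) (c : 'cV[A]_d) : Y \in unitmx ->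
    (forall i j : 'I_d, j = i.+1 :> nat ->
       form_act V sigma (row i Y) = row i Y + row j Y) ->
    (forall i : 'I_d, i.+1 = d -> form_act V sigma (row i Y) = row i Y) ->
    (forall i : 'I_d, i = 0%N :> nat -> form_act V tau (row i Y) = z ^ s *: row i Y) ->
  tuning_module V (A := A) c <->
  jordan_tuple (gext_act E sigma) (gext_act E tau) (z ^ s)
    (coord_change (A := A) Y c).
Proof.
move=> uY YS Ylast Y0; set x := coord_change (A := A) Y c.
have xE i : x i 0 = form_map (A := A) c (row i Y) := coord_changeE _ _ _.
split=> [[Ic ec] | [Ix xS xlast x0]].
  split=> [|i j ij|i i_d|i i0].
  - exact: int_coord_change.
  - have := ec sigma (row i Y); rewrite (YS i j ij) form_mapD -!xE => e.
    by apply/esym/eqP; rewrite subr_eq addrC; apply/eqP/esym/e.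
  - have := ec sigma (row i Y); rewrite (Ylast i i_d) -!xE => e.
    by apply/eqP; rewrite subr_eq0; apply/eqP/esym/e.
  - have := ec tau (row i Y); rewrite (Y0 i i0) form_mapZ -!xE => e.
    exact/esym/e.
have sigma_eq : equivariant V (A := A) c sigma.
  apply: (equivariant_basis uY) => i.
  have := ltn_ord i; rewrite leq_eqVlt => /predU1P[i_d | lt_id].
    by rewrite (Ylast i i_d) -!xE; apply/esym/eqP; rewrite -subr_eq0; apply/eqP/xlast.
  rewrite (YS i (Ordinal lt_id) erefl) form_mapD -!xE (xS i (Ordinal lt_id) erefl).
  by rewrite addrC subrK.
have tau_eq : equivariant V (A := A) c tau.
  apply: (equivariant_basis uY) => -[i lt_id]; elim: i lt_id => [|i IHi] lt_id.
    by rewrite Y0 // form_mapZ -!xE; apply/esym/x0.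
  set j := Ordinal lt_id; pose i' := Ordinal (ltnW lt_id); have {}IHi := IHi (ltnW lt_id).
  have Yj : form_act V sigma (row i' Y) = row i' Y + row j Y by apply: YS.
  have tau_sigma : (tau * sigma = sigma ^+ a * tau)%g by rewrite -G_rel mulgKV.
  apply: (addrI (form_map (A := A) c (form_act V tau (row i' Y)))).
  rewrite -form_mapD -form_actD -Yj -form_actM tau_sigma form_actM.
  rewrite (equivariantX a sigma_eq) IHi -GactM -tau_sigma GactM -sigma_eq Yj.
  by rewrite form_mapD GactD.
split; first by rewrite -[c](coord_changeK (A := A) uY); apply: int_coord_change.
move=> g; have [i [j ->]] := sdprod_elements G_sdprod g.
by apply: equivariantM; apply: equivariantX.
Qed.

Hypothesis E_gamma : has_gamma sigma tau m z gamma E.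
Hypothesis V_ds : is_Vds V p z sigma tau s.

(** The least [n] with [m p n + p i - r j >= 0], in the form of the ceiling in [v_formula]. *)
Definition min_exponent r (j : 'I_d) (i : nat) : int :=
  Num.ceil ((- (i * p)%:R + (j * r)%:R) / (m * p)%:R : rat).

Lemma has_length_extension : exists D,
  has_length (tuning_span V (A := A)) (@int_vectors _ _ d A) D /\
  (#|gT|%:R^-1 * D%:R : rat) = v_formula p m d gamma (last_jump E) s.
Proof.
have [r [alpha [beta [u X]]]] := exists_artin_schreier_data p_prime p'm char_k z_prim
  G_sdprod order_sigma order_tau G_rel gamma_unit E_gamma.
have -> : last_jump E = r := last_jumpE p_prime p'm char_k z_prim G_sdprod order_sigma
  order_tau gamma_unit X.
have [/andP[d_gt0 le_dp] [Y [uY YS Ylast Y0]]] := V_ds.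
have m_gt0 := prim_order_gt0 z_prim; have p_gt0 := prime_gt0 p_prime.
have mp_gt0 : (0 < m * p)%N by rewrite muln_gt0 m_gt0.
pose ii := @index_of m d r gamma s m_gt0.
pose nn j := min_exponent r j (ii j).
have z0 := prim_root_neq0 z_prim.
(* The right-hand side is [z^(gamma (i - r j))], so this is the congruence of the index set
   multiplied by [gamma]. *)
have ii_eigen (i : 'I_m) (j : 'I_d) :
    z ^ s = (z ^ gamma) ^+ i * ((z ^ gamma) ^- r) ^+ j <-> i = ii j.
  have -> : (z ^ gamma) ^+ i * ((z ^ gamma) ^- r) ^+ j = z ^ (gamma * (i%:Z - r%:Z * j%:Z)).
    rewrite mulrBr expfzDr // exprnP exprz_exp; congr (_ * _).
    by rewrite exprVn -exprM exprnN exprz_exp mulrN PoszM.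
  apply: (iff_trans (rwP eqP)); rewrite (prim_root_exprz_eq _ _ z_prim).
  apply: (iff_trans _ (iff_sym (rwP eqP))); rewrite -index_ofP !eqz_mod_dvd.
  have /eqP := inv_modP gamma_unit; rewrite eqz_mod_dvd.
  move: (inv_mod m gamma) (i%:Z - r%:Z * j%:Z) => g w inv; split=> dvd_m.
    have -> : w - s * g = - g * (s - gamma * w) - w * (g * gamma - 1) by ring.
    by rewrite rpredB ?dvdz_mull.
  have -> : s - gamma * w = - gamma * (w - s * g) - s * (g * gamma - 1) by ring.
  by rewrite rpredB ?dvdz_mull.
have nn_min j l : 0 <= mval r l (ii j, widen_ord le_dp j) <-> nn j <= l.
  rewrite /nn /min_exponent ceil_le_int ler_pdivrMr ?ltr0n //.
  suff -> : (0 <= mval r l (ii j, widen_ord le_dp j)) =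
    (- (ii j * p)%:R + (j * r)%:R <= l%:~R * (m * p)%:R :> rat) by [].
  rewrite -[RHS]subr_ge0 -(ler0z rat) /mval /=; congr (0 <= _).
  by rewrite !rmorphB !rmorphD /= !rmorphM /= -!pmulrn ?natrM; ring.
(* As [i < m], the numerator exceeds [- m p]; a ceiling of a number above -1 is nonnegative. *)
have nn_ge0 j : 0 <= nn j.
  rewrite /nn /min_exponent ceil_ge0 ltr_pdivlMr ?ltr0n // mulN1r.
  rewrite (@lt_le_trans _ _ (- (ii j * p)%:R)) ?lerDl ?ler0n //.
  by rewrite ltrN2 ltr_nat ltn_pmul2r.
exists (\sum_j pivot_weight p ii nn j)%N; split.
  apply: (@has_length_coord_change _ _ A d Y (tuning_module V (A := A))
    (jordan_tuple (d := d) (gext_act E sigma) (gext_act E tau) (z ^ s)) _ uY).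
    by move=> c; apply: (@tuning_jordan_tuple Y c uY YS Ylast Y0).
  have := jordan_length X ii_eigen nn_min nn_ge0.
  suff -> : tuning_column_span (gext_act E sigma) alpha beta le_dp ii nn
    = int_span (A := A)
        (jordan_tuple (d := d) (gext_act E sigma) (gext_act E tau) (z ^ s)) by [].
  (* Jordan tuples are combinations of the columns over [k[[t]]], so both span the same module over
     the integral closure. *)
  apply/seteqP; split=> c.
    case=> b b_int ->; exists d, b, (tuning_column (gext_act E sigma) alpha beta le_dp ii nn).
    by split=> // j; apply: (jordan_tuple_column X ii_eigen nn_min).
  case=> n [b [x [b_int x_jordan ->]]].
  pose f i := projT1 (cid (jordan_tuple_span X d_gt0 ii_eigen nn_min (x_jordan i))).
  have fE i : x i = \sum_j ring_emb E (f i j)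
      *: tuning_column (gext_act E sigma) alpha beta le_dp ii nn j.
    exact: projT2 (cid (jordan_tuple_span X d_gt0 ii_eigen nn_min (x_jordan i))).
  exists (fun j => \sum_i b i * ring_emb E (f i j)) => [j|].
    apply: big_ind => [||i _]; [exact: integral0 | exact: integral_add |].
    by apply: integral_mul; [apply: b_int | apply: integral_id].
  under [RHS]eq_bigr do rewrite scaler_suml.
  rewrite exchange_big; apply: eq_bigr => i _; rewrite fE scaler_sumr.
  by apply: eq_bigr => j _; rewrite scalerA.
(* Term by term, [(m p n + p i) / (m p) = i / m + n]. *)
rewrite /v_formula !(sum_index_set _ _ _ m_gt0) -big_split natr_sum mulr_sumr.
apply: eq_bigr => j _ /=; rewrite (card_sdprod_cycles G_sdprod order_sigma order_tau).
rewrite -/ii -/(min_exponent r j (ii j)) -/(nn j) /pivot_weight.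
have -> : `|((m * p)%:Z * nn j + (p * ii j)%:Z)%R|%N%:R
    = (m * p)%:R * (nn j)%:~R + (p * ii j)%:R :> rat.
  rewrite pmulrn gez0_abs ?addr_ge0 ?mulr_ge0 ?nn_ge0 //.
  by rewrite rmorphD rmorphM.
rewrite !natrM; field.
by rewrite !pnatr_eq0 -!lt0n m_gt0 p_gt0.
Qed.

End ExtensionLength.

Section IntegralSpan.
Variables (k : fieldType) (gT : finGroupType) (A : Galgebra k gT) (d : nat).
Implicit Types T : set 'cV[A]_d.

Lemma int_span_sub T : (T `<=` @int_columns _ A d)%classic ->
  (int_span T `<=` @int_columns _ A d)%classic.
Proof.
move=> T_int c [n [a [x [a_int Tx ->]]]] i; rewrite summxE.
apply: big_ind => [||j _]; [exact: integral0 | exact: integral_add |].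
by rewrite mxE; apply: integral_mul; [apply: a_int | apply: T_int].
Qed.

Lemma int_columns_submodule : fps_submodule (@int_columns _ A d).
Proof.
split=> [i|x y Ix Iy i|f x Ix i]; rewrite mxE.
- exact: integral0.
- by apply: integral_add; [apply: Ix | apply: Iy].
- by apply: integral_mul; [apply: integral_id | apply: Ix].
Qed.

Lemma has_length0_full T : (T `<=` @int_columns _ A d)%classic ->
  (@int_columns _ A d `<=` int_span T)%classic ->
  has_length (int_span T) (@int_columns _ A d) 0.
Proof.
move=> T_int T_gen.
have -> : int_span T = @int_columns _ A d by apply/seteqP; split=> //; apply: int_span_sub.
exact/has_length0/int_columns_submodule.
Qed.

Lemma int_spanD T x y : int_span T x -> int_span T y -> int_span T (x + y).
Proof.
move=> [n [a [v [a_int Tv ->]]]] [n' [a' [v' [a'_int Tv' ->]]]].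
pose b (i : 'I_(n + n')) := match split i with inl j => a j | inr j => a' j end.
pose w (i : 'I_(n + n')) := match split i with inl j => v j | inr j => v' j end.
exists (n + n')%N, b, w; split=> [i|i|]; rewrite /b /w; try by case: (split i).
rewrite big_split_ord; congr (_ + _); apply: eq_bigr => i _.
  by rewrite -[lshift _ _]/(unsplit (inl i)) unsplitK.
by rewrite -[rshift _ _]/(unsplit (inr i)) unsplitK.
Qed.

End IntegralSpan.

(** * The trivial torsor *)

Section TrivialTorsor.
Variables (k : fieldType) (gT : finGroupType) (A : Galgebra k gT) (d : nat).
Variable V : mx_representation k [set: gT]%G d.
Hypothesis A_trivial : trivial_torsor A.

(** In the algebra of functions on the group, the columns of the matrix [h |-> V h^-1] are tuning
    vectors. Its inverse [h |-> V h] is integral too, so these columns span all integral vectors. *)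
Lemma has_length_trivial_torsor :
  has_length (tuning_span V (A := A)) (@int_vectors _ _ d A) 0.
Proof.
have [phi [[psi phiK psiK] phi_lin phi1 phiM phi_act]] := A_trivial.
have phi0 h : phi 0 h = 0.
  have := phi_lin 1 0 0 h; rewrite scaler0 addr0 mul1r => e.
  by apply: (addrI (phi 0 h)); rewrite addr0 -e.
have phiD x y h : phi (x + y) h = phi x h + phi y h.
  by have := phi_lin 1 x y h; rewrite scale1r mul1r.
have phiZ b x h : phi (b *: x) h = b * phi x h.
  by have := phi_lin b x 0 h; rewrite addr0 phi0 addr0.
have phi_sum n (F : 'I_n -> A) h : phi (\sum_i F i) h = \sum_i phi (F i) h.
  exact: (big_morph (fun x => phi x h) (fun x y => phiD x y h) (phi0 h)).
have phi_inj x y : (forall h, phi x h = phi y h) -> x = y.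
  by move=> xy; apply: (can_inj phiK); apply/ffunP.
have phi_base c x h : phi (base_emb A c * x) h = tofrac (fps_const c) * phi x h.
  by rewrite /base_emb /ring_emb mulr_algl phiZ.
pose const (F : gT -> k) : A := psi [ffun h => tofrac (fps_const (F h))].
have phi_const F h : phi (const F) h = tofrac (fps_const (F h)) by rewrite psiK ffunE.
have const_int F : int_closure A (const F).
  (* Each component of [const F] is a root of one of the factors. *)
  pose P : {poly fps k} := \prod_h ('X - (fps_const (F h))%:P).
  exists P; first exact: monic_prod_XsubC.
  apply/rootP/phi_inj => h.
  rewrite /P rmorph_prod horner_prod phi0.
  rewrite (big_morph (fun x => phi x h) (fun x y => phiM x y h) (phi1 h)) (bigD1 h) //=.
  rewrite rmorphB /= map_polyX map_polyC /= hornerXsubC.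
  have -> : phi (const F - ring_emb A (fps_const (F h))) h = 0.
    rewrite -[ring_emb A _]mulr1 -[ring_emb A _]/(base_emb A _) -mulN1r -(rmorphN1 (base_emb A)).
    rewrite phiD !phi_base phi1 mulr1 phi_const !rmorphN1 mulN1r subrr //.
  by rewrite mul0r.
pose xi (j : 'I_d) : 'cV[A]_d := \col_i const (fun h => V h^-1%g i j).
have form_xi j u h : phi (form_map (xi j) u) h = tofrac (fps_const ((u *m V h^-1%g) 0 j)).
  rewrite phi_sum mxE !rmorph_sum; apply: eq_bigr => i _.
  by rewrite phi_base mxE phi_const !rmorphM.
apply: has_length0_full => [c [] // | b b_int].
(* The coefficients are the inverse matrix applied to [b]. *)
exists d, (fun j => \sum_i const (fun h => V h j i) * b i 0), xi; split=> [j|j|].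
- apply: big_ind => [||i _]; [exact: integral0 | exact: integral_add |].
  by apply: integral_mul; [apply: const_int | apply: b_int].
- split=> [i|g u]; first by rewrite mxE.
  apply: phi_inj => h; rewrite phi_act !form_xi; congr (tofrac (fps_const (_ 0 j))).
  by rewrite /form_act -mulmxA -repr_mxM ?inE // invMg.
apply/colP => i; apply: phi_inj => h; rewrite summxE phi_sum.
have VV l : \sum_j V h j l * V h^-1%g i j = (i == l)%:R.
  transitivity ((V h^-1%g *m V h) i l).
    by rewrite mxE; apply: eq_bigr => j _; rewrite mulrC.
  by rewrite -repr_mxM ?inE // mulVg repr_mx1 mxE.
transitivity (\sum_j \sum_l tofrac (fps_const (V h j l * V h^-1%g i j)) * phi (b l 0) h).
  rewrite exchange_big /= (bigD1 i) //= [X in _ + X]big1 ?addr0 => [|l neq_li].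
    by rewrite -mulr_suml -!rmorph_sum VV eqxx !rmorph1 mul1r.
  by rewrite -mulr_suml -!rmorph_sum VV eq_sym (negPf neq_li) !rmorph0 mul0r.
apply: eq_bigr => j _; rewrite 2!mxE phiM phi_sum phi_const mulr_suml.
apply: eq_bigr => l _; rewrite phiM phi_const !rmorphM.
by rewrite -!mulrA; congr (_ * _); rewrite mulrC.
Qed.

End TrivialTorsor.

(** * Direct sums of representations *)

Section DirectSum.
Variables (k : fieldType) (gT : finGroupType) (A : Galgebra k gT).
Implicit Types V W : representation k [set: gT]%G.

Lemma form_map_col (d1 d2 : nat) (c1 : 'cV[A]_d1) (c2 : 'cV[A]_d2) u1 u2 :
  form_map (col_mx c1 c2) (row_mx u1 u2) = form_map c1 u1 + form_map c2 u2.
Proof. by rewrite !form_mapE map_row_mx mul_row_col mxE. Qed.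

(** Testing on [row_mx u 0] and [row_mx 0 u] separates the two summands. *)
Lemma tuning_module_dadd V W (c1 : 'cV[A]_(rdegree V)) (c2 : 'cV[A]_(rdegree W)) :
  tuning_module (dadd_grepr V W) (col_mx c1 c2 : 'cV[A]_(rdegree (dadd_grepr V W))) <->
  tuning_module V c1 /\ tuning_module W c2.
Proof.
have act_row g u1 u2 : form_act (dadd_grepr V W) g (row_mx u1 u2)
    = row_mx (form_act V g u1) (form_act W g u2).
  by rewrite /form_act /= mul_row_block !mulmx0 addr0 add0r.
have form0 n (c : 'cV[A]_n) : form_map c 0 = 0.
  by rewrite form_mapE map_mx0 mul0mx mxE.
have act0 n (U : mx_representation k [set: gT]%G n) g : form_act U g 0 = 0.
  by rewrite /form_act mul0mx.
split=> [[Ic ec] | [[I1 e1] [I2 e2]]].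
  split; split=> [i|g u].
  - by have := Ic (lshift _ i); rewrite col_mxEu.
  - have := ec g (row_mx u 0); rewrite act_row !form_map_col act0 !form0 !addr0.
    by [].
  - by have := Ic (rshift _ i); rewrite col_mxEd.
  - have := ec g (row_mx 0 u); rewrite act_row !form_map_col act0 !form0 !add0r.
    by [].
split=> [i|g u].
  by rewrite mxE; case: splitP => j _; [apply: I1 | apply: I2].
by rewrite -[u]hsubmxK act_row !form_map_col GactD e1 e2.
Qed.

(** A vector is the sum of its two halves padded by 0, and 0 lies in every tuning module. *)
Lemma tuning_span_dadd V W : tuning_span (dadd_grepr V W) (A := A) =
  prod_set (tuning_span V (A := A)) (tuning_span W (A := A)).
Proof.
have tuning0 n (U : mx_representation k [set: gT]%G n) : tuning_module U (0 : 'cV[A]_n).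
  split=> [i|g u]; first by rewrite mxE; apply: integral0.
  by rewrite !form_mapE !mulmx0 mxE Gact0.
apply/seteqP; split=> [c [n [a [x [a_int x_tun ->]]]] | c [[n [a [x [a_int x_tun cE]]]]
    [n' [a' [x' [a'_int x'_tun c'E]]]]]].
  have x12 i : tuning_module V (usubmx (x i)) /\ tuning_module W (dsubmx (x i)).
    by apply/tuning_module_dadd; rewrite vsubmxK.
  split; rewrite linear_sum.
    exists n, a, (fun i => usubmx (x i)); split=> // [i|]; first by case: (x12 i).
    by apply: eq_bigr => i _; rewrite linearZ.
  exists n, a, (fun i => dsubmx (x i)); split=> // [i|]; first by case: (x12 i).
  by apply: eq_bigr => i _; rewrite linearZ.
have -> : c = col_mx (usubmx c) 0 + col_mx 0 (dsubmx c).
  by rewrite add_col_mx addr0 add0r vsubmxK.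
apply: int_spanD.
  exists n, a, (fun i => col_mx (x i) 0); split=> // [i|].
    by apply/tuning_module_dadd.
  rewrite cE (big_morph (fun y => col_mx y 0) (id1 := 0) (op1 := +%R)).
  - by apply: eq_bigr => i _; rewrite scale_col_mx scaler0.
  - by move=> y1 y2; rewrite add_col_mx addr0.
  - exact: col_mx0.
exists n', a', (fun i => col_mx 0 (x' i)); split=> // [i|].
  by apply/tuning_module_dadd.
rewrite c'E (big_morph (fun y => col_mx 0 y) (id1 := 0) (op1 := +%R)).
- by apply: eq_bigr => i _; rewrite scale_col_mx scaler0.
- by move=> y1 y2; rewrite add_col_mx addr0.
- exact: col_mx0.
Qed.

Lemma has_length_dadd V W n n' :
  has_length (tuning_span V (A := A)) (@int_vectors _ _ (rdegree V) A) n ->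
  has_length (tuning_span W (A := A)) (@int_vectors _ _ (rdegree W) A) n' ->
  has_length (tuning_span (dadd_grepr V W) (A := A))
    (@int_vectors _ _ (rdegree (dadd_grepr V W)) A) (n + n').
Proof.
move=> lenV lenW; rewrite tuning_span_dadd.
have -> : @int_vectors _ _ (rdegree (dadd_grepr V W)) A
    = prod_set (@int_vectors _ _ (rdegree V) A) (@int_vectors _ _ (rdegree W) A).
  apply/seteqP; split=> c => [Ic | [I1 I2] i].
    by split=> i; rewrite mxE; apply: Ic.
  rewrite -[c]vsubmxK mxE; case: splitP => j _; [exact: I1 | exact: I2].
exact: has_length_prod.
Qed.

Lemma has_length_dsum (l : nat) (d_ : 'I_l -> nat)
    (V_ : forall i, mx_representation k [set: gT]%G (d_ i)) (D : 'I_l -> nat) :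
  (forall i, has_length (tuning_span (V_ i) (A := A)) (@int_vectors _ _ (d_ i) A) (D i)) ->
  let W := \big[(@dadd_grepr _ _ _)/(@grepr0 _ _ _)]_(i < l) Representation (V_ i) in
  has_length (tuning_span W (A := A)) (@int_vectors _ _ (rdegree W) A) (\sum_i D i).
Proof.
move=> lenV /=.
apply: (big_rec2 (fun W n => has_length (tuning_span (mx_repr_of_repr W) (A := A))
    (@int_vectors _ _ (rdegree W) A) n)).
  apply: has_length0_full => [c [] //|c _].
  exists 0%N, (fun=> 0), (fun=> 0); split; try by case.
  by apply/colP => -[].
move=> i W n _ lenW.
exact: (has_length_dadd (V := Representation (V_ i)) (lenV i) lenW).
Qed.

End DirectSum.

Lemma v_functionE (k : fieldType) (gT : finGroupType) (A : Galgebra k gT) (d : nat)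
    (V : mx_representation k [set: gT]%G d) n :
  has_length (tuning_span V (A := A)) (@int_vectors _ _ d A) n ->
  v_function V A = (#|gT|%:R^-1 * n%:R : rat)%:E.
Proof. by move=> lenV; rewrite /v_function (quotient_lengthE lenV). Qed.

Theorem theorem1p1 (p m : nat) (k : closedFieldType) (zeta : nat -> k)
    (gT : finGroupType) (sigma tau : gT) (a : nat) (gamma : int)
    (p_prime : prime p) (p_ndvd_m : ~~ (p %| m)%N) (char_k : p \in [pchar k])
    (zeta_prim : forall n, ~~ (p %| n)%N -> n.-primitive_root (zeta n))
    (zeta_compat : forall m' n, ~~ (p %| m' * n)%N ->
       zeta (m' * n)%N ^+ n = zeta m')
    (G_sdprod : (<[sigma]> ><| <[tau]> = [set: gT])%g)
    (order_sigma : #[sigma]%g = p) (order_tau : #[tau]%g = m)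
    (G_rel : (tau * sigma * tau^-1 = sigma ^+ a)%g)
    (gamma_unit : coprimez gamma m%:Z) :
  [/\ forall (d r : nat) (s : int), #|index_set m d gamma r s| = d,
      forall (d : nat) (s : int) (V : mx_representation k [set: gT]%G d),
        is_Vds V p (zeta m) sigma tau s ->
        forall x : Delta sigma tau m (zeta m) gamma,
          (exists n : int, v_gamma V x = (n%:~R / m%:R)%:E) /\
          v_gamma V x =
            match x with
            | Delta_trivial _ _ => 0
            | Delta_ext E _ => v_formula p m d gamma (last_jump E) s
            end%:E
    & forall (l : nat) (d_ : 'I_l -> nat) (s_ : 'I_l -> int)
             (V_ : forall i, mx_representation k [set: gT]%G (d_ i))
             (n : nat) (V : mx_representation k [set: gT]%G n),
        (forall i, is_Vds (V_ i) p (zeta m) sigma tau (s_ i)) ->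
        mx_rsim V (\big[(@dadd_grepr _ _ _)/(@grepr0 _ _ _)]_(i < l)
                     Representation (V_ i)) ->
        forall x : Delta sigma tau m (zeta m) gamma,
          v_gamma V x = (\sum_(i < l) v_gamma (V_ i) x)%E].
Proof.
have z_prim := zeta_prim m p_ndvd_m; have m_gt0 := prim_order_gt0 z_prim.
have ext_length (d : nat) (s : int) (V : mx_representation k [set: gT]%G d)
    (E : Gextension k gT) := @has_length_extension p m k (zeta m) gT sigma tau a gamma p_prime
      p_ndvd_m char_k z_prim G_sdprod order_sigma order_tau G_rel gamma_unit E d s V.
(* Both kinds of points at once, with the length a natural number: the values are then finite and
   can be added in the rationals. *)
have len (d : nat) (s : int) (V : mx_representation k [set: gT]%G d)
    (x : Delta sigma tau m (zeta m) gamma) : is_Vds V p (zeta m) sigma tau s ->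
    exists D, has_length (tuning_span V (A := Delta_algebra x)) (@int_vectors _ _ d _) D /\
      #|gT|%:R^-1 * D%:R = match x with
        | Delta_trivial _ _ => 0
        | Delta_ext E _ => v_formula p m d gamma (last_jump E) s
        end :> rat.
  move=> V_ds; case: x => [A A_trivial | E E_gamma] /=; last exact: ext_length.
  by exists 0%N; split; [apply: has_length_trivial_torsor | rewrite mulr0].
split=> [d r s | d s V V_ds x | l d_ s_ V_ n V V_ds V_sum x].
- exact: card_index_set.
- have [D [lenD DE]] := len d s V x V_ds.
  rewrite /v_gamma (v_functionE lenD) DE; split; last by case: x {lenD DE}.
  case: x {lenD DE} => [A _ | E _]; first by exists 0; rewrite mul0r.
  pose r := last_jump E; rewrite /v_formula -/r.
  (* The formula multiplied by [m]. *)
  exists (\sum_(ij in index_set m d gamma r s) ij.1%:Z + m%:Z *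
    \sum_(ij in index_set m d gamma r s)
       Num.ceil ((- (ij.1 * p)%:R + (ij.2 * r)%:R) / (m * p)%:R : rat)).
  rewrite rmorphD rmorphM !rmorph_sum /= mulrDl mulrAC divff ?mul1r ?pnatr_eq0 -?lt0n //.
  by rewrite mulr_suml; congr ((_ + _)%:E); apply: eq_bigr => ij _.
pose D i := projT1 (cid (len _ _ (V_ i) x (V_ds i))).
have lenD i : has_length (tuning_span (V_ i) (A := Delta_algebra x))
    (@int_vectors _ _ (d_ i) _) (D i).
  by have [] := projT2 (cid (len _ _ (V_ i) x (V_ds i))).
have lenV := has_length_rsim V_sum (has_length_dsum lenD).
rewrite /v_gamma (v_functionE lenV).
rewrite natr_sum mulr_sumr -sumEFin; apply: eq_bigr => i _.
by rewrite (v_functionE (lenD i)).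
Qed.
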